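(* Let $f:M\to M$ be a $C^{r}$ ($r>1$) map on a compact Riemannian manifold $M$, and let $\bar\eta=\{\eta_m\}_{m\ge1}$ be any sequence of positive real numbers converging to $0$. Let $\{\mu_n\}_{n\ge1}\subseteq\mathcal P_{\bar\eta}(f)$ be a sequence of measures such that $\lim_{n\to\infty}\mu_n=\mu$ in the weak$^*$ topology. Then $$e_f(\mu)\ \ge\ \limsup_{n\to\infty}e_f(\mu_n).$$
   Context: $\mathcal P(M)$ is the set of Borel probability measures on $M$ with the weak$^*$ topology. Folding entropy: let $\epsilon=\{\{x\}\}_{x\in M}$ be the partition into points and $f^{-1}\epsilon=\{f^{-1}\{x\}\}_{x\in M}$ the partition into preimage sets. For $\mu\in\mathcal P(M)$, $F_f(\mu)=H_\mu(\epsilon\mid f^{-1}\epsilon)=\int_M H_{\tilde\mu_x}(\epsilon)\,d(f\mu)(x)$, where $f\mu=\mu\circ f^{-1}$ is the image measure, $\{\tilde\mu_x\}$ is the disintegration of $\mu$ along the sets $f^{-1}\{x\}$, and $H_{\tilde\mu_x}(\epsilon)$ is the entropy of the partition into points with respect to $\tilde\mu_x$ (equal to $-\sum_y \tilde\mu_x(\{y\})\log\tilde\mu_x(\{y\})$ if $\tilde\mu_x$ is purely atomic and $+\infty$ otherwise). Entropy production: $e_f(\mu)=F_f(\mu)-\int_M\log|\mathrm{Jac}(D_xf)|\,d\mu(x)$, where $\mathrm{Jac}(D_xf)$ is the Jacobian determinant of $D_xf$. Degenerate rate: $\Sigma_f=\{x\in M:\mathrm{Jac}(D_xf)=0\}$.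 Fix a decreasing sequence $\{V_m\}_{m\ge1}$ of open neighborhoods of $\Sigma_f$ with $d_H(V_m,\Sigma_f)\to0$, $d_H$ being the Hausdorff distance. Then $$\mathcal P_{\bar\eta}(f)=\Big\{\nu\in\mathcal P(M):\ \Big|\int_{V_m}\log|\mathrm{Jac}(D_xf)|\,d\nu(x)\Big|\le\eta_m\ \ \forall m\ge1\Big\}$$ (with $\log 0=-\infty$, so that $\nu(\Sigma_f)=0$ for $\nu\in\mathcal P_{\bar\eta}(f)$). *)

(* Defs.v *)
From HB Require Import structures.
From mathcomp Require Import all_boot all_order all_algebra.
From mathcomp Require Import all_classical all_reals all_analysis.
From mathcomp Require Import measurable_realfun.

Set Implicit Arguments.
Unset Strict Implicit.
Unset Printing Implicit Defensive.

Import Order.TTheory GRing.Theory Num.Theory.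
Import numFieldNormedType.Exports.

Local Open Scope classical_set_scope.
Local Open Scope ring_scope.

Section calculus.
Context {R : realType} {d : nat} {W : normedModType R}.
Implicit Types (O : set 'rV[R]_d) (F : 'rV[R]_d -> W).

(* [F] is [k] times differentiable on [O], and every partial derivative of
   order exactly [k] satisfies [P]. *)
Fixpoint diff_upto O (P : ('rV[R]_d -> W) -> Prop) (k : nat) F : Prop :=
  if k is k'.+1 then
    (forall y, O y -> differentiable F y) /\
    (forall i : 'I_d, diff_upto O P k' (fun y => 'D_(delta_mx 0 i) F y))
  else P F.

Definition continuous_on O F := forall y, O y -> {for y, continuous F}.

Definition locally_holder (alpha : R) O F :=
  forall y, O y -> exists C : R,
    \forall z1 \near y & z2 \near y,
      `|F z1 - F z2| <= C * `|z1 - z2| `^ alpha.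

Definition smooth_on O F := forall k, diff_upto O (continuous_on O) k F.

(* C^r for real [r >= 0]: with k the integer part of [r], the derivatives of
   order k are continuous, and locally (r - k)-Hoelder if [r] is not an
   integer. *)
Definition Cr_on (r : R) O F :=
  diff_upto O
    (fun G => continuous_on O G /\
       (r != (Num.truncn r)%:R -> locally_holder (r - (Num.truncn r)%:R) O G))
    (Num.truncn r) F.

End calculus.

Record chart (R : realType) (d : nat) (M : topologicalType) := Chart {
  chart_dom : set M ;
  chart_map : M -> 'rV[R]_d ;
  chart_inv : 'rV[R]_d -> M ;
  chart_dom_open : open chart_dom ;
  chart_img_open : open (chart_map @` chart_dom) ;
  chart_mapK : forall x, chart_dom x -> chart_inv (chart_map x) = x ;
  chart_map_cont : forall x, chart_dom x -> {for x, continuous chart_map} ;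
  chart_inv_cont : forall y, (chart_map @` chart_dom) y ->
    {for y, continuous chart_inv}
}.

(* The map [f] read in the charts [a] (source) and [b] (target), and the open
   set on which this reading is meaningful. *)
Definition local_rep (R : realType) (d : nat) (M : topologicalType)
    (a b : chart R d M) (f : M -> M) : 'rV[R]_d -> 'rV[R]_d :=
  fun y => chart_map b (f (chart_inv a y)).

Definition local_dom (R : realType) (d : nat) (M : topologicalType)
    (a b : chart R d M) (f : M -> M) : set 'rV[R]_d :=
  chart_map a @` (chart_dom a `&` f @^-1` chart_dom b).

(* A smooth structure is given by an atlas indexed by the points of [M], the
   chart of index [x] being defined around [x]; every atlas can be reindexed
   in this way. *)
Record smooth_manifold (R : realType) (d : nat) (M : topologicalType) :=
  SmoothManifold {
    chart_at :> M -> chart R d M ;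
    manifold_hausdorff : hausdorff_space M ;
    manifold_second_countable : @second_countable M ;
    chart_at_dom : forall x, chart_dom (chart_at x) x ;
    transition_smooth : forall a b,
      smooth_on (local_dom (chart_at a) (chart_at b) id)
                (local_rep (chart_at a) (chart_at b) id)
  }.

(* [gram a y] is the Gram matrix of the metric in the coordinates of the chart
   of index [a], at the point of coordinates [y].  Tangent vectors are row
   vectors, on which a differential acts by [v |-> v *m 'J F y]. *)
Record riemannian_manifold (R : realType) (d : nat) (M : topologicalType) :=
  RiemannianManifold {
    manifold :> smooth_manifold R d M ;
    gram : M -> 'rV[R]_d -> 'M[R]_d ;
    gram_smooth : forall a,
      smooth_on (chart_map (manifold a) @` chart_dom (manifold a)) (gram a) ;
    gram_sym : forall a x, chart_dom (manifold a) x ->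
      let g := gram a (chart_map (manifold a) x) in g^T = g ;
    gram_posdef : forall a x, chart_dom (manifold a) x ->
      forall v : 'rV[R]_d, v != 0 ->
      0 < (v *m gram a (chart_map (manifold a) x) *m v^T) ord0 ord0 ;
    gram_change : forall a b x,
      chart_dom (manifold a) x -> chart_dom (manifold b) x ->
      let y := chart_map (manifold a) x in
      let J := jacobian (local_rep (manifold a) (manifold b) id) y in
      gram a y = J *m gram b (chart_map (manifold b) x) *m J^T
  }.

Section riemannian_distance.
Context {R : realType} {d : nat} {M : topologicalType}
  (g : riemannian_manifold R d M).
Local Open Scope ereal_scope.

Definition C1_curve (c : R -> M) : Prop :=
  continuous c /\
  forall a t, chart_dom (g a) (c t) ->
    derivable (chart_map (g a) \o c) t 1%R /\
    {for t, continuous (derive1 (chart_map (g a) \o c))}.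

Definition speed (c : R -> M) (t : R) : R :=
  let a := c t in
  let v := derive1 (chart_map (g a) \o c) t in
  Num.sqrt ((v *m gram g a (chart_map (g a) (c t)) *m v^T) ord0 ord0).

Definition arc_length (c : R -> M) : \bar R :=
  \int[lebesgue_measure]_(t in `[0%R, 1%R]) (speed c t)%:E.

(* A piecewise C^1 path is a list of consecutive C^1 arcs, each of them
   parametrized by [0, 1]; a C^1 arc on [0, 1] is the restriction of a C^1
   curve defined on the whole line. *)
Fixpoint joins (p : M) (cs : seq (R -> M)) (q : M) : Prop :=
  if cs is c :: cs' then
    [/\ C1_curve c, c 0%R = p & joins (c 1%R) cs' q]
  else p = q.

(* The distance is +oo between distinct connected components. *)
Definition riemannian_dist (p q : M) : \bar R :=
  ereal_inf [set \sum_(c <- cs) arc_length c | cs in [set cs | joins p cs q]].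

(* Suprema are taken in [0, +oo]: two empty sets are at distance 0, an empty
   set and a nonempty one at distance +oo. *)
Definition hausdorff_dist (A B : set M) : \bar R :=
  maxe 0 (maxe
    (ereal_sup [set ereal_inf [set riemannian_dist x y | y in B] | x in A])
    (ereal_sup [set ereal_inf [set riemannian_dist x y | x in A] | y in B])).

End riemannian_distance.

Definition Cr_map (R : realType) (d : nat) (M : topologicalType)
    (g : smooth_manifold R d M) (r : R) (f : M -> M) : Prop :=
  continuous f /\
  forall a b, Cr_on r (local_dom (g a) (g b) f) (local_rep (g a) (g b) f).

(* |Jac(D_x f)|: the absolute value of the determinant of D_x f in orthonormal
   bases of the tangent spaces at [x] and [f x].  A matrix E of an orthonormal
   basis satisfies E *m G *m E^T = 1%:M with G the Gram matrix, so that its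
   determinant is (\det G) ^ (-1/2) up to sign. *)
Definition abs_jac (R : realType) (d : nat) (M : topologicalType)
    (g : riemannian_manifold R d M) (f : M -> M) (x : M) : R :=
  let y := chart_map (g x) x in
  let z := chart_map (g (f x)) (f x) in
  `|\det (jacobian (local_rep (g x) (g (f x)) f) y)|
    * Num.sqrt (\det (gram g (f x) z)) / Num.sqrt (\det (gram g x y)).

Notation borel M := (g_sigma_algebraType (@open M)).

Section entropy.
Context {R : realType} {M : ptopologicalType}.
Local Open Scope ereal_scope.
Implicit Types (f : M -> M) (mu nu : probability (borel M) R).

Definition purely_atomic nu : Prop :=
  exists2 C : set (borel M), countable C & nu (~` C) = 0.

(* Entropy of the partition into points; [ln 0 = 0], so that points of
   measure 0 do not contribute. *)
Definition point_entropy nu : \bar R :=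
  if pselect (purely_atomic nu) then
    \esum_(y in [set: borel M])
      (- (fine (nu [set y]) * ln (fine (nu [set y]))))%:E
  else +oo.

(* Disintegrations of [mu] along the sets f^-1{x}. *)
Definition disintegration f mu (k : borel M -> probability (borel M) R) :
    Prop :=
  [/\ forall A : set (borel M), measurable A ->
        measurable_fun [set: borel M] (fun x => k x A),
      {ae pushforward mu (f : borel M -> borel M),
        forall x, k x (f @^-1` [set x]) = 1} &
      forall A : set (borel M), measurable A ->
        mu A = \int[pushforward mu (f : borel M -> borel M)]_x k x A].

(* Any two disintegrations agree almost everywhere, so that the set below has
   at most one element. *)
Definition folding_entropy f mu : \bar R :=
  get [set \int[pushforward mu (f : borel M -> borel M)]_x point_entropy (k x)
      | k in disintegration f mu].

Definition entropy_production (d : nat) (g : riemannian_manifold R d M) f mu :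
    \bar R :=
  folding_entropy f mu - \int[mu]_x lne (abs_jac g f x)%:E.

Definition critical_set (d : nat) (g : riemannian_manifold R d M) f : set M :=
  [set x | abs_jac g f x = 0%R].

(* The sequences indexed by m >= 1 in the mathematics are indexed by [nat]. *)
Definition shrinking_nbhs (d : nat) (g : riemannian_manifold R d M) f
    (V : nat -> set M) : Prop :=
  [/\ forall m, open (V m),
      forall m, critical_set g f `<=` V m,
      forall m, V m.+1 `<=` V m &
      (fun m => hausdorff_dist g (V m) (critical_set g f)) @ \oo --> 0].

Definition degenerate_rate (d : nat) (g : riemannian_manifold R d M) f
    (V : nat -> set M) (eta : nat -> R) : set (probability (borel M) R) :=
  [set nu | forall m,
    `| \int[nu]_(x in (V m : set (borel M))) lne (abs_jac g f x)%:E |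
      <= (eta m)%:E].

Definition weak_star_cvg (mus : nat -> probability (borel M) R) mu : Prop :=
  forall phi : M -> R, continuous phi ->
    (fun n => \int[mus n]_x (phi x)%:E) @ \oo --> \int[mu]_x (phi x)%:E.

End entropy.

(* Main.v *)
(* Off the critical set [f] is locally injective, so that the complement of the
   critical set splits into countably many Borel pieces [E i] on which [f] is
   injective; the disintegration of [nu] gives the point of the fibre over [x]
   lying in [E i] the mass [q i x], a Radon-Nikodym density.  By Gibbs'
   inequality a weight [v > 0] whose sum over the fibre of each [x] is at most
   [Theta x] satisfies
     F_f(nu) + 1 <= - int ln v dnu + int (Theta o f) dnu,
   with near equality for [nu = mu] when [v] and [Theta] are built from
   continuous approximations of the [q i] and of the indicators of the [E i].
   Such [v] and [Theta] are continuous, so minus [int ln |Jac|] the right-hand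
   side passes to the limit: away from the critical set by weak convergence, and
   on [V m] within a multiple of [eta m], provided [v >= delta |Jac|^A].

   The term [delta |Jac|^A] is allowed in [v] if the sums of [|Jac|^A] over the
   fibres are bounded, and this is where [r > 1] enters: two points [y <> y'] of
   a fibre satisfy [|Jac y|^n <= C |y - y'|] in a chart because the differential
   is Hoelder, hence the balls of radius proportional to [|Jac y|^n] around the
   points of a fibre are disjoint and comparing volumes gives [A = n d].

   Convergence of the [V m] for the Hausdorff distance becomes a topological
   statement through bump functions that are 1-Lipschitz for the Riemannian
   distance. *)
From HB Require Import structures.
Require Import Defs.
From mathcomp Require Import all_boot all_order all_algebra.
From mathcomp Require Import all_classical all_reals all_analysis.
From mathcomp Require Import measurable_realfun.
From mathcomp Require Import ring lra.
From mathcomp Require polyrcf.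
Set Implicit Arguments.
Unset Strict Implicit.
Unset Printing Implicit Defensive.
Import Order.TTheory GRing.Theory Num.Theory.
Import numFieldNormedType.Exports.
Local Open Scope classical_set_scope.
Local Open Scope ring_scope.

(** * Continuous approximation *)

(** The scheme works because one weight serves all measures: for fixed [v] and [Theta] the bound of
    Gibbs' inequality is linear in [nu], so both are tuned to [mu] alone and then applied to every
    [mus n]. The summand [delta |Jac|^A] is forced by there being infinitely many pieces: a weight
    made from the first [N] of them would vanish on the others, where [- ln v] would be infinite.
    With it, [- ln v] is at most a constant plus [- A ln |Jac|], an unbounded quantity that the rate
    does control; its price in [Theta] is [delta] times a bound for the fibre sums. That [mu] gives
    the critical set no mass has to be proved. The truncations [ln J0 - ln (max J c)] are continuous
    and their integrals are bounded uniformly in [n] and [c]; the bound passes to [mu], and monotone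
    convergence as [c] tends to 0 gives [mu S = 0] and the integrability of [ln J]. All entropies in
    play are then finite, so differences in the extended reals reduce to real arithmetic. The
    Hoelder estimate on two points of a fibre is used twice: for the fibre sums, and for local
    injectivity off the critical set. *)

Lemma bigcup_partial_unions {T : Type} (F : nat -> set T) :
  \bigcup_n \big[setU/set0]_(i < n) F i = \bigcup_n F n.
Proof.
apply/seteqP; split=> x.
  by move=> [n _]; rewrite -bigcup_mkord => -[k _ Fx]; exists k.
by move=> [n _ Fx]; exists n.+1 => //; rewrite -bigcup_mkord; exists n => /=.
Qed.

Lemma continuous_bigsum {R : realType} {M : topologicalType} (I : Type)
    (s : seq I) (F : I -> M -> R) :
  (forall i, continuous (F i)) -> continuous (fun x => \sum_(i <- s) F i x).
Proof.
move=> cF; elim: s => [|i s IH].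
  rewrite (_ : (fun _ => _) = cst 0); first by move=> x; exact: cvg_cst.
  by apply/funext => x; rewrite big_nil.
rewrite (_ : (fun _ => _) = (fun x => F i x + \sum_(j <- s) F j x)).
  by move=> x; apply: cvgD; [exact: cF|exact: IH].
by apply/funext => x; rewrite big_cons.
Qed.

Section borel_sets.
Context {R : realType} {M : ptopologicalType}.

Lemma open_borel (U : set M) : open U -> measurable (U : set (borel M)).
Proof. by move=> oU; apply: sub_sigma_algebra. Qed.

Lemma closed_borel (C : set M) : closed C -> measurable (C : set (borel M)).
Proof.
move=> cC; rewrite -(setCK C); apply: measurableC; apply: open_borel.
exact: closed_openC.
Qed.

Lemma continuous_borel_real (h : M -> R) :
  continuous h -> measurable_fun [set: borel M] (h : borel M -> R).
Proof.
move=> /continuousP ch; apply: (measurability _ (RGenOpens.measurableE R)).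
move=> _ [B [a [b Bab]] <-]; rewrite setTI.
by apply: open_borel; apply: ch; rewrite Bab; exact: interval_open.
Qed.

Lemma continuous_borel (f : M -> M) :
  continuous f -> measurable_fun [set: borel M] (f : borel M -> borel M).
Proof.
move=> /continuousP cf; apply: (measurability _ (erefl (@measurable _ (borel M)))).
move=> _ [B oB <-]; rewrite setTI.
by apply: open_borel; apply: cf.
Qed.

End borel_sets.

Section continuous_approximation.
Context {R : realType} {M : ptopologicalType}.
Hypotheses (M_hausdorff : hausdorff_space M) (M_compact : compact [set: M])
  (M_sc : @second_countable M).
Variable m : {finite_measure set (borel M) -> \bar R}.

Let T := borel M.

Lemma urysohn_bump (C U : set M) : closed C -> open U -> C `<=` U ->
  exists u : M -> R, [/\ continuous u, forall x, 0 <= u x <= 1,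
    forall x, C x -> u x = 1 & forall x, ~ U x -> u x = 0].
Proof.
move=> cC oU CU.
have nM : normal_space M by exact: compact_normal.
have d0 : ~` U `&` C = set0.
  by apply/seteqP; split => // x [/= nU /CU].
have /(uniform_separatorP (R := R)) := normal_uniform_separator nM (open_closedC oU) cC d0.
move=> [u [cu ur u0 u1]]; exists u; split=> //.
- by move=> x; have /ur := imageT u x; rewrite /= in_itv.
- by move=> x Cx; apply: u1; exists x.
- by move=> x nUx; apply: u0; exists x.
Qed.

(** Regularity puts around each point of [U] a basic open set whose closure stays in [U]; the basis
    is countable, so countably many such closures exhaust [U]. *)
Lemma open_Fsigma (U : set M) : open U ->
  exists2 C : nat -> set M, (forall n, closed (C n)) & U = \bigcup_n C n.
Proof.
move=> oU; have [B cB [Bo Bb]] := M_sc.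
have rM : regular_space M.
    by move=> x; apply: (@compact_regular _ x [set: M]) => //; exact: filterT.
have [->|/set0P[x0 Ux0]] := eqVneq U set0.
  by exists (fun=> set0); [move=> n; exact: closed0|rewrite bigcup0].
pose D := [set A | B A /\ closure A `<=` U].
have cD : countable D by apply: sub_countable cB; apply: subset_card_le => A [].
have UD x : U x -> exists2 A, D A & A x.
  move=> Ux.
  have nU : nbhs x U by exact: open_nbhs_nbhs.
  have [E nE EU] := rM x U nU.
  have [A /= [BA Ax] AE] := Bb x E nE.
  exists A => //; split=> //; apply: subset_trans EU; exact: closureS.
have [A0 DA0 _] := UD _ Ux0.
have /pfcard_geP [D0|[e]] := cD.
  by move: DA0; rewrite D0.
exists (fun n => closure (e n)); first by move=> n; exact: closed_closure.
apply/seteqP; split=> x.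
  move=> /UD [A DA Ax].
  have [n _ en] := @surj _ _ _ _ e _ DA.
  by exists n => //; apply: subset_closure; rewrite en.
move=> [n _ enx]; have [_] : D (e n) by exact: funS.
exact.
Qed.

(** Approximability in L1([m]) by continuous functions, with the constraint that these stay in
    [0, 1]; the fibre sums and the upper bounds of the weights built later rely on that
    constraint. *)
Definition appr (q : T -> R) := forall e : R, 0 < e ->
  exists u : M -> R, [/\ continuous u, forall x, 0 <= u x <= 1 &
    (\int[m]_x `|u x - q x|%:E <= e%:E)%E].

Let mabs (u q : T -> R) : measurable_fun [set: T] u ->
  measurable_fun [set: T] q ->
  measurable_fun [set: T] (fun x => `|u x - q x|%:E).
Proof.
move=> mu mq; apply/measurable_EFinP; apply: measurableT_comp => //.
exact: measurable_funB.
Qed.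

Lemma appr_limit (q : T -> R) : measurable_fun [set: T] q ->
  (forall e : R, 0 < e -> exists q' : T -> R,
     [/\ measurable_fun [set: T] q', appr q' &
        (\int[m]_x `|q' x - q x|%:E <= e%:E)%E]) ->
  appr q.
Proof.
move=> mq H e e0; have e20 : 0 < e / 2 by rewrite divr_gt0.
have [q' [mq' aq' q'q]] := H _ e20.
have [u [cu u01 uq']] := aq' _ e20; exists u; split=> //.
have mu := continuous_borel_real cu.
apply: (@le_trans _ _ (\int[m]_x (`|u x - q' x|%:E + `|q' x - q x|%:E))%E).
  apply: ge0_le_integral => //.
  - exact: mabs.
  - by apply: emeasurable_funD; exact: mabs.
  - by move=> x _; rewrite -EFinD lee_fin ler_distD.
rewrite ge0_integralD//; [|exact: mabs..].
by rewrite [e]splitr EFinD leeD.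
Qed.

Lemma appr_compl (q : T -> R) : appr q -> appr (fun x => 1 - q x).
Proof.
move=> aq e e0; have [u [cu u01 uq]] := aq _ e0.
exists (fun x => 1 - u x); split=> //.
- by move=> x; apply: continuousB; [exact: cvg_cst|exact: cu].
- by move=> x; have := u01 x; lra.
- rewrite (eq_integral (fun x : T => `|u x - q x|%:E)) // => x _; congr _%:E.
  by rewrite distrC; congr `|_|; ring.
Qed.

(** Serves for finite unions of sets: a maximum of approximants, unlike a sum, stays in [0, 1]. *)
Lemma appr_max (q q' : T -> R) : measurable_fun [set: T] q ->
  measurable_fun [set: T] q' -> appr q -> appr q' ->
  appr (fun x => Num.max (q x) (q' x)).
Proof.
move=> mq mq' aq aq' e e0; have e20 : 0 < e / 2 by rewrite divr_gt0.
have [u [cu u01 uq]] := aq _ e20.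
have [u' [cu' u'01 u'q']] := aq' _ e20.
exists (fun x => Num.max (u x) (u' x)); split=> //.
- by move=> x; apply: (@continuous_max R M); [exact: cu|exact: cu'].
- move=> x; have := u01 x; have := u'01 x => /andP[? ?] /andP[? ?].
  by rewrite le_max ge_max; apply/andP; split; [apply/orP; left|apply/andP].
have mu := continuous_borel_real cu.
have mu' := continuous_borel_real cu'.
apply: (@le_trans _ _ (\int[m]_x (`|u x - q x|%:E + `|u' x - q' x|%:E))%E).
  apply: ge0_le_integral => //.
  - by apply: mabs; exact: measurable_maxr.
  - by apply: emeasurable_funD; exact: mabs.
  - move=> x _; rewrite -EFinD lee_fin.
    rewrite ler_norml; case: (ler0P (u x - q x)); case: (ler0P (u' x - q' x));
    case: (leP (u x) (u' x)); case: (leP (q x) (q' x)); lra.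
rewrite ge0_integralD//; [|exact: mabs..].
by rewrite [e]splitr EFinD leeD.
Qed.

(** Finite unions [D n] of closed sets increase to [U], so the difference [U \ D n] has small
    measure for some [n]; a Urysohn function equal to 1 on [D n] and 0 off [U] errs only on that
    difference. *)
Lemma appr_open (U : set M) : open U -> appr (\1_(U : set T)).
Proof.
move=> oU e e0; have [C cC UC] := open_Fsigma oU.
pose D n := \big[setU/set0]_(i < n) C i.
have cD n : closed (D n) by apply: closed_bigsetU.
have DU n : D n `<=` U.
  by rewrite UC /D -bigcup_mkord; apply: bigcup_sub => i _; exact: bigcup_sup.
have mD n : measurable (D n : set T) by exact: closed_borel.
have UD : U = \bigcup_n D n.
  by rewrite UC bigcup_partial_unions.
have mU : measurable (U : set T) by exact: open_borel.
have : (m \o D) x @[x --> \oo] --> m U.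
  rewrite [in X in _ --> m X]UD; apply: nondecreasing_cvg_mu => //.
    by rewrite -UD.
  by apply/nondecreasing_seqP => n; rewrite subsetEset /D big_ord_recr; exact: subsetUl.
have fU : m U \is a fin_num by exact: fin_num_measure.
have fD n : m (D n) \is a fin_num by exact: fin_num_measure.
rewrite -(fineK fU) => /fine_cvgP[_] /cvgrPdist_le /(_ e e0) [N _ /(_ N (leqnn N))] /= HN.
have [u [cu u01 u1 u0]] := urysohn_bump (cD N) oU (DU N).
exists u; split=> //.
apply: (@le_trans _ _ (\int[m]_x (\1_(U `\` D N : set T) x)%:E)%E).
  apply: ge0_le_integral => //.
  - by apply: mabs; [exact: continuous_borel_real|exact: measurable_indic].
  - by apply/measurable_EFinP; apply: measurable_indic; exact: measurableD.
  move=> x _; rewrite lee_fin !indicE.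
  have [Dx|nDx] := pselect (D N x).
    by rewrite u1// (mem_set (DU _ _ Dx)) subrr normr0.
  have [Ux|nUx] := pselect (U x).
    rewrite (mem_set Ux) mem_set /=; last by split.
    by have /andP[? ?] := u01 x; rewrite distrC ger0_norm; lra.
  by rewrite u0// memNset// sub0r normrN normr0.
rewrite integral_indic//; last exact: measurableD.
rewrite setIT measureD// ?ltey_eq ?fU// (setIidr (DU N)).
have -> : (m U - m (D N))%E = (fine (m U) - fine (m (D N)))%:E.
  by rewrite EFinB !fineK.
exact: le_trans (ler_norm _) HN.
Qed.

(** The Borel sets with approximable indicator contain the open sets and form a sigma-algebra:
    complements through [1 - u], countable unions as increasing limits of finite ones. *)
Lemma appr_indic (A : set T) : measurable A -> appr (\1_A).
Proof.
pose G := [set A : set T | measurable A /\ appr (\1_A)].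
suff : (@measurable _ T) `<=` G by move=> + mA => /(_ _ mA) [].
apply: smallest_sub; last first.
  by move=> U oU; split; [exact: open_borel|exact: appr_open].
split.
- split; first exact: measurable0.
  rewrite (_ : \1_set0 = \1_(set0 : set M))//; apply: appr_open; exact: open0.
- move=> B [mB aB]; rewrite setTD; split; first exact: measurableC.
  rewrite (_ : \1_(~` B) = (fun x => 1 - \1_B x)); first exact: appr_compl.
  apply/funext => x; rewrite !indicE in_setC.
  by case: (x \in B) => /=; rewrite ?subrr ?subr0.
move=> F GF; have mF n : measurable (F n : set T) by case: (GF n).
split; first exact: bigcup_measurable.
pose D n : set T := \big[setU/set0]_(i < n) F i.
have mD n : measurable (D n) by apply: bigsetU_measurable.
have aD n : appr (\1_(D n)).
  rewrite /D; elim: n => [|n IH].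
    rewrite big_ord0 (_ : \1_set0 = \1_(set0 : set M))//; apply: appr_open; exact: open0.
  rewrite big_ord_recr /=.
  rewrite (_ : \1_(_ `|` _) = (fun x => Num.max (\1_(D n) x) (\1_(F n) x))).
    apply: appr_max => //; [exact: measurable_indic..|by case: (GF n)].
  apply/funext => x; rewrite !indicE in_setU -/(D n).
  case: (_ \in D n); case: (_ \in F n) => /=; rewrite ?maxxx//.
    by rewrite max_l// ler01.
  by rewrite max_r// ler01.
pose A0 : set T := \bigcup_n F n.
have mA : measurable A0 by exact: bigcup_measurable.
apply: appr_limit; first exact: measurable_indic.
move=> e e0.
have AD : A0 = \bigcup_n D n by rewrite /A0 /D bigcup_partial_unions.
have : (m \o D) x @[x --> \oo] --> m A0.
  rewrite [X in _ --> m X]AD; apply: nondecreasing_cvg_mu => //.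
    by rewrite -AD.
  by apply/nondecreasing_seqP => n; rewrite subsetEset /D big_ord_recr; exact: subsetUl.
have fA : m A0 \is a fin_num by exact: fin_num_measure.
have fD n : m (D n) \is a fin_num by exact: fin_num_measure.
rewrite -(fineK fA) => /fine_cvgP[_] /cvgrPdist_le /(_ e e0) [N _ /(_ N (leqnn N))] /= HN.
exists (\1_(D N)); split=> //.
have DA : D N `<=` A0 by rewrite AD; exact: bigcup_sup.
apply: (@le_trans _ _ (\int[m]_x (\1_(A0 `\` D N) x)%:E)%E).
  apply: ge0_le_integral => //.
  - by apply: mabs; exact: measurable_indic.
  - by apply/measurable_EFinP; apply: measurable_indic; exact: measurableD.
  move=> x _; rewrite lee_fin !indicE in_setD.
  have [Dx|nDx] := boolP (x \in D N).
    by rewrite mem_set ?subrr ?normr0//; apply: DA; rewrite -in_setE.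
  by case: (x \in A0); rewrite /= ?sub0r ?normrN ?normr1 ?normr0.
rewrite integral_indic//; last exact: measurableD.
rewrite setIT measureD// ?ltey_eq ?fA// (setIidr DA).
have -> : (m A0 - m (D N))%E = (fine (m A0) - fine (m (D N)))%:E.
  by rewrite EFinB !fineK.
exact: le_trans (ler_norm _) HN.
Qed.

Lemma appr_average (q : nat -> T -> R) n :
  (forall k, appr (q k)) -> (forall k, measurable_fun [set: T] (q k)) ->
  appr (fun x => (n.+1%:R)^-1 * \sum_(k < n.+1) q k x).
Proof.
move=> aq mq e e0.
pose u k := sval (cid (aq k e e0)).
have uP k : [/\ continuous (u k), forall x, 0 <= u k x <= 1 &
    (\int[m]_x `|u k x - q k x|%:E <= e%:E)%E] by exact: (svalP (cid (aq k e e0))).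
have n0 : 0 < n.+1%:R :> R by rewrite ltr0n.
exists (fun x => (n.+1%:R)^-1 * \sum_(k < n.+1) u k x); split.
- move=> x; apply: cvgM; first exact: cvg_cst.
  by apply: continuous_bigsum => k; case: (uP k).
- move=> x; rewrite mulr_ge0 ?invr_ge0 ?(ltW n0) ?sumr_ge0//=; last first.
    by move=> k _; have [_ /(_ x)/andP[]] := uP k.
  rewrite mulrC ler_pdivrMr// mul1r.
  rewrite (_ : n.+1%:R = \sum_(k < n.+1) (1 : R)); last by rewrite sumr_const card_ord.
  apply: ler_sum => k _.
  by have [_ /(_ x)/andP[]] := uP k.
have mu k := continuous_borel_real (let: And3 c _ _ := uP k in c).
apply: (@le_trans _ _ (\int[m]_x ((n.+1%:R)^-1%:E * \sum_(k < n.+1) `|u k x - q k x|%:E))%E).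
  apply: ge0_le_integral => //.
  - apply: mabs; apply: measurable_funM => //; exact: measurable_sum.
  - apply: emeasurable_funM => //; apply: emeasurable_sum => k; exact: mabs.
  move=> x _; rewrite sumEFin -EFinM lee_fin -mulrBr normrM ger0_norm ?invr_ge0 ?(ltW n0)//.
  by rewrite ler_pM2l ?invr_gt0// -sumrB ler_norm_sum.
have msum : measurable_fun [set: T] (fun x => (\sum_(k < n.+1) `|u k x - q k x|%:E)%E).
  by apply: emeasurable_sum => k; exact: mabs.
rewrite (ge0_integralZl m measurableT msum); last 2 first.
- by move=> x _; apply: sume_ge0.
- by rewrite lee_fin invr_ge0 (ltW n0).
rewrite ge0_integral_sum//; last by move=> k; exact: mabs.
rewrite lee_pdivrMl//.
apply: (@le_trans _ _ (\sum_(k < n.+1) e%:E)%E).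
  by apply: lee_sum => k _; case: (uP k).
by rewrite sumEFin -EFinM lee_fin sumr_const card_ord -[e *+ _]mulr_natl.
Qed.

(** The average of the indicators of the level sets [q >= (k+1)/(n+1)] is [q] rounded down to a
    multiple of [1/(n+1)]. The error is uniformly at most [1/(n+1)], and [n] is taken so large that
    the total mass divided by [n+1] is at most [e]. *)
Lemma appr_unit_interval (q : T -> R) : measurable_fun [set: T] q ->
  (forall x, 0 <= q x <= 1) -> appr q.
Proof.
move=> mq q01.
apply: appr_limit => // e e0.
have [n hn] : exists n : nat, fine (m [set: T]) / e <= n.+1%:R.
  exists (Num.truncn (fine (m [set: T]) / e)); apply/ltW/truncnS_gt.
have n0 : 0 < n.+1%:R :> R by rewrite ltr0n.
pose A k := [set x : T | k.+1%:R / n.+1%:R <= q x].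
have mA k : measurable (A k).
  by rewrite -[A k]setTI; apply: measurable_fun_le => //; exact: measurable_cst.
exists (fun x => (n.+1%:R)^-1 * \sum_(k < n.+1) \1_(A k) x); split.
- by apply: measurable_funM => //; apply: measurable_sum => k; exact: measurable_indic.
- by apply: (@appr_average (fun k => \1_(A k))) => k; [exact: appr_indic|exact: measurable_indic].
apply: (@le_trans _ _ (\int[m]_x (cst (n.+1%:R)^-1%:E x))%E).
  apply: ge0_le_integral => //.
    apply: mabs => //; apply: measurable_funM => //; apply: measurable_sum => k; exact: measurable_indic.
  move=> x _; rewrite lee_fin.
  pose j := Num.truncn (q x * n.+1%:R).
  have /andP[q0 q1] := q01 x.
  have qn0 : 0 <= q x * n.+1%:R by rewrite mulr_ge0// ltW.
  have /andP[j1 j2] := truncn_itv qn0; rewrite -/j in j1 j2.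
  have jn : (j <= n.+1)%N.
    by rewrite -(ler_nat R); apply: le_trans j1 _; rewrite ler_piMl// ltW.
  have -> : \sum_(k < n.+1) \1_(A k) x = j%:R :> R.
    transitivity (\sum_(k < n.+1) ((k < j)%N%:R : R)).
      apply: eq_bigr => k _; rewrite indicE; congr (_%:R).
      congr nat_of_bool; apply/idP/idP; rewrite in_setE /A /= ler_pdivrMr//.
        by move=> h; have := le_lt_trans h j2; rewrite ltr_nat ltnS.
      by move=> h; apply: le_trans j1; rewrite ler_nat.
    rewrite -natr_sum; congr (_%:R).
    rewrite -(big_mkord xpredT (fun k => (k < j)%N : nat)) (big_cat_nat _ jn)//=.
    rewrite (eq_big_nat _ _ (F2 := fun=> 1%N)); last by move=> i /andP[_ ->].
    rewrite [X in (_ + X)%N](eq_big_nat _ _ (F2 := fun=> 0%N)); last first.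
      by move=> i /andP[+ _]; rewrite leqNgt => /negbTE ->.
    by rewrite !sum_nat_const_nat muln0 addn0 muln1 subn0.
  rewrite -(ler_pM2r n0) mulVf ?gt_eqF// -{2}(ger0_norm (ltW n0)) -normrM.
  rewrite mulrBl mulrAC mulVf ?gt_eqF// mul1r distrC ger0_norm ?subr_ge0//.
  by move: j2; rewrite -natr1; lra.
rewrite integral_cst//.
have -> : ((n.+1%:R^-1)%:E * m [set: T] = (n.+1%:R^-1 * fine (m [set: T]))%:E)%E.
  by rewrite EFinM fineK// fin_num_measure.
rewrite lee_fin.
by rewrite mulrC ler_pdivrMr// mulrC -ler_pdivrMr.
Qed.

(** The L1 errors are summable, so the sum [S] of the pointwise errors is integrable, hence finite
    almost everywhere, and the terms of a convergent series tend to 0. The explicit rate is recorded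
    because it later bounds the integral of [Theta]. *)
Lemma continuous_ae_approximation (q : T -> R) : measurable_fun [set: T] q ->
  (forall x, 0 <= q x <= 1) ->
  exists h : nat -> M -> R, [/\ forall n, continuous (h n),
    forall n x, 0 <= h n x <= 1,
    forall n, (\int[m]_x `|h n x - q x|%:E <= ((4^-1) ^+ n)%:E)%E &
    {ae m, forall x, (h n x) @[n --> \oo] --> q x}].
Proof.
move=> mq q01.
have e0 n : 0 < (4^-1) ^+ n :> R by rewrite exprn_gt0.
have aq := appr_unit_interval mq q01.
pose h n := sval (cid (aq _ (e0 n))).
have hP n : [/\ continuous (h n), forall x, 0 <= h n x <= 1 &
  (\int[m]_x `|h n x - q x|%:E <= ((4^-1) ^+ n)%:E)%E] by exact: (svalP (cid (aq _ (e0 n)))).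
have mh n : measurable_fun [set: T] (fun x : T => `|h n x - q x|%:E).
  by apply: mabs => //; apply: continuous_borel_real; case: (hP n).
exists h; split; [by move=> n; case: (hP n)..|].
pose S (x : T) := (\sum_(0 <= n <oo) `|h n x - q x|%:E)%E.
have mS : measurable_fun [set: T] S.
  by apply: ge0_emeasurable_sum => // n x _ _; rewrite lee_fin.
have S0 x : (0 <= S x)%E by apply: nneseries_ge0.
have SI : (\int[m]_x S x < +oo)%E.
  rewrite integral_nneseries//.
  apply: (@le_lt_trans _ _ (\sum_(0 <= n <oo) ((4^-1) ^+ n)%:E)%E).
    apply: lee_nneseries => //.
    - by move=> n _ _; exact: integral_ge0.
    - by move=> n _; case: (hP n).
  rewrite (_ : (\sum_(0 <= n <oo) _)%E = (1 / (1 - 4^-1))%:E) ?ltry//.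
  apply/cvg_lim => //.
  rewrite (_ : (fun n => _) = EFin \o series (geometric 1 (4^-1))); last first.
    apply/funext => n /=; rewrite sumEFin; congr EFin.
    by rewrite /series /=; apply: eq_bigr => i _; rewrite /= mul1r.
  apply: cvg_EFin; first by apply: nearW.
  by apply: cvg_geometric_series; rewrite ger0_norm// invf_lt1 ?ltr1n.
have iS : m.-integrable [set: T] S.
  by apply/integrableP; split=> //; under eq_integral do rewrite gee0_abs//.
have := integrable_ae measurableT iS; apply: filterS => x /(_ I) Sx.
have : cvgn (series (fun n => `|h n x - q x|)).
  by apply: nnseries_is_cvg => //; rewrite -ge0_fin_numE// S0.
move=> /cvg_series_cvg_0 /norm_cvg0P /(cvgD (cvg_cst (q x))).
rewrite addr0; apply: cvg_trans; apply: near_eq_cvg; apply: nearW => n /=.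
by rewrite addrC subrK.
Qed.

End continuous_approximation.

(** * Integration against a density *)

Section density.
Context {d : measure_display} {T : measurableType d} {R : realType}.
Variables (nu m : {finite_measure set T -> \bar R}) (q : T -> \bar R).
Hypotheses (mq : measurable_fun [set: T] q) (q0 : forall x, (0 <= q x)%E)
  (nuq : forall A, measurable A -> nu A = (\int[m]_(x in A) q x)%E).

(** Change of variables is known for the chosen Radon-Nikodym derivative; [q] has the same integrals
    over all measurable sets, hence agrees with it [m]-almost everywhere. *)
Lemma density_integral (g : T -> \bar R) : measurable_fun [set: T] g ->
  (forall x, (0 <= g x)%E) -> (\int[nu]_x g x = \int[m]_x (g x * q x))%E.
Proof.
move=> mg g0.
have num : nu `<< m.
  apply/null_content_dominatesP => A mA mA0; rewrite nuq//.
  by apply: null_set_integral => //; exact: measurable_funTS.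
rewrite -(Radon_Nikodym_SigmaFinite.change_of_variables num)//.
apply: ge0_ae_eq_integral => //.
- apply: emeasurable_funM => //.
  exact: measurable_int (Radon_Nikodym_SigmaFinite.f_integrable num).
- by apply: emeasurable_funM.
- by move=> x _; rewrite mule_ge0// Radon_Nikodym_SigmaFinite.f_ge0.
- by move=> x _; rewrite mule_ge0.
apply: ae_eqe_mul2l; apply: integral_ae_eq => //.
- exact: Radon_Nikodym_SigmaFinite.f_integrable.
- move=> A _ mA; rewrite -nuq//.
  by rewrite -Radon_Nikodym_SigmaFinite.f_integral.
Qed.

End density.

(** * Folding entropy *)

(** Two nested families are kept. Closedness of [K n] makes images of Borel subsets Borel, and a
    bump function can equal 1 on [K n]; its support is confined to the open set [O n], on which [f]
    is still injective. *)
Record fiber_pieces (M : ptopologicalType) (f : M -> M) (S : set M)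
    (K O : nat -> set M) : Prop := FiberPieces {
  piece_closed : forall n, closed (K n) ;
  nbhd_open : forall n, open (O n) ;
  piece_sub : forall n, K n `<=` O n ;
  nbhd_inj : forall n, set_inj (O n) f ;
  piece_cover : \bigcup_n K n = ~` S }.

(** The basic open sets whose closure lies in an open set that misses [S] and on which [f] is
    injective are countably many, and by regularity they cover the complement of [S]. *)
Lemma fiber_pieces_exist (M : ptopologicalType) (f : M -> M) (S : set M) :
  hausdorff_space M -> compact [set: M] -> @second_countable M ->
  closed S ->
  (forall p, ~ S p -> exists U, [/\ open U, U p & set_inj U f]) ->
  exists K O, fiber_pieces f S K O.
Proof.
move=> hM cM [B cB [Bo Bb]] cS inj.
have rM : regular_space M.
  by move=> x; apply: (@compact_regular _ x [set: M]) => //; exact: filterT.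
pose good A := exists O, [/\ open O, closure A `<=` O, O `&` S = set0 & set_inj O f].
pose D := [set A | B A /\ good A].
have cD : countable D by apply: sub_countable cB; apply: subset_card_le => A [].
have DP p : ~ S p -> exists2 A, D A & A p.
  move=> nSp; have [U [oU Up iU]] := inj p nSp.
  pose O := U `&` ~` S.
  have oO : open O by apply: openI => //; exact: closed_openC.
  have nO : nbhs p O by apply: open_nbhs_nbhs; split.
  have [E nE EO] := rM p O nO.
  have [A /= [BA Ap] AE] := Bb p E nE.
  exists A => //; split=> //; exists O; split=> //.
  - by apply: subset_trans EO; exact: closureS.
  - by apply/seteqP; split => // x [[_ nS] Sx]; exact: nS.
  - by move=> x y xO yO; apply: iU; rewrite inE; [move: xO|move: yO]; rewrite inE => -[].
have [S0|/set0P[p0 nSp0]] := eqVneq (~` S) set0.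
  exists (fun=> set0), (fun=> set0); split.
  - by move=> _; exact: closed0.
  - by move=> _; exact: open0.
  - by move=> _.
  - by move=> _ x y; rewrite inE.
  - by rewrite bigcup0 ?S0.
have [A0 DA0 _] := DP _ nSp0.
have /pfcard_geP [D0|[e]] := cD; first by move: DA0; rewrite D0.
have De n : good (e n) by have [] : D (e n) by exact: funS.
pose O n := sval (cid (De n)).
have OP n : [/\ open (O n), closure (e n) `<=` O n, O n `&` S = set0 & set_inj (O n) f].
  exact: (svalP (cid (De n))).
exists (fun n => closure (e n)), O; split.
- by move=> n; exact: closed_closure.
- by move=> n; case: (OP n).
- by move=> n; case: (OP n).
- by move=> n; case: (OP n).
apply/seteqP; split=> x.
  move=> [n _ ex] Sx; have [_ + + _] := OP n => /(_ _ ex) Ox /seteqP[+ _].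
  by move=> /(_ x (conj Ox Sx)).
move=> /DP [A DA Ax]; have [n _ en] := @surj _ _ _ _ e _ DA.
by exists n => //; apply: subset_closure; rewrite en.
Qed.

Lemma cvg_bigsum {R : realType} {T : Type} (F : set_system T) {FF : Filter F}
    (I : Type) (s : seq I) (g : I -> T -> R) (l : I -> R) :
  (forall i, g i x @[x --> F] --> l i) ->
  (\sum_(i <- s) g i x) @[x --> F] --> \sum_(i <- s) l i.
Proof.
move=> cg; elim: s => [|i s IH].
  rewrite big_nil (_ : (fun _ => _) = cst 0); first exact: cvg_cst.
  by apply/funext => x; rewrite big_nil.
rewrite big_cons (_ : (fun _ => _) = (fun x => g i x + \sum_(j <- s) g j x)).
  by apply: cvgD; [exact: cg|exact: IH].
by apply/funext => x; rewrite big_cons.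
Qed.

Lemma measurable_invr {R : realType} : measurable_fun [set: R] (@GRing.inv R).
Proof.
have m0 : measurable [set~ 0 : R] by apply: measurableC; exact: measurable_set1.
rewrite -(setvU [set 0 : R]); apply/measurable_funU => //; split.
  apply: open_continuous_measurable_fun; first by apply: closed_openC;
    apply: accessible_closed_set1; apply: hausdorff_accessible; exact: Rhausdorff.
  by move=> x /set_mem /= /eqP x0; exact: inv_continuous.
have : measurable_fun [set (0 : R)] (cst (0 : R)) by [].
by apply: eq_measurable_fun => x; rewrite inE => ->; rewrite invr0.
Qed.

(** * Integrals of nonnegative functions that are not known to be measurable *)

Section nonmeasurable_integrand.
Context {d} {T : measurableType d} {R : realType}.
Variable mu : {measure set T -> \bar R}.

Lemma ge0_le_integral_any (f g : T -> \bar R) : (forall x, (0 <= f x)%E) ->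
  (forall x, (f x <= g x)%E) -> (\int[mu]_x f x <= \int[mu]_x g x)%E.
Proof.
move=> f0 fg; have g0 x : (0 <= g x)%E by exact: le_trans (f0 x) (fg x).
rewrite !ge0_integralE//; apply: le_ereal_sup => _ [h hf <-]; exists h => // x.
by apply: le_trans (hf x) _; rewrite !patch_setT.
Qed.

(** [f] lies between the functions obtained from [g] by putting 0 and [+oo] on a null set; both are
    measurable with the integral of [g], and monotonicity concludes. The intended [f] is
    [x |-> point_entropy (k x)], whose measurability is not at hand. *)
Lemma ge0_ae_eq_integral_any (f g : T -> \bar R) : (forall x, (0 <= f x)%E) ->
  (forall x, (0 <= g x)%E) -> measurable_fun [set: T] g ->
  {ae mu, forall x, f x = g x} -> (\int[mu]_x f x = \int[mu]_x g x)%E.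
Proof.
move=> f0 g0 mg [N [mN N0 NP]].
have fg x : ~ N x -> f x = g x by move=> Nx; apply: contrapT => h; apply: Nx; apply: NP.
pose b x := x \in N.
have mb : measurable_fun [set: T] b by apply: (measurable_fun_bool true); rewrite setTI;
  rewrite (_ : _ @^-1` _ = N)//; apply/seteqP; split=> x; [exact: set_mem|exact: mem_set].
have aeg (c : \bar R) : (0 <= c)%E ->
    (\int[mu]_x (if b x then c else g x) = \int[mu]_x g x)%E.
  move=> c0; apply: ge0_ae_eq_integral => //.
  - exact: measurable_fun_ifT.
  - by move=> x _; case: (b x).
  - exists N; split=> // x /=; apply: contra_notP => Nx _.
    by rewrite /b memNset.
apply/eqP; rewrite eq_le; apply/andP; split.
- rewrite -(aeg +oo%E)//; apply: ge0_le_integral_any => // x.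
  by rewrite /b; case: ifPn => [_|/negP Nx]; rewrite ?leey// fg// => Nx'; apply: Nx; rewrite inE.
- rewrite -(aeg 0%E)//; apply: ge0_le_integral_any => x; rewrite /b.
    by case: ifP.
  by case: ifPn => [_|/negP Nx]//; rewrite fg// => Nx'; apply: Nx; rewrite inE.
Qed.

End nonmeasurable_integrand.

Lemma atomic_probability {d} {T : measurableType d} {R : realType} (c : nat -> R)
    (s : nat -> T) : (forall i, 0 <= c i) -> (\sum_(0 <= i <oo) (c i)%:E = 1)%E ->
  exists P : probability T R,
    forall A, P A = (\sum_(0 <= i <oo) (c i)%:E * \d_(s i) A)%E.
Proof.
move=> c0 c1.
pose m : {measure set T -> \bar R} := mseries (fun i => mscale (NngNum (c0 i)) \d_(s i)) 0.
have m1 : m [set: T] = 1%E.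
  rewrite -c1 /m /mseries; apply: eq_eseriesr => i _.
  transitivity ((c i)%:E * (dirac (s i) [set: T] : \bar R))%E => //.
  by rewrite diracE in_setT mule1.
pose P : probability T R := HB.pack (Measure.sort m) (Measure_isProbability.Build _ _ _ m m1).
by exists P.
Qed.

(** * Disintegrations along fibres and two-sided bounds for the folding entropy *)

Section folding.
Context {R : realType} {M : ptopologicalType}.
Hypotheses (M_hausdorff : hausdorff_space M) (M_compact : compact [set: M]).
Variables (f : M -> M) (f_cont : continuous f) (S : set M) (S_closed : closed S).
Variables (K O : nat -> set M) (KO : fiber_pieces f S K O).

Let T := borel M.
Let E : nat -> set T := seqDU K.
Let fT : T -> T := f.

Lemma piece_borel n : measurable (E n).
Proof.
have mK i : measurable (K i : set T) by apply: closed_borel; exact: piece_closed KO i.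
by rewrite /E /seqDU; apply: measurableD => //; exact: bigsetU_measurable.
Qed.

Lemma piece_trivIset : trivIset [set: nat] E.
Proof. exact: trivIset_seqDU. Qed.

Lemma piece_bigcup : \bigcup_n E n = ~` S :> set T.
Proof. by rewrite -(piece_cover KO) (seqDU_bigcup_eq K). Qed.

Lemma piece_subK n : E n `<=` K n.
Proof. by move=> x []. Qed.

Lemma piece_inj n x y : E n x -> E n y -> f x = f y -> x = y.
Proof.
move=> /piece_subK/(piece_sub KO) Ox /piece_subK/(piece_sub KO) Oy.
by apply: (nbhd_inj KO (n := n)); rewrite inE.
Qed.

Lemma set1_borel (x : M) : measurable ([set x] : set T).
Proof. by apply: closed_borel; apply: accessible_closed_set1; exact: hausdorff_accessible. Qed.

Lemma f_borel : measurable_fun [set: T] fT.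
Proof. exact: continuous_borel. Qed.

Lemma fiber_borel (x : M) : measurable (fT @^-1` [set x]).
Proof. by rewrite -[X in measurable X]setTI; apply: f_borel => //; exact: set1_borel. Qed.

(* [f] maps the compact set [K n] homeomorphically onto its image. *)
Lemma image_piece_borel n (A : set T) : measurable A ->
  measurable (fT @` (E n `&` A)).
Proof.
have imgK : forall A : set T, measurable A -> measurable (fT @` (K n `&` A)).
  move=> B mB.
  pose G := [set B : set T | measurable (fT @` (K n `&` B))].
  suff : (@measurable _ T) `<=` G by exact.
  have cK (C : set M) : closed C -> measurable (fT @` (K n `&` C) : set T).
    move=> cC; apply: closed_borel; apply: compact_closed => //.
    apply: continuous_compact; first exact: continuous_subspaceT.
    by apply: subclosed_compact M_compact _ => //; apply: closedI => //; exact: (piece_closed KO).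
  have GC (B' : set T) : G B' -> G (~` B').
    move=> GB; rewrite /G /= (_ : _ @` _ = fT @` (K n `&` setT) `\` fT @` (K n `&` B')).
      by apply: measurableD => //; apply: (cK setT); exact: closedT.
    apply/seteqP; split=> [_ [x [Kx nBx] <-]|_ [[x [Kx _] <-] nB]].
      split; first by exists x.
      move=> [y [Ky By] fyx]; apply: nBx; rewrite -(_ : y = x)//.
      by apply: (nbhd_inj KO (n := n)); rewrite ?inE//; exact: (piece_sub KO).
    by exists x => //; split=> // Bx; apply: nB; exists x.
  apply: smallest_sub.
    split.
    - by rewrite /G /= setI0 image_set0; exact: measurable0.
    - by move=> A' GA; rewrite setTD; exact: GC.
    - move=> F GF; rewrite /G /= setI_bigcupr image_bigcup.
      by apply: bigcup_measurable => k _; exact: GF.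
  move=> U oU; rewrite -(setCK U); apply: GC; apply: cK.
  exact: open_closedC.
move=> mA; rewrite (_ : E n `&` A = K n `&` (E n `&` A)).
  by apply: imgK; apply: measurableI => //; exact: piece_borel.
by rewrite setIA (setIidr (@piece_subK n)).
Qed.

Section disintegrate.
Variables (nu : probability T R) (nuS : nu S = 0%E).

(** The image under [f] of the restriction of [nu] to [E n]. It is dominated by the image of [nu],
    and its density at [x] is the conditional mass of the point of [E n] above [x]. *)
Definition piece_image n : set T -> \bar R := fun A => nu (fT @^-1` A `&` E n).

Let mpre (A : set T) : measurable A -> measurable (fT @^-1` A).
Proof. by move=> mA; rewrite -[X in measurable X]setTI; exact: f_borel. Qed.

Let piece_image0 n : piece_image n set0 = 0%E.
Proof. by rewrite /piece_image preimage_set0 set0I measure0. Qed.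

Let piece_image_ge0 n A : (0 <= piece_image n A)%E.
Proof. exact: measure_ge0. Qed.

Let piece_image_sigma_additive n : semi_sigma_additive (piece_image n).
Proof.
move=> F mF tF mUF; rewrite /piece_image preimage_bigcup setI_bigcupl.
have mEF i : measurable (fT @^-1` F i `&` E n).
  by apply: measurableI; [exact: mpre|exact: piece_borel].
apply: measure_semi_sigma_additive => //; last exact: bigcup_measurable.
apply/trivIsetP => i j _ _ ij; rewrite setIACA setIid -preimage_setI.
by move/trivIsetP : tF => /(_ _ _ _ _ ij) ->//; rewrite preimage_set0 set0I.
Qed.

HB.instance Definition _ n := isMeasure.Build _ _ _ (piece_image n)
  (piece_image0 n) (piece_image_ge0 n) (@piece_image_sigma_additive n).

Let piece_image_fin n : fin_num_fun (piece_image n).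
Proof.
move=> A mA; apply: fin_num_measure; apply: measurableI; first exact: mpre.
exact: piece_borel.
Qed.

HB.instance Definition _ n := Measure_isFinite.Build _ _ _ (piece_image n)
  (@piece_image_fin n).

Definition f_mfun : {mfun T >-> T} := HB.pack fT (isMeasurableFun.Build _ _ _ _ fT f_borel).
Definition image_prob : probability T R := distribution nu f_mfun.

Lemma sum_pieces (A : set T) : measurable A ->
  (\sum_(0 <= i <oo) nu (E i `&` A) = nu A)%E.
Proof.
move=> mA; have mEA i : measurable (E i `&` A) by apply: measurableI => //; exact: piece_borel.
rewrite -measure_semi_bigcup//; last 2 first.
- apply/trivIsetP => i j _ _ ij; rewrite setIACA setIid.
  by have /trivIsetP -> := piece_trivIset; rewrite ?set0I.
- exact: bigcup_measurable.
have mS : measurable (S : set T) by exact: closed_borel.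
rewrite -setI_bigcupl piece_bigcup [RHS](measureDI nu mA mS)//.
rewrite [X in (_ + X)%E](_ : _ = 0%E) ?adde0 1?setIC ?setDE//.
apply/eqP; rewrite -measure_le0 -nuS; apply: le_measure; rewrite ?inE//.
exact: measurableI.
Qed.

Let dom n : piece_image n `<< image_prob.
Proof.
apply/null_content_dominatesP => A mA mA0.
apply/eqP; rewrite -measure_le0 -mA0; apply: le_measure; rewrite ?inE.
- by apply: measurableI; [exact: mpre|exact: piece_borel].
- exact: mpre.
- exact: subIsetl.
Qed.

(** The conditional measure over [x] is the sum of the Dirac masses at the points of the [E n] above
    [x], weighted by the densities [q n x]. Existence matters because [folding_entropy] is a [get],
    which would be arbitrary on an empty set. *)
Lemma disintegration_exists : exists k, disintegration f nu k.
Proof.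
pose q n := Radon_Nikodym_SigmaFinite.f (piece_image n) image_prob.
have q0 n x : (0 <= q n x)%E by exact: (Radon_Nikodym_SigmaFinite.f_ge0 (dom n) x).
have qfin n x : q n x \is a fin_num by exact: (Radon_Nikodym_SigmaFinite.f_fin_num (dom n) x).
have mq n : measurable_fun [set: T] (q n).
  exact: measurable_int (Radon_Nikodym_SigmaFinite.f_integrable (dom n)).
have mfE n A : measurable A -> measurable (fT @` (E n `&` A)) by exact: image_piece_borel.
(* The mass to be given to [E n] intersected with [A], written with the image of that set instead of
   a Dirac mass: images are Borel, so measurability in [x] does not go through the section [s]
   below. *)
pose t n A x : R := fine (q n x) * \1_(fT @` (E n `&` A)) x.
have t0 n A x : 0 <= t n A x by rewrite mulr_ge0// fine_ge0.
have mt n A : measurable A -> measurable_fun [set: T] (t n A).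
  move=> mA; apply: measurable_funM; last by apply: measurable_indic; exact: mfE.
  by apply: measurableT_comp => //.
have It n A B : measurable A -> measurable B ->
    (\int[image_prob]_(x in B) (t n A x)%:E = nu (E n `&` A `&` fT @^-1` B))%E.
  move=> mA mB.
  under eq_integral => x _.
    rewrite /t EFinM fineK//.
    rewrite (_ : (q n x * _)%E = (q n \_ (fT @` (E n `&` A))) x); last by rewrite epatch_indic.
    over.
  rewrite -integral_mkcondr -(Radon_Nikodym_SigmaFinite.f_integral (dom n))//; last first.
    by apply: measurableI => //; exact: mfE.
  rewrite /= /piece_image; congr (nu _); apply/seteqP; split=> y /=.
    move=> [[By [z [Ez Az] fzy]] Ey]; split=> //; split=> //.
    by rewrite -(piece_inj Ez Ey fzy).
  by move=> [[Ey Ay] By]; split=> //; split=> //; exists y.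
pose Z x := (\sum_(0 <= n <oo) (t n setT x)%:E)%E.
have mZ : measurable_fun [set: T] Z.
  apply: ge0_emeasurable_sum => [n x _ _|n _]; first by rewrite lee_fin.
  by apply/measurable_EFinP; exact: mt.
(* The total mass [Z] integrates over each [A] to the image measure of [A], because the pieces fill
   up the complement of the null set [S]. *)
have Z1 : {ae image_prob, forall x, Z x = 1%E}.
  have ZI A : measurable A -> (\int[image_prob]_(x in A) Z x = \int[image_prob]_(x in A) 1)%E.
    move=> mA; rewrite integral_nneseries//; last 2 first.
    - by move=> n; apply/measurable_EFinP; apply: measurable_funTS; exact: mt.
    - by move=> n x _; rewrite lee_fin.
    under eq_eseriesr => n _ do rewrite It// setIT.
    by rewrite sum_pieces ?integral_cst ?mul1e//; exact: mpre.
  have iZ : image_prob.-integrable [set: T] Z.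
    apply/integrableP; split=> //.
    have Z0 x : (0 <= Z x)%E by apply: nneseries_ge0 => n _ _; rewrite lee_fin.
    under eq_integral do rewrite gee0_abs//.
    rewrite ZI// integral_cst// mul1e.
    exact: le_lt_trans (probability_le1 _ measurableT) (ltry 1).
  have : ae_eq image_prob setT Z (cst 1%E).
    apply: integral_ae_eq => //.
    by move=> A _ mA; rewrite ZI.
  by apply: filterS => x /(_ I).
pose s n x : T := xget point [set y | E n y /\ f y = x].
have sP n x : (fT @` (E n `&` setT)) x -> E n (s n x) /\ f (s n x) = x.
  by move=> [y [Ey _] fy]; rewrite /s; case: xgetP => [z -> //|/(_ y) []].
have tE n A x : (t n A x)%:E = ((t n setT x)%:E * \d_(s n x) A)%E.
  rewrite /t diracE -EFinM -mulrA; congr (_ * _)%:E.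
  rewrite !indicE; have [fx|nfx] := boolP (x \in fT @` (E n `&` setT)); last first.
    rewrite mul0r memNset// => -[y [Ey Ay] fy].
    by move/negP : nfx; apply; rewrite inE; exists y.
  rewrite mul1r; congr (nat_of_bool _)%:R.
  have [Es fs] : E n (s n x) /\ f (s n x) = x by apply: sP; rewrite inE in fx.
  apply/idP/idP; rewrite !inE.
    move=> [y [Ey Ay] fy]; rewrite (_ : s n x = y)//; apply: (@piece_inj n) => //.
    by rewrite fs -fy.
  by move=> As; exists (s n x).
(* On the null set where the masses do not add up to 1, an arbitrary Dirac mass keeps [k x] a
   probability. *)
have kex x : exists P : probability T R, forall A : set T, P A =
    if Z x == 1%E then (\sum_(0 <= n <oo) (t n A x)%:E)%E else \d_(point : T) A.
  have [Zx|nZx] := eqVneq (Z x) 1%E; last by exists (\d_(point : T)).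
  have [P PE] := @atomic_probability _ T R (fun n => t n setT x) (fun n => s n x) (fun n => t0 n setT x) Zx.
  exists P => A; rewrite PE; apply: eq_eseriesr => n _.
  by rewrite -tE.
pose k x := sval (cid (kex x)).
have kE x A : k x A = if Z x == 1%E then (\sum_(0 <= n <oo) (t n A x)%:E)%E else \d_(point : T) A.
  exact: (svalP (cid (kex x))).
have msum A : measurable A -> measurable_fun [set: T] (fun x => (\sum_(0 <= n <oo) (t n A x)%:E)%E).
  move=> mA; apply: ge0_emeasurable_sum => [n x _ _|n _]; first by rewrite lee_fin.
  by apply/measurable_EFinP; exact: mt.
have mk A : measurable A -> measurable_fun [set: T] (fun x => k x A).
  move=> mA; under eq_fun do rewrite kE.
  apply: measurable_fun_ifT => //; last exact: msum.
  apply: (measurable_fun_bool true).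
  rewrite (_ : _ @^-1` _ = [set x | Z x = cst 1%E x]); first exact: measurable_eqe.
  by apply/seteqP; split => x /= => [/eqP|->]//; rewrite eqxx.
exists k; split=> //.
- apply: filterS Z1 => x Zx; rewrite kE Zx eqxx -[RHS]Zx; apply: eq_eseriesr => n _.
  rewrite tE; have [fx|nfx] := pselect ((fT @` (E n `&` setT)) x).
    have [Es fs] := sP _ _ fx; rewrite diracE mem_set ?mule1//.
  by rewrite /t indicE memNset// mulr0 mul0e.
- move=> A mA; rewrite -[LHS]sum_pieces//.
  transitivity (\int[image_prob]_x (\sum_(0 <= n <oo) (t n A x)%:E))%E.
    rewrite integral_nneseries//; last 2 first.
    - by move=> n; apply/measurable_EFinP; exact: mt.
    - by move=> n x _; rewrite lee_fin.
    by apply: eq_eseriesr => n _; rewrite It// preimage_setT setIT.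
  apply: ge0_ae_eq_integral => //; [exact: msum|exact: mk|..].
  - by move=> x _; apply: nneseries_ge0 => n _ _; rewrite lee_fin.
  - by apply: filterS Z1 => x Zx _; rewrite kE Zx eqxx.
Qed.

Lemma piece_image_integral n (g : T -> \bar R) : measurable_fun [set: T] g ->
  (forall x, (0 <= g x)%E) ->
  (\int[piece_image n]_x g x = \int[nu]_(y in E n) g (fT y))%E.
Proof.
move=> mg g0; have mE : measurable (E n) by exact: piece_borel.
have oo : (nu (E n) < +oo)%E by exact: le_lt_trans (probability_le1 _ mE) (ltry 1).
pose r : {finite_measure set T -> \bar R} := mfrestr mE oo.
transitivity (\int[pushforward r fT]_x g x)%E => //.
rewrite (ge0_integral_pushforward f_borel r)// preimage_setT.
have mgf : measurable_fun [set: T] (g \o fT) by apply: measurableT_comp => //; exact: f_borel.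
rewrite (@density_integral _ _ _ r nu (EFin \o \1_(E n)))//.
- rewrite [RHS]integral_mkcond; apply: eq_integral => x _.
  by rewrite epatch_indic.
- by apply/measurable_EFinP; exact: measurable_indic.
- by move=> x; rewrite lee_fin.
- by move=> A mA; rewrite integral_indic// setIC.
- by move=> x; exact: g0.
Qed.

(** [- ln (q n (f y))] for [y] in [E n] is the conditional information function of the partition
    into points; in this form the entropy is an integral against [nu] itself and can be compared
    pointwise with [- ln v]. *)
Definition folding_density (q : nat -> T -> R) := [/\
  forall n, measurable_fun [set: T] (q n),
  forall n x, 0 <= q n x <= 1,
  forall n (g : T -> \bar R), measurable_fun [set: T] g -> (forall x, (0 <= g x)%E) ->
    (\int[nu]_(y in E n) g (fT y) = \int[image_prob]_x (g x * (q n x)%:E))%E &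
  folding_entropy f nu =
    (\sum_(0 <= n <oo) \int[nu]_(y in E n) (- ln (q n (fT y)))%:E)%E].

(** A fibre meets each piece in at most one point and [S] has no mass, so [P] is carried by at most
    one atom per piece. *)
Lemma purely_atomic_entropy (P : probability T R) x :
  P (fT @^-1` [set x]) = 1%E -> P S = 0%E ->
  point_entropy P = (\sum_(0 <= n <oo)
    (- (fine (P (E n)) * ln (fine (P (E n)))))%:E)%E.
Proof.
move=> Px PS; pose F : set T := fT @^-1` [set x].
have mF : measurable F by exact: fiber_borel.
have mE n : measurable (E n) by exact: piece_borel.
have mS : measurable (S : set T) by exact: closed_borel.
have PFC : P (~` F) = 0%E by rewrite probability_setC// Px subee.
have EF n : E n `&` F = set0 \/ exists y, E n `&` F = [set y].
  have [->|/set0P[y [Ey Fy]]] := eqVneq (E n `&` F) set0; first by left.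
  right; exists y; apply/seteqP; split=> [z [Ez Fz]|z ->]; last by split.
  by apply: (@piece_inj n) => //; rewrite (_ : f z = x)// -(_ : f y = x).
have PE n : P (E n) = P (E n `&` F).
  rewrite [LHS](measureDI P (mE n) mF) [X in (X + _)%E](_ : _ = 0%E) ?add0e//.
  apply/eqP; rewrite -measure_le0 -PFC; apply: le_measure; rewrite ?inE.
  - exact: measurableD.
  - exact: measurableC.
  - by move=> y [].
have pure : purely_atomic P.
  exists (\bigcup_n (E n `&` F)).
    apply: bigcup_countable => // n _; have [->|[y ->]] := EF n; first exact: countable0.
    exact: countable1.
  apply/eqP; rewrite -measure_le0 -setI_bigcupl piece_bigcup setCI setCK.
  apply: le_trans (measureU2 _ _ _) _ => //; first exact: measurableC.
  have -> : (P S + P (~` F))%E = 0%E by transitivity (0 + 0 : \bar R)%E; [congr (_ + _)%E|rewrite adde0].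
  by [].
have eta0 (A : set T) : measurable A -> 0 <= - (fine (P A) * ln (fine (P A))).
  move=> mA; rewrite -mulrN mulr_ge0 ?fine_ge0// oppr_ge0 ln_le0//.
  by rewrite -lee_fin fineK ?fin_num_measure// probability_le1.
pose a (y : T) := (- (fine (P [set y]) * ln (fine (P [set y]))))%:E.
have a0 y : (0 <= a y)%E by rewrite lee_fin; apply: eta0; exact: set1_borel.
have atom0 y : ~ (\bigcup_n (E n `&` F)) y -> a y = 0%E.
  move=> ny; rewrite /a [P _](_ : _ = 0%E) ?mul0r ?oppr0//.
  have : ~ F y \/ S y.
    have [Fy|] := pselect (F y); last by left.
    right; apply: contrapT => nSy.
    have : (\bigcup_n E n) y by rewrite piece_bigcup.
    by move=> [n _ Ey]; apply: ny; exists n.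
  move=> [nF|Sy]; apply/eqP; rewrite -measure_le0.
    rewrite -PFC; apply: le_measure; rewrite ?inE; [exact: set1_borel|exact: measurableC|].
    by move=> _ ->.
  rewrite -PS; apply: le_measure; rewrite ?inE//; first exact: set1_borel.
  by move=> _ ->.
rewrite /point_entropy; case: pselect => [pP|//] /=.
rewrite nneseries_esumT; last by move=> n; rewrite lee_fin; exact: eta0.
transitivity (\esum_(y in \bigcup_n (E n `&` F)) a y)%E.
  rewrite [RHS]esum_mkcond; apply: eq_esum => y _.
  by case: ifPn => // /negP ny; apply: atom0 => By; apply: ny; rewrite inE.
rewrite esum_bigcupT//; last first.
  by apply: trivIset_setIr; exact: piece_trivIset.
apply: eq_esum => n _; rewrite PE; have [->|[y ->]] := EF n.
  by rewrite esum_set0 measure0 /= mul0r oppr0.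
by rewrite esum_set1.
Qed.

(** With [k] the disintegration behind the value of [get], take [q n x] to be [k x (E n)]. The
    entropy is then the integral of the sum of the [- q n * ln (q n)], and one factor [q n] is the
    density that moves the integral back to [E n]. *)
Lemma folding_density_exists : exists q, folding_density q.
Proof.
have [k0 dk0] := disintegration_exists.
have mE n : measurable (E n) by exact: piece_borel.
have [k [mk kf kd] Fk] : [set (\int[pushforward nu fT]_x point_entropy (k x))%E
    | k in disintegration f nu] (folding_entropy f nu).
  by apply: xgetPex; exists (\int[pushforward nu fT]_x point_entropy (k0 x))%E; exists k0.
have {}kf : {ae image_prob, forall x, k x (fT @^-1` [set x]) = 1%E} by exact: kf.
pose q n x := fine (k x (E n)).
have qE n x : k x (E n) = (q n x)%:E by rewrite fineK// fin_num_measure.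
have q01 n x : 0 <= q n x <= 1.
  by rewrite fine_ge0//= -lee_fin -qE probability_le1.
have mq n : measurable_fun [set: T] (q n).
  by apply: measurableT_comp => //; exact: mk.
have mS : measurable (S : set T) by exact: closed_borel.
have aeS : {ae image_prob, forall x, k x S = 0%E}.
  have : ae_eq image_prob setT (fun x => k x S) (cst 0%E).
    apply/ae_eq_integral_abs => //; first exact: mk.
    rewrite -[RHS]nuS kd//; apply: eq_integral => x _.
    by rewrite gee0_abs.
  by apply: filterS => x /(_ I).
have dens n A : measurable A ->
    (piece_image n A = \int[image_prob]_(x in A) (q n x)%:E)%E.
  move=> mA; rewrite /piece_image kd; last by apply: measurableI => //; exact: mpre.
  rewrite [RHS]integral_mkcond; apply: (ge0_ae_eq_integral (mu := image_prob)) => //.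
  - by apply: mk; apply: measurableI => //; exact: mpre.
  - by apply/(measurable_restrictT _ _).1 => //; apply: measurable_funTS; apply/measurable_EFinP.
  - by move=> x _; apply: erestrict_ge0 => y _; rewrite lee_fin; case/andP: (q01 n y).
  apply: filterS kf => x kx _.
  have mF : measurable (fT @^-1` [set x]) by exact: fiber_borel.
  have kxC : k x (~` (fT @^-1` [set x])) = 0%E by rewrite probability_setC// kx subee.
  rewrite patchE; case: ifPn => [|/negP] Ax.
    rewrite -qE [RHS](measureDI (k x) (mE n) (mpre mA)).
    rewrite [X in (X + _)%E](_ : _ = 0%E) ?add0e 1?setIC//.
    apply/eqP; rewrite -measure_le0 -kxC; apply: le_measure; rewrite ?inE.
    - by apply: measurableD => //; exact: mpre.
    - exact: measurableC.
    - move=> y [_ nA] fy; apply: nA; rewrite /= (_ : fT y = x)//.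
      by rewrite inE in Ax.
  apply/eqP; rewrite -measure_le0 -kxC; apply: le_measure; rewrite ?inE.
  - by apply: measurableI => //; exact: mpre.
  - exact: measurableC.
  - by move=> y [Ay _] fy; apply: Ax; rewrite inE -(_ : fT y = x).
have chg n (g : T -> \bar R) : measurable_fun [set: T] g -> (forall x, (0 <= g x)%E) ->
    (\int[nu]_(y in E n) g (fT y) = \int[image_prob]_x (g x * (q n x)%:E))%E.
  move=> mg g0; rewrite -piece_image_integral//.
  apply: density_integral => //.
  - exact/measurable_EFinP.
  - by move=> x; rewrite lee_fin; case/andP: (q01 n x).
  - exact: dens.
exists q; split=> //.
have eta0 n x : 0 <= - (q n x * ln (q n x)).
  have /andP[q0 q1] := q01 n x.
  by rewrite -mulrN mulr_ge0// oppr_ge0 ln_le0.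
have meta n : measurable_fun [set: T] (fun x => (- (q n x * ln (q n x)))%:E).
  apply/measurable_EFinP; apply: measurableT_comp => //; apply: measurable_funM => //.
  by apply: measurableT_comp => //; exact: measurable_ln.
rewrite -Fk.
transitivity (\int[image_prob]_x (\sum_(0 <= n <oo) (- (q n x * ln (q n x)))%:E))%E.
  (* Measurability is available only for the series; it agrees with the point entropy wherever [k x]
     is carried by its fibre and does not charge [S]. *)
  apply: (ge0_ae_eq_integral_any (mu := image_prob)).
  - move=> x; rewrite /point_entropy; case: pselect => [pP|nP] //=; apply: esum_ge0 => y _.
    rewrite lee_fin -mulrN mulr_ge0 ?fine_ge0// oppr_ge0 ln_le0//.
    by rewrite -lee_fin fineK ?fin_num_measure ?probability_le1//; exact: set1_borel.
  - by move=> x; apply: nneseries_ge0 => n _ _; rewrite lee_fin.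
  - by apply: ge0_emeasurable_sum => // n x _ _; rewrite lee_fin.
  - by apply: filterS2 kf aeS => x kx kS; apply: (purely_atomic_entropy kx kS).
rewrite integral_nneseries//; last by move=> n x _; rewrite lee_fin.
apply: eq_eseriesr => n _.
rewrite (chg n (fun x => (- ln (q n x))%:E)).
- by apply: eq_integral => x _; rewrite -EFinM mulNr mulrC.
- apply/measurable_EFinP; apply: measurableT_comp => //.
  by apply: measurableT_comp => //; exact: measurable_ln.
- by move=> x; rewrite lee_fin oppr_ge0 ln_le0//; case/andP: (q01 n x).
Qed.

Lemma integral_pieces (h : T -> \bar R) : measurable_fun [set: T] h ->
  (forall x, (0 <= h x)%E) ->
  (\int[nu]_x h x = \sum_(0 <= n <oo) \int[nu]_(x in E n) h x)%E.
Proof.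
move=> mh h0; have mS : measurable (S : set T) by exact: closed_borel.
rewrite -ge0_integral_bigcup//; last 3 first.
- exact: piece_borel.
- exact: measurable_funTS.
- exact: piece_trivIset.
rewrite piece_bigcup [RHS]integral_mkcond; apply: ge0_ae_eq_integral => //.
- apply/(measurable_restrictT _ _).1 => //; first exact: measurableC.
  exact: measurable_funTS.
- by move=> x _; apply: erestrict_ge0.
exists S; split=> // x /=; apply: contra_notP => nSx _.
by rewrite patchE mem_set.
Qed.

(** A sum over a possibly infinite fibre is bounded through its finite duplicate-free lists; the
    empty list makes [Theta] nonnegative everywhere. *)
Definition fiber_sum_le (v Theta : M -> R) := forall x (s : seq M),
  uniq s -> (forall y, y \in s -> f y = x) -> \sum_(y <- s) v y <= Theta x.

Let pre n x : M := xget point [set y | E n y /\ f y = x].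

Let preP n x : (fT @` (E n `&` setT)) x -> E n (pre n x) /\ f (pre n x) = x.
Proof.
by move=> [y [Ey _] fy]; rewrite /pre; case: xgetP => [z -> //|/(_ y) []].
Qed.

(* [transfer n v x] is the value of [v] at the point of the fiber over [x] lying in [E n]. *)
Let transfer n (v : M -> R) (x : T) : R :=
  if x \in fT @` (E n `&` setT) then v (pre n x) else 0.

Let transferE n v y : E n y -> transfer n v (fT y) = v y.
Proof.
move=> Ey; have fy : (fT @` (E n `&` setT)) (fT y) by exists y.
rewrite /transfer mem_set//; have [Ep fp] := preP fy.
by congr v; exact: piece_inj Ep Ey fp.
Qed.

Let transfer_borel n (v : M -> R) : measurable_fun [set: T] (v : T -> R) ->
  measurable_fun [set: T] (transfer n v).
Proof.
move=> mv _ B mB; rewrite setTI.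
have mC : measurable (fT @` (E n `&` (v : T -> R) @^-1` B)).
  by apply: image_piece_borel; rewrite -[X in measurable X]setTI; exact: mv.
have mD : measurable (~` (fT @` (E n `&` setT)) `&` (if 0 \in B then setT else set0)).
  apply: measurableI; first by apply: measurableC; exact: image_piece_borel.
  by case: ifP.
rewrite (_ : _ @^-1` B = fT @` (E n `&` (v : T -> R) @^-1` B) `|`
  (~` (fT @` (E n `&` setT)) `&` (if 0 \in B then setT else set0))).
  exact: measurableU.
apply/seteqP; split=> [x /=|x [[y [Ey By] <-]|[nx]]].
- rewrite /transfer; case: ifPn => [|/negP] fx Bx; last first.
    by right; split; [move=> fx'; apply: fx; rewrite inE|rewrite mem_set].
  rewrite inE in fx; have [Ep fp] := preP fx.
  by left; exists (pre n x).
- by rewrite /= transferE.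
- move=> B0x; rewrite /= (_ : transfer n v x = 0).
    by move: B0x; case: ifPn => // /set_mem.
  by rewrite /transfer; case: ifPn => // /set_mem.
Qed.

Let transfer_ge0 n v x : (forall y, 0 <= v y) -> 0 <= transfer n v x.
Proof. by move=> v0; rewrite /transfer; case: ifP. Qed.

Let transfer_sum v Theta x : (forall y, 0 <= v y) -> fiber_sum_le v Theta ->
  (\sum_(0 <= n <oo) (transfer n v x)%:E <= (Theta x)%:E)%E.
Proof.
move=> v0 vT; apply: lime_le; first by apply: is_cvg_nneseries => n _ _; rewrite lee_fin transfer_ge0.
apply: nearW => m; rewrite sumEFin lee_fin.
pose s := [seq pre n x | n <- [seq n <- iota 0 m | x \in fT @` (E n `&` setT)]].
apply: le_trans (vT x s _ _).
- rewrite /s big_map big_filter /index_iota subn0.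
  rewrite [leRHS]big_mkcond/=.
  by apply: ler_sum => n _; rewrite /transfer; case: ifP.
- rewrite map_inj_in_uniq ?filter_uniq ?iota_uniq// => i j.
  rewrite !mem_filter => /andP[fi _] /andP[fj _] eij.
  rewrite !inE in fi fj; have [Ei _] := preP fi; have [Ej _] := preP fj.
  apply: piece_trivIset => //.
  by exists (pre i x); split=> //; rewrite eij.
- by move=> y /mapP[n]; rewrite mem_filter => /andP[/set_mem/preP[_ fp] _] ->.
Qed.

(* Gibbs' inequality [- ln q <= - ln v + v / q - 1], integrated over the pieces. *)
Lemma gibbs_inequality (q : nat -> T -> R) (v Theta : M -> R) (B : R) :
  folding_density q ->
  measurable_fun [set: T] (v : T -> R) -> measurable_fun [set: T] (Theta : T -> R) ->
  1 <= B -> (forall y, 0 <= v y <= B) -> (forall y, ~ S y -> 0 < v y) ->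
  fiber_sum_le v Theta ->
  (folding_entropy f nu + (1 + ln B)%:E <=
   \int[nu]_y (ln (B / v y))%:E + \int[nu]_y (Theta (f y))%:E)%E.
Proof.
move=> [mq q01 qI ->] mv mT B1 vB vpos vT.
have B0 : 0 < B by exact: lt_le_trans ltr01 B1.
have v0 y : 0 <= v y by case/andP: (vB y).
have mE n : measurable (E n) by exact: piece_borel.
have T0 x : 0 <= Theta x by have := vT x [::]; rewrite big_nil; exact.
have c0 : 0 <= 1 + ln B by rewrite addr_ge0// ln_ge0.
pose a n (y : T) := - ln (q n (fT y)).
have a0 n y : 0 <= a n y by rewrite oppr_ge0 ln_le0//; case/andP: (q01 n (fT y)).
have ma n : measurable_fun [set: T] (a n).
  apply: measurableT_comp => //; apply: measurableT_comp; first exact: measurable_ln.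
  by apply: measurableT_comp => //; exact: f_borel.
have ml : measurable_fun [set: T] (fun y : T => (ln (B / v y))%:E).
  apply/measurable_EFinP; apply: measurableT_comp; first exact: measurable_ln.
  apply: measurable_funM => //.
  by apply: measurableT_comp => //; exact: measurable_invr.
(* The bound [B] on [v] is there for this sign: all integrands are nonnegative, so the extended
   integrals may be added and exchanged with series. It is paid for by [ln B] on the left. *)
have l0 y : (0 <= (ln (B / v y))%:E)%E.
  rewrite lee_fin; have [vy|vy] := eqVneq (v y) 0; first by rewrite vy invr0 mulr0 ln0.
  have vy0 : 0 < v y by rewrite lt_neqAle eq_sym vy v0.
  by rewrite ln_ge0// ler_pdivlMr// mul1r; case/andP: (vB y).
have sumc : ((1 + ln B)%:E = \sum_(0 <= n <oo) \int[nu]_(y in E n) (1 + ln B)%:E)%E.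
  rewrite -(integral_pieces (h := cst (1 + ln B)%:E))//.
  rewrite integral_cst// -[LHS]mule1; congr (_ * _)%E.
  exact/esym/probability_setT.
rewrite [X in (_ + X)%E]sumc -nneseriesD; last 2 first.
- by move=> n _ _; apply: integral_ge0 => y _; rewrite lee_fin a0.
- by move=> n _ _; apply: integral_ge0 => y _; rewrite lee_fin.
apply: (@le_trans _ _ (\sum_(0 <= n <oo) (\int[nu]_(y in E n) (ln (B / v y))%:E
   + \int[image_prob]_x (transfer n v x)%:E))%E).
  apply: lee_nneseries.
    move=> n _ _; apply: adde_ge0; apply: integral_ge0 => y _; rewrite lee_fin//.
    exact: a0.
  move=> n _; rewrite -ge0_integralD//; last 2 first.
  - by move=> y _; rewrite lee_fin; exact: a0.
  - by apply: measurable_funTS; apply/measurable_EFinP; exact: ma.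
  (* Where [q n] vanishes the majorant is set to [+oo]. This costs nothing, since [h] will be
     integrated against the density [q n] and [+oo * 0 = 0]. *)
  pose h (x : T) : \bar R := if q n x == 0 then +oo%E else (transfer n v x / q n x)%:E.
  have h0 x : (0 <= h x)%E.
    rewrite /h; case: ifP => // _; rewrite lee_fin mulr_ge0 ?transfer_ge0// invr_ge0.
    by case/andP: (q01 n x).
  have mh : measurable_fun [set: T] h.
    apply: measurable_fun_ifT => //.
      apply: (measurable_fun_bool true).
      rewrite (_ : _ @^-1` _ = [set x | (q n x)%:E = cst 0%E x]).
        by apply: measurable_eqe => //; apply/measurable_EFinP.
      by apply/seteqP; split => x /= => [/eqP->|[->]]//; rewrite eqxx.
    apply/measurable_EFinP; apply: measurable_funM; first exact: transfer_borel.
    by apply: measurableT_comp => //; exact: measurable_invr.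
  apply: (@le_trans _ _ (\int[nu]_(y in E n) ((ln (B / v y))%:E + h (fT y)))%E).
    apply: ge0_le_integral => //.
    - by move=> y _; rewrite -EFinD lee_fin addr_ge0//; exact: a0.
    - by apply: measurable_funTS; apply: emeasurable_funD => //; apply/measurable_EFinP; exact: ma.
    - apply: measurable_funTS; apply: emeasurable_funD => //.
      by apply: measurableT_comp => //; exact: f_borel.
    move=> y Ey; rewrite /h; case: ifPn => [_|q0]; first by rewrite addey// leey.
    rewrite transferE// -!EFinD lee_fin /a.
    have qp : 0 < q n (fT y) by rewrite lt_neqAle eq_sym q0; case/andP: (q01 n (fT y)).
    have vp : 0 < v y.
      by apply: vpos => Sy; have : (~` S) y by rewrite -piece_bigcup; exists n.
    rewrite lnM ?posrE ?invr_gt0// lnV ?posrE//.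
    have vq0 : 0 < v y / q n (fT y) by rewrite divr_gt0.
    have : ln (v y / q n (fT y)) <= v y / q n (fT y) - 1.
      have := @le_ln1Dx R (v y / q n (fT y) - 1).
      rewrite (_ : 1 + (v y / q n (fT y) - 1) = v y / q n (fT y)); last by ring.
      by apply; lra.
    rewrite lnM ?posrE ?invr_gt0// lnV ?posrE//; lra.
  rewrite ge0_integralD//; last 2 first.
  - exact: measurable_funTS.
  - by apply: measurable_funTS; apply: measurableT_comp => //; exact: f_borel.
  (* Passing to the image measure multiplies [h] by [q n] and cancels the denominator; what remains
     is [transfer n v], whose sum over [n] is at most [Theta]. *)
  rewrite leeD2l// qI//; apply: ge0_le_integral => //.
  - by move=> x _; rewrite mule_ge0// lee_fin; case/andP: (q01 n x).
  - by apply: emeasurable_funM => //; apply/measurable_EFinP.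
  - by apply/measurable_EFinP; exact: transfer_borel.
  move=> x _; rewrite /h; case: ifPn => [/eqP ->|q0].
    by rewrite mule0 lee_fin transfer_ge0.
  by rewrite -EFinM divfK.
rewrite nneseriesD; last 2 first.
- by move=> n _ _; exact: integral_ge0.
- by move=> n _ _; apply: integral_ge0 => x _; rewrite lee_fin transfer_ge0.
rewrite -integral_pieces// leeD2l// -integral_nneseries//; last 2 first.
- by move=> n; apply/measurable_EFinP; exact: transfer_borel.
- by move=> n x _; rewrite lee_fin transfer_ge0.
apply: (@le_trans _ _ (\int[image_prob]_x (Theta x)%:E)%E).
  apply: ge0_le_integral => //.
  - by move=> x _; apply: nneseries_ge0 => n _ _; rewrite lee_fin transfer_ge0.
  - apply: ge0_emeasurable_sum => [n x _ _|n _]; first by rewrite lee_fin transfer_ge0.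
    by apply/measurable_EFinP; exact: transfer_borel.
  - exact/measurable_EFinP.
  - by move=> x _; exact: transfer_sum.
rewrite (ge0_integral_pushforward f_borel nu)//; first exact/measurable_EFinP.
by move=> x _; rewrite lee_fin.
Qed.

(** Injectivity on [O'] leaves at most one nonzero term in the sum. *)
Let bump_sum (O' : set M) (c : M -> R) x (s : seq M) : set_inj O' f ->
  (forall y, 0 <= c y <= 1) -> (forall y, ~ O' y -> c y = 0) ->
  uniq s -> (forall y, y \in s -> f y = x) -> \sum_(y <- s) c y <= 1.
Proof.
move=> iO c01 cO us fs.
have [/hasP[y0 y0s cy0]|/hasPn h] := boolP (has (fun y => c y != 0) s); last first.
  rewrite big_seq big1 ?ler01// => y ys.
  by have := h y ys; rewrite negbK => /eqP.
have O0 : O' y0 by apply: contrapT => nO; rewrite cO ?eqxx in cy0.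
rewrite (bigD1_seq y0)//= big_seq_cond big1 ?addr0; first by case/andP: (c01 y0).
move=> y /andP[ys yy0]; apply: cO => Oy; move/eqP: yy0; apply.
by apply: iO; rewrite ?inE// !fs.
Qed.

(** Almost every [y] in [E n] has [q n (f y)] positive: the function [+oo] on the zero set of [q n],
    integrated against [q n], gives 0. The convention [ln 0 = 0] therefore does no harm in the
    estimates. *)
Let density_pos q n : folding_density q ->
  (\int[nu]_(y in E n) (if q n (fT y) == 0%R then +oo else 0) = 0)%E.
Proof.
move=> [mq q01 qI _].
rewrite (qI n (fun x => if q n x == 0 then +oo%E else 0%E)).
- apply: integral0_eq => x _; case: ifPn => [/eqP ->|_]; last by rewrite mul0e.
  by rewrite mule0.
- apply: measurable_fun_ifT => //; apply: (measurable_fun_bool true).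
  rewrite (_ : _ @^-1` _ = [set x | (q n x)%:E = cst 0%E x]).
    by apply: measurable_eqe => //; apply/measurable_EFinP.
  by apply/seteqP; split => x /= => [/eqP->|[->]]//; rewrite eqxx.
- by move=> x; case: ifP.
Qed.

(** The optimal weight would be [q i (f y)] on each [E i]. Only [i < N] is kept, densities and
    indicators are replaced by continuous approximations, and [delta * w] takes care of the
    remaining pieces. The error [eps] is split into four equal parts: the tail beyond [N], the term
    [delta * C], dominated convergence, and the L1 errors of the [h i n]. *)
Lemma near_optimal_weight (q : nat -> T -> R) (w : M -> R) (C eps : R) :
  @second_countable M -> folding_density q -> continuous w ->
  (forall y, 0 <= w y <= 1) -> (forall y, ~ S y -> 0 < w y) ->
  0 <= C -> fiber_sum_le w (cst C) ->
  nu.-integrable [set: T] (fun y : T => (ln (w y))%:E) -> 0 < eps ->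
  exists (v Theta : M -> R) (B delta : R),
    [/\ continuous v /\ continuous Theta, 1 <= B /\ 0 < delta,
        forall y, delta * w y <= v y <= B, fiber_sum_le v Theta &
        (\int[nu]_y (ln (B / v y))%:E + \int[nu]_y (Theta (f y))%:E <=
          folding_entropy f nu + (1 + ln B + eps)%:E)%E].
Proof.
move=> M_sc hq cw w01 wpos C0 wC iw eps0; have [mq q01 qI FE] := hq.
have mE n : measurable (E n) by exact: piece_borel.
pose e := eps / 4; have e0 : 0 < e by rewrite divr_gt0.
(* The bound 1 keeps [delta * w] below 1; the other bound makes its contribution [delta * C] to
   [Theta] at most [e], with [C + 1] to avoid dividing by 0. *)
pose delta := Num.min 1 (e / (C + 1)).
have d0 : 0 < delta by rewrite lt_min ltr01 divr_gt0// ltr_wpDl.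
have d1 : delta <= 1 by rewrite ge_min lexx.
have dC : delta * C <= e.
  apply: (@le_trans _ _ (e / (C + 1) * C)).
    by rewrite ler_wpM2r// ge_min lexx orbT.
  by rewrite mulrAC ler_pdivrMr ?ltr_wpDl// ler_wpM2l ?ltW// ltrDl ltr01.
pose ell (y : T) := - ln (delta * w y).
have ell0 y : 0 <= ell y.
  have /andP[w0 w1] := w01 y.
  by rewrite oppr_ge0 ln_le0// mulr_ile1// ltW.
have mw : measurable_fun [set: T] (w : T -> R) by exact: continuous_borel_real.
have mell : measurable_fun [set: T] ell.
  apply: measurableT_comp => //; apply: measurableT_comp; first exact: measurable_ln.
  exact: measurable_funM.
have iell : nu.-integrable [set: T] (EFin \o ell).
  apply: (@le_integrable _ _ _ nu _ measurableT _ (fun y => ((- ln delta)%:E - (ln (w y))%:E)%E)).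
  - exact/measurable_EFinP.
  - move=> y _ /=; rewrite lee_fin; have /andP[w0 w1] := w01 y.
    rewrite ger0_norm//; have [wy|wy] := eqVneq (w y) 0.
      by rewrite /ell wy mulr0 ln0// oppr0.
    apply: le_trans (ler_norm _); rewrite /ell lnM ?posrE ?opprD//.
    by rewrite lt_neqAle eq_sym wy.
  - apply: integrableB => //.
    exact: finite_measure_integrable_cst.
have tailoo : (\sum_(0 <= i <oo) \int[nu]_(y in E i) (ell y)%:E < +oo)%E.
  rewrite -integral_pieces//; last exact/measurable_EFinP.
  move/integrableP : iell => [_]; apply: le_lt_trans.
  apply: ge0_le_integral => //.
  - by move=> y _; rewrite lee_fin.
  - exact/measurable_EFinP.
  - by apply: measurableT_comp => //; exact/measurable_EFinP.
  - by move=> y _; rewrite lee_fin ler_norm.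
have I0 i : (0 <= \int[nu]_(y in E i) (ell y)%:E)%E.
  by apply: integral_ge0 => y _; rewrite lee_fin.
(* Beyond [N] the weight will be no better than [delta * w], whose loss [ell] is integrable and so
   has a small tail over the pieces. *)
have [N tailN] : exists N, (\sum_(N <= i <oo) \int[nu]_(y in E i) (ell y)%:E <= e%:E)%E.
  have /fine_cvgP[[N1 _ fin1] /cvgrPdist_le /(_ e e0)[N2 _ H]] :=
    nneseries_tail_cvg tailoo (fun i _ => I0 i).
  exists (maxn N1 N2); rewrite -[leLHS]fineK; last by apply: fin1 => /=; exact: leq_maxl.
  have := H (maxn N1 N2) (leq_maxr _ _); rewrite lee_fin /= sub0r normrN.
  exact: le_trans (ler_norm _).
(* A weight has [N] summands in [0, 1] plus [delta * w <= 1]. *)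
pose B : R := N.+1%:R.
have B1 : 1 <= B by rewrite ler1n.
have B0 : 0 < B by exact: lt_le_trans ltr01 B1.
have apph i : exists h : nat -> M -> R, [/\ forall n, continuous (h n),
    forall n x, 0 <= h n x <= 1,
    forall n, (\int[image_prob]_x `|h n x - q i x|%:E <= ((4^-1) ^+ n)%:E)%E &
    {ae image_prob, forall x, (h n x) @[n --> \oo] --> q i x}].
  by apply: continuous_ae_approximation.
pose h i := sval (cid (apph i)).
have hP i : [/\ forall n, continuous (h i n),
    forall n x, 0 <= h i n x <= 1,
    forall n, (\int[image_prob]_x `|h i n x - q i x|%:E <= ((4^-1) ^+ n)%:E)%E &
    {ae image_prob, forall x, (h i n x) @[n --> \oo] --> q i x}].
  exact: (svalP (cid (apph i))).
have appu i : exists u : nat -> M -> R, [/\ forall n, continuous (u n),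
    forall n x, 0 <= u n x <= 1,
    forall n, (\int[nu]_x `|u n x - \1_(E i) x|%:E <= ((4^-1) ^+ n)%:E)%E &
    {ae nu, forall x, (u n x) @[n --> \oo] --> (\1_(E i) x : R)}].
  apply: continuous_ae_approximation => //.
  by move=> x; rewrite indicE; case: (x \in E i); rewrite ?lexx ler01.
pose u i := sval (cid (appu i)).
have uP i : [/\ forall n, continuous (u i n),
    forall n x, 0 <= u i n x <= 1,
    forall n, (\int[nu]_x `|u i n x - \1_(E i) x|%:E <= ((4^-1) ^+ n)%:E)%E &
    {ae nu, forall x, (u i n x) @[n --> \oo] --> (\1_(E i) x : R)}].
  exact: (svalP (cid (appu i))).
have appz i : exists z : M -> R, [/\ continuous z, forall x, 0 <= z x <= 1,
    forall x, K i x -> z x = 1 & forall x, ~ O i x -> z x = 0].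
  apply: urysohn_bump => //; [exact: (piece_closed KO)|exact: (nbhd_open KO)|exact: (piece_sub KO)].
pose z i := sval (cid (appz i)).
have zP i : [/\ continuous (z i), forall x, 0 <= z i x <= 1,
    forall x, K i x -> z i x = 1 & forall x, ~ O i x -> z i x = 0].
  exact: (svalP (cid (appz i))).
(* The factor [z i] confines the continuous copy of the indicator to [O i], so each fibre meets its
   support at most once; it equals 1 on [K i], hence on [E i], and leaves the limit unchanged. *)
pose chi i n y := z i y * u i n y.
have chi01 i n y : 0 <= chi i n y <= 1.
  have [_ /(_ y)/andP[z0 z1] _ _] := zP i.
  have [_ /(_ n y)/andP[u0 u1] _ _] := uP i.
  by rewrite /chi mulr_ge0//= mulr_ile1.
have h01 i n x : 0 <= h i n x <= 1 by have [_ + _ _] := hP i.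
pose v n y := \sum_(i < N) h i n (f y) * chi i n y + delta * w y.
pose Theta n x := \sum_(i < N) h i n x + delta * C.
pose vlim y := \sum_(i < N) q i (f y) * \1_(E i) y + delta * w y.
have ch i n : continuous (h i n) by have [+ _ _ _] := hP i.
have cchi i n : continuous (chi i n).
  move=> y; apply: cvgM; first by have [+ _ _ _] := zP i; exact.
  by have [+ _ _ _] := uP i; exact.
have cv n : continuous (v n).
  move=> y; apply: cvgD; last by apply: cvgM; [exact: cvg_cst|exact: cw].
  apply: cvg_bigsum => i; apply: cvgM; last exact: cchi.
  by apply: continuous_comp; [exact: f_cont|exact: ch].
have cTheta n : continuous (Theta n).
  by move=> y; apply: cvgD; [apply: cvg_bigsum => i; exact: ch|exact: cvg_cst].
have sum01 (c : 'I_N -> R) : (forall i, 0 <= c i <= 1) -> 0 <= \sum_(i < N) c i <= N%:R.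
  move=> c01; rewrite sumr_ge0/=; last by move=> i _; case/andP: (c01 i).
  rewrite (_ : N%:R = \sum_(i < N) (1 : R)); last by rewrite sumr_const card_ord.
  by apply: ler_sum => i _; case/andP: (c01 i).
have prod01 (a b : R) : 0 <= a <= 1 -> 0 <= b <= 1 -> 0 <= a * b <= 1.
  by move=> /andP[a0 a1] /andP[b0 b1]; rewrite mulr_ge0//= mulr_ile1.
have dw01 y : 0 <= delta * w y <= 1 by apply: prod01 => //; rewrite (ltW d0) d1.
have vB n y : delta * w y <= v n y <= B.
  have /andP[s0 s1] := sum01 (fun i => h i n (f y) * chi i n y) (fun i => prod01 _ _ (h01 i n (f y)) (chi01 i n y)).
  rewrite /v lerDr s0/= /B -natr1 lerD//; by case/andP: (dw01 y).
have vlB y : delta * w y <= vlim y <= B.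
  have i01 (i : nat) : 0 <= (\1_(E i) y : R) <= 1 by rewrite indicE; case: (y \in E i); rewrite ?lexx ler01.
  have /andP[s0 s1] := sum01 (fun i => q i (f y) * \1_(E i) y) (fun i => prod01 _ _ (q01 i (f y)) (i01 i)).
  rewrite /vlim lerDr s0/= /B -natr1 lerD//; by case/andP: (dw01 y).
have vT n : fiber_sum_le (v n) (Theta n).
  move=> x s us fs; rewrite /v big_split /= exchange_big /= lerD//.
    apply: ler_sum => i _.
    rewrite (eq_big_seq (fun y => h i n x * chi i n y)); last by move=> y ys; rewrite fs.
    rewrite -mulr_sumr ler_piMr//; first by case/andP: (h01 i n x).
    apply: (bump_sum (nbhd_inj KO (n := i))) us fs => // y nOy.
    by rewrite /chi; have [_ _ _ ->] := zP i; rewrite ?mul0r.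
  by rewrite -mulr_sumr ler_wpM2l ?(ltW d0)//; exact: wC us fs.
have aelim : {ae nu, forall y : T, v n y @[n --> \oo] --> vlim y}.
  have aeh : {ae nu, forall y : T, forall i, h i n (f y) @[n --> \oo] --> q i (f y)}.
    apply: ae_foralln => i; have [_ _ _ [A [mA A0 AP]]] := hP i.
    exists (fT @^-1` A); split=> //; first exact: mpre.
    by move=> y /= H; apply: AP.
  have aeu : {ae nu, forall y : T, forall i, u i n y @[n --> \oo] --> (\1_(E i) y : R)}.
    by apply: ae_foralln => i; have [_ _ _] := uP i.
  apply: filterS2 aeh aeu => y Hh Hu; apply: cvgD; last exact: cvg_cst.
  apply: (cvg_bigsum (g := fun (i : 'I_N) n => h i n (f y) * chi i n y)
    (l := fun i : 'I_N => q i (f y) * \1_(E i) y)) => i; apply: cvgM; first exact: Hh.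
  rewrite (_ : \1_(E i) y = z i y * \1_(E i) y).
    by apply: cvgM; [exact: cvg_cst|exact: Hu].
  rewrite indicE; have [Ey|nEy] := boolP (y \in E i); last by rewrite mulr0.
  have Ky : K i y by apply: piece_subK; rewrite inE in Ey.
  by have [_ _ z1 _] := zP i; rewrite z1// mulr1.
have mlnB (v' : M -> R) : measurable_fun [set: T] (v' : T -> R) ->
    measurable_fun [set: T] (fun y : T => (ln (B / v' y))%:E).
  move=> mv; apply/measurable_EFinP; apply: measurableT_comp; first exact: measurable_ln.
  apply: measurable_funM => //.
  by apply: measurableT_comp => //; exact: measurable_invr.
have mvlim : measurable_fun [set: T] (vlim : T -> R).
  apply: measurable_funD; last exact: measurable_funM.
  apply: measurable_sum => i; apply: measurable_funM; last exact: measurable_indic.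
  exact: (measurableT_comp (mq i) f_borel).
have aeS : {ae nu, forall y : T, ~ S y}.
  exists S; split=> //; first exact: closed_borel.
  by move=> y /= /contrapT.
have lnB_bound (v' : M -> R) y : delta * w y <= v' y <= B -> ~ S y ->
    0 <= ln (B / v' y) <= ln B + ell y.
  move=> /andP[v1 v2] nSy; have wy := wpos y nSy.
  have dw : 0 < delta * w y by rewrite mulr_gt0.
  have vy : 0 < v' y by exact: lt_le_trans v1.
  rewrite ln_ge0 ?ler_pdivlMr ?mul1r//= lnM ?posrE ?invr_gt0// lnV ?posrE// lerD2l lerN2.
  by rewrite ler_ln ?posrE.
(* All the weights are at least [delta * w], which yields the integrable majorant [ln B + ell]. *)
have [ivl _ cvgI] : [/\ nu.-integrable [set: T] (fun y : T => (ln (B / vlim y))%:E),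
    [sequence (\int[nu]_y `|(ln (B / v n y))%:E - (ln (B / vlim y))%:E|)%E]_n @ \oo --> 0%E &
    [sequence (\int[nu]_y (ln (B / v n y))%:E)%E]_n @ \oo --> (\int[nu]_y (ln (B / vlim y))%:E)%E].
  apply: (@dominated_convergence _ _ _ nu setT measurableT _ _ (fun y => ((ln B)%:E + (ell y)%:E)%E)).
  - by move=> n; apply: mlnB; exact: continuous_borel_real.
  - exact: mlnB.
  - apply: filterS2 aelim aeS => y vy nSy _.
    have vly : 0 < vlim y.
      by apply: lt_le_trans (andP (vlB y)).1; rewrite mulr_gt0// wpos.
    apply: cvg_EFin; first exact: nearW.
    apply: (cvg_comp (fun n => B / v n y) (@ln R)); last first.
      by apply: continuous_ln; rewrite divr_gt0.
    by apply: cvgM; [exact: cvg_cst|apply: cvgV => //; rewrite gt_eqF].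
  - apply: integrableD => //; exact: finite_measure_integrable_cst.
  - apply: filterS aeS => y nSy n _; rewrite lee_fin.
    by have /andP[l0 l1] := lnB_bound (v n) y (vB n y) nSy; rewrite ger0_norm.
(* On [E i] the limit weight is at least [q i (f y)] if [i < N], and at least [delta * w] otherwise:
   the first case sums to at most the entropy, the second to the tail. *)
have limI : (\int[nu]_y (ln (B / vlim y))%:E <= folding_entropy f nu + (ln B + e)%:E)%E.
  have lnB0 : 0 <= ln B by exact: ln_ge0.
  have a0 i y : 0 <= - ln (q i (fT y)).
    by rewrite oppr_ge0 ln_le0//; case/andP: (q01 i (fT y)).
  have ma i : measurable_fun [set: T] (fun y => (- ln (q i (fT y)))%:E).
    apply/measurable_EFinP; apply: measurableT_comp => //; apply: measurableT_comp; first exact: measurable_ln.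
    by apply: measurableT_comp => //; exact: f_borel.
  have vl0 y : 0 <= vlim y.
    by apply: le_trans (andP (vlB y)).1; case/andP: (dw01 y).
  have l0 y : (0 <= (ln (B / vlim y))%:E)%E.
    rewrite lee_fin; have [vy|vy] := eqVneq (vlim y) 0; first by rewrite vy invr0 mulr0 ln0.
    have vy0 : 0 < vlim y by rewrite lt_neqAle eq_sym vy vl0.
    by rewrite ln_ge0// ler_pdivlMr// mul1r; case/andP: (vlB y).
  rewrite integral_pieces//; last exact: mlnB.
  apply: (@le_trans _ _ (\sum_(0 <= i <oo) (\int[nu]_(y in E i) (- ln (q i (fT y)))%:E +
     (\int[nu]_(y in E i) (ln B)%:E +
      if (i < N)%N then 0%E else \int[nu]_(y in E i) (ell y)%:E)))%E).
    apply: lee_nneseries; first by move=> i _ _; exact: integral_ge0.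
    move=> i _.
    pose Z x : \bar R := if q i x == 0 then +oo%E else 0%E.
    have Z0 x : (0 <= Z x)%E by rewrite /Z; case: ifP.
    have mZ : measurable_fun [set: T] (fun y => Z (fT y)).
      apply: (@measurableT_comp _ _ _ _ _ _ Z); last exact: f_borel.
      apply: measurable_fun_ifT => //; apply: (measurable_fun_bool true).
      rewrite (_ : _ @^-1` _ = [set x | (q i x)%:E = cst 0%E x]).
        by apply: measurable_eqe => //; apply/measurable_EFinP.
      by apply/seteqP; split => x /= => [/eqP->|[->]]//; rewrite eqxx.
    have [iN|iN] := ltnP i N.
      rewrite adde0.
      apply: (@le_trans _ _ (\int[nu]_(y in E i) ((- ln (q i (fT y)))%:E + ((ln B)%:E + Z (fT y))))%E).
        apply: ge0_le_integral => //.
        - by apply: measurable_funTS; exact: mlnB.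
        - by apply: measurable_funTS; apply: emeasurable_funD => //; apply: emeasurable_funD.
        move=> y Ey; rewrite /Z; case: ifPn => [_|q0]; first by rewrite !addey// leey.
        rewrite adde0 -EFinD lee_fin addrC.
        have qp : 0 < q i (fT y) by rewrite lt_neqAle eq_sym q0; case/andP: (q01 i (fT y)).
        have vq : q i (fT y) <= vlim y.
          rewrite /vlim (bigD1 (Ordinal iN))//= indicE mem_set// mulr1 -addrA lerDl addr_ge0//.
            apply: sumr_ge0 => j _; rewrite mulr_ge0//; by case/andP: (q01 j (fT y)).
          by case/andP: (dw01 y).
        have vy : 0 < vlim y by exact: lt_le_trans vq.
        by rewrite lnM ?posrE ?invr_gt0// lnV ?posrE// lerD2l lerN2 ler_ln ?posrE.
      rewrite ge0_integralD//; last 4 first.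
      - by move=> y _; rewrite lee_fin; exact: a0.
      - exact: measurable_funTS.
      - by move=> y _; apply: adde_ge0.
      - by apply: measurable_funTS; apply: emeasurable_funD.
      rewrite leeD2l// ge0_integralD//; last exact: measurable_funTS.
      by rewrite [X in (_ + X)%E]density_pos// adde0.
    apply: (@le_trans _ _ (\int[nu]_(y in E i) ((ln B)%:E + (ell y)%:E))%E).
      apply: ge0_le_integral => //.
      - by apply: measurable_funTS; exact: mlnB.
      - by apply: measurable_funTS; apply: emeasurable_funD => //; exact/measurable_EFinP.
      move=> y Ey; rewrite -EFinD lee_fin.
      have nSy : ~ S y by move=> Sy; have : (~` S) y by rewrite -piece_bigcup; exists i.
      by case/andP: (lnB_bound _ _ (vlB y) nSy).
    rewrite ge0_integralD//; last 2 first.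
    - by move=> y _; rewrite lee_fin.
    - by apply: measurable_funTS; exact/measurable_EFinP.
    by rewrite leeDr// integral_ge0// => y _; rewrite lee_fin; exact: a0.
  have J0 i : (0 <= \int[nu]_(y in E i) (ln B)%:E)%E by apply: integral_ge0 => y _; rewrite lee_fin.
  have T0 i : (0 <= if (i < N)%N then 0 else \int[nu]_(y in E i) (ell y)%:E)%E by case: ifP.
  rewrite nneseriesD; last 2 first.
  - by move=> i _ _; apply: integral_ge0 => y _; rewrite lee_fin; exact: a0.
  - by move=> i _ _; exact: adde_ge0.
  rewrite FE leeD2l// nneseriesD// EFinD; apply: leeD.
    rewrite -(integral_pieces (h := cst (ln B)%:E))//.
    rewrite integral_cst// -[leRHS]mule1 lee_wpmul2l ?lee_fin//.
    exact: probability_le1.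
  rewrite (nneseries_split 0 N)// add0n [X in (X + _)%E]big_nat_cond big1 ?add0e; last first.
    by move=> i /andP[/andP[_ iN] _]; rewrite iN.
  apply: le_trans tailN; rewrite ereal_series [leRHS]ereal_series.
  apply: lee_nneseries => // i; rewrite leqNgt.
  by case: ltnP.
(* Each [q i] integrates to [nu (E i)], in total at most 1: this is the 1 on the left of Gibbs'
   inequality. *)
have ThetaI n : (\int[nu]_y (Theta n (f y))%:E <= (1 + N%:R * (4^-1) ^+ n + e)%:E)%E.
  have mh i : measurable_fun [set: T] (fun x : T => (`|h i n x - q i x|)%:E).
    apply/measurable_EFinP; apply: measurableT_comp => //; apply: measurable_funB => //.
    exact: continuous_borel_real.
  have qsum : (\sum_(i < N) \int[image_prob]_x (q i x)%:E <= 1)%E.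
    apply: (@le_trans _ _ (\sum_(0 <= i <oo) nu (E i `&` setT))%E); last first.
      by rewrite sum_pieces// probability_le1.
    apply: le_trans (nneseries_lim_ge N _); last by move=> *; exact: measure_ge0.
    rewrite big_mkord; apply: lee_sum => i _.
    have -> : (\int[image_prob]_x (q i x)%:E = \int[image_prob]_x (cst 1 x * (q i x)%:E))%E.
      by apply: eq_integral => x _; rewrite mul1e.
    rewrite -(qI i (cst 1%E))// integral_cst// mul1e setIT.
    exact: lexx.
  have -> : (\int[nu]_y (Theta n (f y))%:E = \int[image_prob]_x (Theta n x)%:E)%E.
    rewrite (ge0_integral_pushforward f_borel nu)//.
      by apply/measurable_EFinP; exact: continuous_borel_real.
    move=> x _; rewrite lee_fin addr_ge0//; last by rewrite mulr_ge0// ltW.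
    by apply: sumr_ge0 => i _; case/andP: (h01 i n x).
  apply: (@le_trans _ _ (\int[image_prob]_x (\sum_(i < N) ((q i x)%:E + `|h i n x - q i x|%:E) + e%:E))%E).
    apply: ge0_le_integral => //.
    - move=> x _; rewrite lee_fin addr_ge0//; last by rewrite mulr_ge0// ltW.
      by apply: sumr_ge0 => i _; case/andP: (h01 i n x).
    - by apply/measurable_EFinP; exact: continuous_borel_real.
    - apply: emeasurable_funD => //; apply: emeasurable_sum => i.
      by apply: emeasurable_funD => //; exact/measurable_EFinP.
    move=> x _; rewrite sumEFin -EFinD lee_fin lerD//; apply: ler_sum => i _.
    by rewrite -lerBlDl ler_norm.
  rewrite ge0_integralD//; last 3 first.
  - move=> x _; apply: sume_ge0 => i _; rewrite -EFinD lee_fin addr_ge0//.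
    by case/andP: (q01 i x).
  - by apply: emeasurable_sum => i; apply: emeasurable_funD => //; exact/measurable_EFinP.
  - by move=> x _; rewrite lee_fin ltW.
  rewrite [leRHS]EFinD; apply: leeD; last first.
    rewrite integral_cst// -[leRHS]mule1 lee_wpmul2l ?lee_fin ?(ltW e0)//.
    exact: probability_le1.
  rewrite ge0_integral_sum//; last 2 first.
  - by move=> i; apply: emeasurable_funD => //; exact/measurable_EFinP.
  - move=> i x _; rewrite -EFinD lee_fin addr_ge0//; by case/andP: (q01 i x).
  under eq_bigr => i _.
    rewrite ge0_integralD//; last 2 first.
    - by move=> x _; rewrite lee_fin; case/andP: (q01 i x).
    - exact/measurable_EFinP.
    over.
  rewrite big_split/= EFinD leeD//.
  apply: (@le_trans _ _ (\sum_(i < N) ((4^-1) ^+ n)%:E)%E).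
    by apply: lee_sum => i _; have [_ _ + _] := hP i; exact.
  by rewrite sumEFin lee_fin sumr_const card_ord -[_ *+ N]mulr_natl.
have flim : (\int[nu]_y (ln (B / vlim y))%:E)%E \is a fin_num by exact: integrable_fin_num.
have [n [In Nn]] : exists n, (\int[nu]_y (ln (B / v n y))%:E <=
     \int[nu]_y (ln (B / vlim y))%:E + e%:E)%E /\ N%:R * (4^-1) ^+ n <= e.
  have c4 : N%:R * (4^-1) ^+ n @[n --> \oo] --> (0 : R).
    rewrite -[X in _ --> X](mulr0 N%:R); apply: cvgM; first exact: cvg_cst.
    by apply: cvg_expr; rewrite ger0_norm// invf_lt1 ?ltr1n.
  move: cvgI; rewrite -{1}(fineK flim) => /fine_cvgP[[N1 _ H1] /cvgrPdist_le /(_ e e0)[N2 _ H2]].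
  move: c4 => /cvgrPdist_le /(_ e e0)[N3 _ H3].
  pose n := maxn N1 (maxn N2 N3); exists n; split.
    have n1 : (N1 <= n)%N by exact: leq_maxl.
    have n2 : (N2 <= n)%N by rewrite /n maxnCA leq_maxl.
    have f1 := H1 n n1; rewrite -[leLHS]fineK// -(fineK flim) -EFinD lee_fin.
    have := H2 n n2; rewrite distrC => /(le_trans (ler_norm _)) /=; lra.
  have n3 : (N3 <= n)%N by rewrite /n maxnA leq_maxr.
  by have := H3 n n3; rewrite sub0r normrN => /(le_trans (ler_norm _)).
exists (v n), (Theta n), B, delta; split=> //.
apply: le_trans (leeD In (ThetaI n)) _.
apply: le_trans (leeD (leeD limI (lexx _)) (lexx _)) _.
rewrite -!addeA leeD2l// -!EFinD lee_fin.
rewrite (_ : eps = e + e + e + e); last by rewrite /e; field.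
lra.
Qed.

End disintegrate.


End folding.

(** * Upper semicontinuity for an abstract Jacobian *)

Lemma limn_esup_le_near {R : realType} (u : nat -> \bar R) (c : \bar R) (N : nat) :
  (forall n, (N <= n)%N -> (u n <= c)%E) -> (limn_esup u <= c)%E.
Proof.
move=> uc; rewrite /limn_esup limf_esupE.
apply: (@le_trans _ _ (ereal_sup (u @` [set n | (N <= n)%N]))).
  by apply: ereal_inf_lbound; exists [set n | (N <= n)%N] => //; exists N.
by apply: ge_ereal_sup => _ [n /= Nn <-]; exact: uc.
Qed.

Lemma integrable_ae_dominated {d} {T : measurableType d} {R : realType}
    (mu : {measure set T -> \bar R}) (g h : T -> \bar R) :
  measurable_fun [set: T] g -> mu.-integrable [set: T] h ->
  {ae mu, forall x, (`|g x| <= `|h x|)%E} -> mu.-integrable [set: T] g.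
Proof.
move=> mg /integrableP[mh hoo] gh; apply/integrableP; split=> //.
apply: le_lt_trans hoo; apply: ae_ge0_le_integral => //.
- exact: measurableT_comp.
- exact: measurableT_comp.
- by apply: filterS gh => x.
Qed.

Lemma compact_lower_bound {R : realType} {M : ptopologicalType} (h : M -> R)
    (D : set M) : compact D -> continuous h -> (forall x, D x -> 0 < h x) ->
  exists c : R, [/\ 0 < c, c <= 1 & forall x, D x -> c <= h x].
Proof.
move=> cD ch hpos; have [->|/set0P D0] := eqVneq D set0.
  by exists 1; split.
have [c /set_mem Dc hc] := compact_EVT_min D0 cD (continuous_subspaceT ch).
exists (Num.min 1 (h c)); split.
- by rewrite lt_min ltr01 hpos.
- by rewrite ge_min lexx.
- by move=> x Dx; rewrite ge_min hc ?orbT// inE.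
Qed.

(** * Integrability of the logarithm of the Jacobian *)

Section jacobian_integral.
Context {R : realType} {M : ptopologicalType}.
Hypotheses (M_hausdorff : hausdorff_space M) (M_compact : compact [set: M]).
Variables (J : M -> R) (J_cont : continuous J) (J_ge0 : forall x, 0 <= J x).
Variables (J0 : R) (J0_ge1 : 1 <= J0) (J_le : forall x, J x <= J0).

Let T := borel M.
Let S : set T := [set x | J x = 0].
Implicit Type nu : probability T R.

Lemma zero_set_closed : closed ([set x | J x = 0] : set M).
Proof.
rewrite (_ : [set x | J x = 0] = J @^-1` [set 0]); last by [].
apply: closed_comp => //.
Qed.

Let mS : measurable S.
Proof. by apply: closed_borel; exact: zero_set_closed. Qed.

Let mJ : measurable_fun [set: T] (J : T -> R).
Proof. exact: continuous_borel_real. Qed.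

Lemma measurable_lne_comp : measurable_fun [set: T] (fun x : T => lne (J x)%:E).
Proof.
apply: measurable_fun_ifT => //.
- apply: (measurable_fun_bool true).
  rewrite (_ : _ @^-1` _ = [set x | J x <= cst 0 x]); last by apply/seteqP; split.
  exact: measurable_fun_le.
- by apply/measurable_EFinP; apply: measurableT_comp => //; exact: measurable_ln.
Qed.

Let m_lnJ : measurable_fun [set: T] (fun x : T => ln (J x)).
Proof. by apply: measurableT_comp => //; exact: measurable_ln. Qed.

Let Jpos x : ~ S x -> 0 < J x.
Proof. by move=> nS; rewrite lt_neqAle J_ge0 andbT eq_sym; apply/eqP. Qed.

Let lnJ_le x : ln (J x) <= ln J0.
Proof.
have [Sx|nS] := pselect (S x); first by rewrite Sx ln0// ln_ge0.
by rewrite ler_ln ?posrE ?Jpos// (lt_le_trans (Jpos nS)).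
Qed.

(** As [c] decreases to 0 it increases to [ln J0 - ln J], and to [+oo] on [S]; for [c > 0] it is
    continuous, so its integral passes to weak limits. *)
Definition truncated_loss (c : R) (x : M) : R := ln J0 - ln (Num.max (J x) c).

Lemma truncated_loss_cont c : 0 < c -> continuous (truncated_loss c).
Proof.
move=> c0 x; apply: cvgB; first exact: cvg_cst.
apply: (cvg_comp (fun y => Num.max (J y) c) (@ln R)).
  by apply: (@continuous_max R M J (cst c) x); [exact: J_cont|exact: cvg_cst].
by apply: continuous_ln; rewrite lt_max c0 orbT.
Qed.

Lemma truncated_loss_ge0 c x : 0 < c -> c <= 1 -> 0 <= truncated_loss c x.
Proof.
move=> c0 c1; rewrite subr_ge0 ler_ln ?posrE; last by exact: lt_le_trans J0_ge1.
  by rewrite ge_max J_le (le_trans c1).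
by rewrite lt_max c0 orbT.
Qed.

(** The second clause alone does not see [S], where [ln 0 = 0]. *)
Definition integrable_jacobian nu := nu S = 0%E /\
  nu.-integrable [set: T] (fun x : T => (ln (J x))%:E).

(** Monotone convergence along [c = 1/(k+1)]: the limit [L] is [+oo] on [S], so a finite integral
    forces [nu S = 0], and off [S] the modulus of [ln J] is at most [L + ln J0]. *)
Lemma integrable_jacobian_of_bound nu (K : R) :
  (forall c, 0 < c -> c <= 1 -> (\int[nu]_x (truncated_loss c x)%:E <= K%:E)%E) ->
  integrable_jacobian nu.
Proof.
move=> HK; pose c k : R := k.+1%:R^-1.
have c0 k : 0 < c k by rewrite invr_gt0.
have c1 k : c k <= 1 by rewrite invf_le1// ler1n.
pose g k (x : T) := (truncated_loss (c k) x)%:E.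
have mg k : measurable_fun [set: T] (g k).
  by apply/measurable_EFinP; apply: continuous_borel_real; exact: truncated_loss_cont.
have g0 k x : (0 <= g k x)%E by rewrite lee_fin truncated_loss_ge0.
have gmono x : {homo g^~ x : n m / (n <= m)%N >-> (n <= m)%E}.
  move=> n m nm; rewrite lee_fin lerD2l lerN2 ler_ln ?posrE ?lt_max ?c0 ?orbT//.
  rewrite ge_max le_max lexx/= le_max; apply/orP; right.
  by rewrite lef_pV2 ?posrE// ler_nat.
pose L (x : T) := ((ln J0)%:E - lne (J x)%:E)%E.
have gL x : limn (g^~ x) = L x.
  apply/cvg_lim => //; have [Sx|nS] := pselect (S x).
    rewrite /L Sx le0_lneNy// /= ; apply/cvgeryP.
    apply: (@cvg_trans _ ((fun k => ln J0 + ln k.+1%:R) @ \oo)).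
      apply: near_eq_cvg; apply: nearW => k.
      by rewrite /truncated_loss Sx max_r ?ltW// lnV ?posrE// opprK.
    apply/cvgryPge => A; exists (Num.truncn (expR (A - ln J0))) => // k /= hk.
    rewrite -lerBlDl -[leLHS]expRK ler_ln ?posrE ?expR_gt0//.
    by apply/ltW/(lt_le_trans (truncnS_gt _)); rewrite ler_nat ltnS.
  have Jx := Jpos nS; rewrite /L lne_EFin// -EFinB.
  apply: cvg_EFin; first exact: nearW.
  apply: (@cvg_trans _ ((fun k : nat => ln J0 - ln (J x)) @ \oo)); last exact: cvg_cst.
  apply: near_eq_cvg; exists (Num.truncn (J x)^-1) => // k /= hk.
  rewrite /= /truncated_loss max_l// -[J x]invrK lef_pV2 ?posrE ?invr_gt0//.
  by apply/ltW/(lt_le_trans (truncnS_gt _)); rewrite ler_nat ltnS.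
have L0 x : (0 <= L x)%E.
  rewrite -gL; apply: lime_ge; last exact: nearW.
  by apply: ereal_nondecreasing_is_cvgn; exact: gmono.
have mL : measurable_fun [set: T] L.
  by apply: emeasurable_funB => //; exact: measurable_lne_comp.
have LK : (\int[nu]_x L x <= K%:E)%E.
  under eq_integral do rewrite -gL.
  rewrite (monotone_convergence nu measurableT mg); last 2 first.
  - by move=> k x _; exact: g0.
  - by move=> x _; exact: gmono.
  apply: lime_le.
    apply: ereal_nondecreasing_is_cvgn => n m nm.
    by apply: ge0_le_integral => // x _; exact: gmono.
  by apply: nearW => k; exact: HK.
split.
  apply/eqP; apply/negPn/negP => nuS0.
  have : (\int[nu]_(x in S) cst +oo x <= K%:E)%E.
    apply: le_trans LK; apply: (@le_trans _ _ (\int[nu]_(x in S) L x)%E).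
      apply: ge0_le_integral => //.
      - by move=> x _; exact: leey.
      - exact: measurable_funTS mL.
      move=> x Sx; by rewrite /L Sx le0_lneNy//; exact: leey.
    by apply: ge0_subset_integral.
  rewrite integral_cst// gt0_mulye//.
  by rewrite lt_neqAle eq_sym measure_ge0 andbT.
apply: (@integrable_ae_dominated _ _ _ nu _ (fun x => L x + (ln J0)%:E)%E).
- exact/measurable_EFinP.
- apply: integrableD => //; last exact: finite_measure_integrable_cst.
  apply/integrableP; split=> //; under eq_integral do rewrite gee0_abs//.
  exact: le_lt_trans LK (ltry _).
apply: aeW => x; rewrite [leRHS]gee0_abs; last by rewrite adde_ge0 ?L0 ?lee_fin ?ln_ge0.
have [Sx|nS] := pselect (S x).
  by rewrite Sx ln0// abse0 adde_ge0 ?L0 ?lee_fin ?ln_ge0.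
rewrite /L lne_EFin ?Jpos// -EFinB -EFinD lee_fin.
have := lnJ_le x; have := ln_ge0 J0_ge1.
by rewrite ler_norml; lra.
Qed.

(** On [U] the logarithm is negative, so the modulus of its integral is the integral of its modulus;
    off [U] the truncated loss is at most [ln J0 - ln (min c 1)]. The resulting bound involves
    neither [c'] nor [nu]. *)
Lemma loss_bound_of_rate (U : set M) (eta c : R) nu : open U ->
  (forall x, U x -> J x < 1) -> 0 < c -> (forall x, ~ U x -> c <= J x) ->
  (`| \int[nu]_(x in (U : set T)) lne (J x)%:E | <= eta%:E)%E ->
  (\int[nu]_(x in (U : set T)) (- lne (J x)%:E) <= eta%:E)%E /\
  forall c', 0 < c' -> c' <= 1 ->
    (\int[nu]_x (truncated_loss c' x)%:E <= (ln J0 - ln (Num.min c 1) + eta)%:E)%E.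
Proof.
move=> oU UJ c0 Uc Hrate.
have mU : measurable (U : set T) by exact: open_borel.
have l0 x : U x -> (0 <= - lne (J x)%:E)%E.
  move=> Ux; rewrite oppe_ge0; have [J1|J1] := leP (J x) 0.
    by rewrite le0_lneNy// leNye.
  by rewrite lne_EFin// lee_fin ln_le0// ltW// UJ.
have mlne := measurable_lne_comp.
have mNlne : measurable_fun [set: T] (fun x => (- lne (J x)%:E)%E) by exact: measurableT_comp.
have Hloss : (\int[nu]_(x in (U : set T)) (- lne (J x)%:E) <= eta%:E)%E.
  apply: le_trans Hrate.
  have -> : (\int[nu]_(x in (U : set T)) lne (J x)%:E =
      - \int[nu]_(x in (U : set T)) (- lne (J x)%:E))%E.
    rewrite -(integral_ge0N nu l0).
    by apply: eq_integral => x _; rewrite oppeK.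
  by rewrite abseN; exact: lee_abs.
split=> // c' c'0 c'1.
pose m1 : R := Num.min c 1.
have m10 : 0 < m1 by rewrite lt_min c0 ltr01.
have lm1 : ln m1 <= 0 by rewrite ln_le0// ge_min lexx orbT.
have lJ0 : 0 <= ln J0 by exact: ln_ge0.
apply: (@le_trans _ _ (\int[nu]_x ((ln J0 - ln m1)%:E + ((fun x => - lne (J x)%:E) \_ (U : set T)) x))%E).
  apply: ge0_le_integral => //.
  - by move=> x _; rewrite lee_fin truncated_loss_ge0.
  - by apply/measurable_EFinP; apply: continuous_borel_real; exact: truncated_loss_cont.
  - apply: emeasurable_funD => //; apply/(measurable_restrictT _ _).1 => //.
    exact: measurable_funTS.
  move=> x _; rewrite patchE; case: ifPn => [/set_mem Ux|nU].
    have [J1|J1] := leP (J x) 0; first by rewrite le0_lneNy//= addey// leey.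
    rewrite lne_EFin// -EFinN -EFinD lee_fin /truncated_loss.
    have : ln (J x) <= ln (Num.max (J x) c').
      by rewrite ler_ln ?posrE ?lt_max ?J1// le_max lexx.
    lra.
  have cJ : c <= J x by apply: Uc => Ux; move/negP : nU; apply; rewrite inE.
  rewrite adde0 lee_fin /truncated_loss lerD2l lerN2 ler_ln ?posrE//; last by rewrite lt_max c'0 orbT.
  by rewrite ge_min le_max cJ.
rewrite ge0_integralD//; last 3 first.
- by move=> x _; rewrite lee_fin subr_ge0 (le_trans lm1).
- by move=> x _; apply: erestrict_ge0.
- by apply/(measurable_restrictT _ _).1 => //; exact: measurable_funTS.
rewrite -integral_mkcond [leRHS]EFinD; apply: leeD => //.
rewrite integral_cst// -[leRHS]mule1; apply: lee_wpmul2l; last exact: probability_le1.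
by rewrite lee_fin subr_ge0 (le_trans lm1).
Qed.

(** * Semicontinuity along a sequence of measures that obeys the rate *)

Section upper_semicontinuity.
Hypothesis M_sc : @second_countable M.
Variables (f : M -> M) (f_cont : continuous f).
Hypothesis f_locinj : forall p, J p != 0 -> exists U, [/\ open U, U p & set_inj U f].
Variables (A : nat) (C : R).
Hypothesis fiber_bound : forall x (s : seq M), uniq s ->
  (forall y, y \in s -> f y = x) -> \sum_(y <- s) (J y) ^+ A <= C.
Variables (V : nat -> set M) (V_open : forall m, open (V m)).
Hypothesis V_shrink : forall U : set M, open U -> S `<=` U ->
  exists m0, forall m, (m0 <= m)%N -> V m `<=` U.
Hypothesis V_sup : forall m, S `<=` V m.
Variables (eta : nat -> R) (eta_cvg0 : eta @ \oo --> (0 : R)).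
Variables (mus : nat -> probability T R) (mu : probability T R).
Hypothesis mus_rate : forall n m,
  (`| \int[mus n]_(x in (V m : set T)) lne (J x)%:E | <= (eta m)%:E)%E.
Hypothesis mus_cvg : weak_star_cvg mus mu.

(** Normalises [w] to have both its values and its fibre sums at most 1, as [near_optimal_weight] is
    applied with [C = 1]. *)
Let D : R := Num.max (J0 ^+ A) (Num.max C 1).
Let D1 : 1 <= D. Proof. by rewrite /D !le_max lexx !orbT. Qed.
Let D0 : 0 < D. Proof. exact: lt_le_trans ltr01 D1. Qed.
Let w (x : M) : R := (J x) ^+ A / D.

Let w01 x : 0 <= w x <= 1.
Proof.
rewrite /w divr_ge0 ?exprn_ge0 ?(ltW D0)//= ler_pdivrMr// mul1r /D le_max.
by rewrite lerXn2r// nnegrE// (le_trans (J_ge0 x)).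
Qed.

Let w_cont : continuous w.
Proof.
move=> x; apply: cvgM; last exact: cvg_cst.
by apply: (cvg_comp J (fun r => r ^+ A)); [exact: J_cont|exact: exprn_continuous].
Qed.

Let w_pos x : ~ S x -> 0 < w x.
Proof. by move=> nS; rewrite divr_gt0// exprn_gt0// Jpos. Qed.

Let w_fiber : fiber_sum_le f w (cst 1).
Proof.
move=> x s us fs; rewrite -mulr_suml ler_pdivrMr// mul1r.
by apply: le_trans (fiber_bound us fs) _; rewrite /D !le_max lexx !orbT.
Qed.

(** The threshold [expR (-1)], and not 1, makes [- ln J] at least 1 on [V m], so that constants can
    be absorbed into multiples of it. *)
Let small_nbhd : exists m0, forall m, (m0 <= m)%N -> forall x, V m x -> J x < expR (-1).
Proof.
apply: V_shrink; last by move=> x ->; exact: expR_gt0.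
rewrite (_ : (fun x => is_true (J x < expR (-1))) = J @^-1` [set r | r < expR (-1)])//.
by apply: open_comp => //; exact: open_lt.
Qed.

Let lower_bound m (h : M -> R) : continuous h -> (forall x, ~ S x -> 0 < h x) ->
  exists c, [/\ 0 < c, c <= 1 & forall x, ~ V m x -> c <= h x].
Proof.
move=> ch hpos.
have cK : compact (~` V m).
  by apply: subclosed_compact M_compact _ => //; exact: open_closedC.
have [c [c0 c1 cV]] := compact_lower_bound cK ch (fun x nV => hpos x (fun Sx => nV (@V_sup m x Sx))).
by exists c; split.
Qed.

Let e1 : expR (-1) < 1 :> R.
Proof. by rewrite -[X in _ < X]expR0 ltr_expR ltrN10. Qed.

Let uniform_loss : exists K : R, forall n c, 0 < c -> c <= 1 ->
  (\int[mus n]_x (truncated_loss c x)%:E <= K%:E)%E.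
Proof.
have [m0 Vm0] := small_nbhd.
have [c [c0 c1 Vc]] := lower_bound m0 J_cont Jpos.
exists (ln J0 - ln (Num.min c 1) + eta m0) => n c' c'0 c'1.
have UJ x : V m0 x -> J x < 1 by move=> /(Vm0 _ (leqnn _)) h; exact: lt_trans e1.
by have [_] := loss_bound_of_rate (V_open m0) UJ c0 Vc (mus_rate n m0); apply.
Qed.

Let mus_ij n : integrable_jacobian (mus n).
Proof. by have [K HK] := uniform_loss; apply: (@integrable_jacobian_of_bound _ K) => c; exact: HK. Qed.

(** For fixed [c] the bound on the truncated losses, uniform in [n], passes to the weak limit; only
    afterwards does [c] tend to 0. *)
Let mu_ij : integrable_jacobian mu.
Proof.
have [K HK] := uniform_loss; apply: (@integrable_jacobian_of_bound _ K) => c c0 c1.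
have H := mus_cvg (truncated_loss_cont c0).
rewrite -(cvg_lim _ H)//; apply: lime_le; first by apply/cvg_ex; eexists; exact: H.
by apply: nearW => n; exact: HK.
Qed.

Let lne_integral nu : integrable_jacobian nu ->
  (\int[nu]_x lne (J x)%:E = \int[nu]_x (ln (J x))%:E)%E.
Proof.
move=> [nS _]; apply: ae_eq_integral => //.
- exact: measurable_lne_comp.
- exact/measurable_EFinP.
exists S; split=> // x /=; apply: contra_notP => nSx _.
by rewrite -/(lne (J x)%:E) lne_EFin// Jpos.
Qed.

(** From [1 <= - ln J] on [V m] follows [a - b ln J <= (a + b) (- ln J)], and the rate bounds the
    integral of the right-hand side. *)
Let tail_bound n m (a b : R) : 0 <= a -> 0 <= b -> (forall x, V m x -> J x < expR (-1)) ->
  (\int[mus n]_(x in (V m : set T)) (a - b * ln (J x))%:E <= ((a + b) * eta m)%:E)%E.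
Proof.
move=> a0 b0 VJ; have mV : measurable (V m : set T) by exact: open_borel.
have VJ1 x : V m x -> J x < 1 by move=> /VJ h; exact: lt_trans e1.
have [c [c0 c1 Vc]] := lower_bound m J_cont Jpos.
have [H _] := loss_bound_of_rate (V_open m) VJ1 c0 Vc (mus_rate n m).
have mNlne : measurable_fun [set: T] (fun x : T => (- lne (J x)%:E)%E).
  by apply: measurableT_comp => //; exact: measurable_lne_comp.
rewrite EFinM; apply: (@le_trans _ _ ((a + b)%:E * \int[mus n]_(x in (V m : set T)) (- lne (J x)%:E))%E); last first.
  by apply: lee_wpmul2l => //; rewrite lee_fin addr_ge0.
have l1 x : V m x -> (1 <= - lne (J x)%:E)%E.
  move=> Vx; have [J1|J1] := leP (J x) 0; first by rewrite le0_lneNy// leey.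
  rewrite lne_EFin// -EFinN lee_fin lerNr -[leRHS]expRK ler_ln ?posrE ?expR_gt0//.
  exact/ltW/VJ.
have l0 x : V m x -> (0 <= - lne (J x)%:E)%E by move=> /l1; exact: le_trans.
have lnJ0 x : V m x -> ln (J x) <= 0 by move=> /VJ1 /ltW; exact: ln_le0.
rewrite -ge0_integralZl//; last 2 first.
- exact: measurable_funTS.
- by rewrite lee_fin addr_ge0.
apply: ge0_le_integral => //.
- by move=> x Vx; rewrite lee_fin subr_ge0 (le_trans _ a0)// mulr_ge0_le0// lnJ0.
- apply: measurable_funTS; apply/measurable_EFinP; apply: measurable_funB => //.
  exact: measurable_funM.
- by apply: measurable_funTS; apply: measurable_funeM.
move=> x Vx; have := l1 x Vx; have [J1|J1] := leP (J x) 0.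
  rewrite le0_lneNy//= => _; have [ab|ab] := ltrP 0 (a + b).
    by rewrite gt0_muley ?lte_fin// leey.
  have -> : a = 0 by lra.
  have -> : b = 0 by lra.
  by rewrite mul0r subr0 addr0 mul0e.
rewrite lne_EFin// -EFinN -EFinM !lee_fin => h.
by have := ler_wpM2l a0 h; lra.
Qed.

Let limsup_arith (i ic h rm lm rn lg s1 s2 k e : R) : 0 < e ->
  i <= rm - lm + (k + e) -> ic <= i -> h <= ic + e -> s1 - lg + s2 <= h + e ->
  rn + k <= s1 + s2 -> rn - lg <= rm - lm + (e + e + e + e).
Proof. lra. Qed.

Theorem entropy_production_limsup :
  (limn_esup (fun n => folding_entropy f (mus n) - \int[mus n]_x lne (J x)%:E)
   <= folding_entropy f mu - \int[mu]_x lne (J x)%:E)%E.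
Proof.
have cS := zero_set_closed.
have [K0 [N0 KO]] := fiber_pieces_exist M_hausdorff M_compact M_sc cS (f := f)
  (fun p nSp => f_locinj (introN eqP nSp)).
have [muS imu] := mu_ij.
have [q hq] := @folding_density_exists R M M_hausdorff M_compact f f_cont _ cS K0 N0 KO mu muS.
have I_lnJ nu : integrable_jacobian nu -> nu.-integrable [set: T] (EFin \o (fun x => ln (J x))).
  by case.
have mcont (h : M -> R) : continuous h -> measurable_fun [set: T] (h : T -> R).
  exact: continuous_borel_real.
have icont nu (h : M -> R) : continuous h -> nu.-integrable [set: T] (EFin \o (h : T -> R)).
  move=> ch; apply: measurable_bounded_integrable => //.
  - exact: le_lt_trans (probability_le1 _ measurableT) (ltry 1).
  - exact: mcont.
  have : compact (h @` setT).
    by apply: continuous_compact => //; exact: continuous_subspaceT.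
  move=> /compact_bounded[N [Nr HN]]; exists N; split=> // N' /HN H x _.
  by apply: H; exists x.
have ilnw : mu.-integrable [set: T] (fun y : T => (ln (w y))%:E).
  apply: (@integrable_ae_dominated _ _ _ mu _ (fun x => (A%:R%:E * (ln (J x))%:E - (ln D)%:E)%E)).
  - apply/measurable_EFinP; apply: measurableT_comp; first exact: measurable_ln.
    exact: mcont.
  - apply: integrableB => //; last exact: finite_measure_integrable_cst.
    exact: integrableZl.
  exists S; split=> // x /=; apply: contra_notP => nSx.
  rewrite /w lnM ?posrE ?exprn_gt0 ?invr_gt0 ?Jpos// lnV ?posrE//.
  by rewrite lnXn ?Jpos// mulr_natl.
(* Near-optimality of the weight, the error on [V m] and weak convergence cost at most [e4] each. *)
apply/lee_addgt0Pr => e e0; pose e4 := e / 4; have e40 : 0 < e4 by rewrite divr_gt0.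
have [v [Th [B [delta [[cv cTh] [B1 delta0] vB vTh Hv]]]]] :=
  near_optimal_weight M_hausdorff M_compact cS KO muS M_sc hq w_cont w01 w_pos ler01 w_fiber ilnw e40.
have B0 : 0 < B by exact: lt_le_trans ltr01 B1.
have lnB0 : 0 <= ln B by exact: ln_ge0.
have vpos x : ~ S x -> 0 < v x.
  by move=> nS; have /andP[+ _] := vB x; apply: lt_le_trans; rewrite mulr_gt0// w_pos.
have v0B x : 0 <= v x <= B.
  have /andP[v1 ->] := vB x; rewrite andbT; apply: le_trans v1.
  by rewrite mulr_ge0 ?(ltW delta0)//; case/andP: (w01 x).
have mlv : measurable_fun [set: T] (fun x : T => ln (B / v x)).
  apply: measurableT_comp; first exact: measurable_ln.
  apply: measurable_funM => //.
  by apply: measurableT_comp; [exact: measurable_invr|exact: mcont].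
(* Read off from [v >= delta * J ^+ A / D]. *)
pose a1 := ln B - ln delta + ln D.
have lv_bound x : ~ S x -> 0 <= ln (B / v x) <= a1 - A%:R * ln (J x).
  move=> nS; have Jx := Jpos nS; have vx := vpos x nS; have /andP[dv vBx] := vB x.
  rewrite ln_ge0 ?ler_pdivlMr ?mul1r//=.
  have : ln (delta * w x) <= ln (v x) by rewrite ler_ln ?posrE// mulr_gt0// w_pos.
  rewrite [ln (delta * _)]lnM ?posrE ?w_pos// /w [ln (_ / D)]lnM ?posrE ?exprn_gt0 ?invr_gt0//.
  rewrite lnV ?posrE// lnXn// lnM ?posrE ?invr_gt0// lnV ?posrE// -mulr_natl /a1; lra.
have ilv nu : integrable_jacobian nu -> nu.-integrable [set: T] (EFin \o (fun x => ln (B / v x))).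
  move=> [nuS inu]; apply: (@integrable_ae_dominated _ _ _ nu _ (fun x => (a1%:E - A%:R%:E * (ln (J x))%:E)%E)).
  - exact/measurable_EFinP.
  - apply: integrableB => //; first exact: finite_measure_integrable_cst.
    exact: integrableZl.
  exists S; split=> // x /=; apply: contra_notP => nSx.
  have /andP[l0 l1] := lv_bound x nSx.
  by rewrite lee_fin ger0_norm// (le_trans l1)// ler_norm.
pose Tf (x : M) := Th (f x).
have cTf : continuous Tf by move=> x; apply: continuous_comp; [exact: f_cont|exact: cTh].
(* The right-hand side of Gibbs' inequality and the Jacobian term of the entropy production as one
   integrand. *)
pose H (x : T) : R := ln (B / v x) - ln (J x) + Tf x.
have ilvJ nu : integrable_jacobian nu -> nu.-integrable [set: T] (EFin \o (fun x => ln (B / v x) - ln (J x))).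
  by move=> ij; exact: (integrableB measurableT (ilv nu ij) (I_lnJ nu ij)).
have iH nu : integrable_jacobian nu -> nu.-integrable [set: T] (EFin \o H).
  by move=> ij; exact: (integrableD measurableT (ilvJ nu ij) (icont nu Tf cTf)).
have IH nu : integrable_jacobian nu -> \int[nu]_x H x =
    \int[nu]_x ln (B / v x) - \int[nu]_x ln (J x) + \int[nu]_x Tf x.
  move=> ij; rewrite RintegralD//; [|exact: ilvJ|exact: icont].
  by rewrite RintegralB//; [exact: ilv|exact: I_lnJ].
have FinE nu (h : T -> R) : nu.-integrable [set: T] (EFin \o h) ->
    (\int[nu]_x (h x)%:E = (\int[nu]_x h x)%:E)%E.
  by move=> ih; rewrite /Rintegral fineK//; exact: integrable_fin_num.
(* Gibbs' inequality with this weight also makes the entropy of any such [nu] finite, so the rest is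
   real arithmetic. *)
have Ffin nu : integrable_jacobian nu -> exists r, folding_entropy f nu = r%:E /\
    r + (1 + ln B) <= \int[nu]_x ln (B / v x) + \int[nu]_x Tf x.
  move=> ij; have [nuS _] := ij.
  have [q' hq'] := @folding_density_exists R M M_hausdorff M_compact f f_cont _ cS K0 N0 KO nu nuS.
  have := gibbs_inequality M_hausdorff M_compact cS KO nuS hq' (mcont v cv) (mcont Th cTh) B1 v0B vpos vTh.
  rewrite (FinE _ (fun x => ln (B / v x)))//; last exact: ilv.
  rewrite (FinE _ Tf); last exact: icont.
  have F0 : (0 <= folding_entropy f nu)%E.
    have [_ q01 _ ->] := hq'; apply: nneseries_ge0 => n _ _; apply: integral_ge0 => y _.
    by rewrite lee_fin oppr_ge0 ln_le0//; case/andP: (q01 n (f y)).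
  case: (folding_entropy f nu) F0 => [r _|//|//]; rewrite -!EFinD lee_fin => h.
  by exists r.
have null_le nu (h1 h2 : T -> R) : nu S = 0%E -> nu.-integrable [set: T] (EFin \o h1) ->
    nu.-integrable [set: T] (EFin \o h2) -> (forall x, ~ S x -> h1 x <= h2 x) ->
    \int[nu]_x h1 x <= \int[nu]_x h2 x.
  move=> nuS i1 i2 h12; rewrite /Rintegral.
  rewrite (negligible_integral mS measurableT i1 nuS) (negligible_integral mS measurableT i2 nuS).
  apply: le_Rintegral => //.
  - exact: measurableD.
  - by apply: integrableS i1 => //; exact: measurableD.
  - by apply: integrableS i2 => //; exact: measurableD.
  - by move=> x [_ nS]; exact: h12.
(* Chosen so that [H - Hc <= a - b * ln J] off [S] on [V m]: [a1 - A ln J] from the weight, [- ln J]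
   from the Jacobian, and [ln J0] from its truncation. *)
pose a := `|a1| + ln J0; pose b : R := A%:R + 1.
have lnJ00 : 0 <= ln J0 by exact: ln_ge0.
have a0 : 0 <= a by rewrite addr_ge0.
have b0 : 0 <= b by rewrite addr_ge0.
have [m [Vm eta_m]] : exists m, (forall x, V m x -> J x < expR (-1)) /\ (a + b) * eta m <= e4.
  have [m0 Hm0] := small_nbhd.
  have ce : (a + b) * eta m @[m --> \oo] --> (0 : R).
    by rewrite -[X in _ --> X](mulr0 (a + b)); apply: cvgM => //; exact: cvg_cst.
  move: ce => /cvgrPdist_le /(_ e4 e40)[m1 _ Hm1].
  exists (maxn m0 m1); split; first exact: Hm0 (leq_maxl _ _).
  by have := Hm1 _ (leq_maxr m0 m1); rewrite sub0r normrN => /(le_trans (ler_norm _)).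
have [c1 [c10 c11 Vc1]] := lower_bound m cv vpos.
have [c2 [c20 c21 Vc2]] := lower_bound m J_cont Jpos.
pose c := Num.min c1 c2.
have c0 : 0 < c by rewrite lt_min c10.
have cle1 : c <= 1 by rewrite ge_min c11.
(* A continuous truncation of [H]: it lies below [H] off [S], and equals [H] off [V m], where [v]
   and [J] are at least [c]. *)
pose Hc (x : M) : R := ln (B / Num.max (v x) c) + (truncated_loss c x - ln J0) + Tf x.
have cHc : continuous Hc.
  move=> x; apply: cvgD; last exact: cTf.
  apply: cvgD; last by apply: cvgB; [exact: truncated_loss_cont|exact: cvg_cst].
  have cmax : {for x, continuous (fun y => Num.max (v y) c)}.
    by apply: (@continuous_max R M v (cst c) x); [exact: cv|exact: cvg_cst].
  have max0 : 0 < Num.max (v x) c by rewrite lt_max c0 orbT.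
  apply: (cvg_comp (fun y => B / Num.max (v y) c) (@ln R)); last first.
    by apply: continuous_ln; rewrite divr_gt0.
  by apply: cvgM; [exact: cvg_cst|apply: cvgV => //; rewrite gt_eqF].
have HcE x : Hc x = ln (B / Num.max (v x) c) - ln (Num.max (J x) c) + Tf x.
  by rewrite /Hc /truncated_loss; ring.
(* For [mu] the inequality [Hc <= H] is the useful direction; the opposite one, with an error on
   [V m], is asked of the [mus n], which obey the rate. *)
have mu_le : \int[mu]_x Hc x <= \int[mu]_x H x.
  apply: null_le => //; [exact: icont|exact: iH|].
  move=> x nS; have Jx := Jpos nS; have vx := vpos x nS.
  rewrite HcE /H lerD2r; apply: lerB.
    rewrite ler_ln ?posrE ?divr_gt0// ?lt_max ?vx//.
    by rewrite ler_pM2l// lef_pV2 ?posrE ?lt_max ?vx// le_max lexx.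
  by rewrite ler_ln ?posrE ?lt_max ?Jx// le_max lexx.
have mV : measurable (V m : set T) by exact: open_borel.
have mus_le n : \int[mus n]_x H x <= \int[mus n]_x Hc x + e4.
  have [nuS inu] := mus_ij n.
  pose g (x : T) : R := a - b * ln (J x).
  have ig : (mus n).-integrable [set: T] (EFin \o g).
    have : (mus n).-integrable [set: T] (fun x => a%:E - b%:E * (ln (J x))%:E)%E.
      apply: integrableB => //; first exact: finite_measure_integrable_cst.
      exact: integrableZl.
    by apply: eq_integrable.
  have igV : (mus n).-integrable [set: T] (EFin \o (g \_ (V m : set T))).
    rewrite -restrict_EFin; apply/integrable_restrict => //.
    by rewrite setTI; apply: integrableS ig.
  apply: (@le_trans _ _ (\int[mus n]_x (Hc x + (g \_ (V m : set T)) x))).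
    apply: null_le => //; first exact: iH.
      exact: (integrableD measurableT (icont _ _ cHc) igV).
    move=> x nS; have Jx := Jpos nS; have vx := vpos x nS; rewrite HcE /H patchE.
    case: ifPn => [/set_mem Vx|/negP nV].
      have mv0 : 0 <= ln (B / Num.max (v x) c).
        rewrite ln_ge0// ler_pdivlMr ?lt_max ?vx// mul1r ge_max.
        by rewrite (le_trans cle1 B1) andbT; case/andP: (v0B x).
      have mJ0 : ln (Num.max (J x) c) <= ln J0.
        rewrite ler_ln ?posrE ?lt_max ?Jx ?(lt_le_trans ltr01 J0_ge1)//.
        by rewrite ge_max J_le (le_trans cle1).
      have /andP[_ l1] := lv_bound x nS.
      have := ler_norm a1; rewrite /g /a /b; lra.
    have nVx : ~ V m x by move=> Vx; apply: nV; rewrite inE.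
    by rewrite addr0 !max_l// ge_min ?Vc1 ?Vc2 ?orbT.
  rewrite RintegralD//; last exact: icont.
  rewrite lerD2l -Rintegral_mkcond -lee_fin.
  apply: le_trans (_ : _ <= ((a + b) * eta m)%:E)%E _; last by rewrite lee_fin.
  rewrite /Rintegral fineK; first exact: tail_bound.
  by apply: integrable_fin_num => //; apply: integrableS ig.
have [r [Fr Hr]] := Ffin mu mu_ij.
have mu_upper : \int[mu]_x H x <= r - \int[mu]_x ln (J x) + (1 + ln B + e4).
  move: Hv; rewrite Fr (FinE _ (fun x => ln (B / v x)))//; last exact: ilv.
  rewrite (FinE _ Tf); last exact: icont.
  rewrite -!EFinD lee_fin (IH _ mu_ij); lra.
have [N HN] : exists N, forall n, (N <= n)%N -> \int[mus n]_x Hc x <= \int[mu]_x Hc x + e4.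
  have := mus_cvg cHc; rewrite (FinE mu Hc); last exact: icont.
  move=> /fine_cvgP[_ /cvgrPdist_le /(_ e4 e40)[N _ HN]].
  exists N => n Nn; have := HN n Nn; rewrite distrC => /(le_trans (ler_norm _)).
  by rewrite /Rintegral /=; lra.
apply: (@limn_esup_le_near _ _ _ N) => n Nn.
have [rn [Frn Hrn]] := Ffin _ (mus_ij n).
rewrite Frn Fr !lne_integral// (FinE (mus n) (fun x => ln (J x))); last exact: I_lnJ.
rewrite (FinE mu (fun x => ln (J x))); last exact: I_lnJ.
rewrite -!EFinB -EFinD lee_fin.
have := mus_le n; rewrite (IH _ (mus_ij n)).
have := HN n Nn; have := mu_le; have := mu_upper.
have -> : e = e4 + e4 + e4 + e4 by rewrite /e4; field.
move=> h1 h2 h3 h4; exact: (limsup_arith e40 h1 h2 h3 h4 Hrn).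
Qed.

End upper_semicontinuity.

End jacobian_integral.

(** * The Jacobian of a C^r map in charts *)

Section matrix_limits.
Context {R : realType} {T : Type} {F : set_system T} {FF : Filter F}.

Lemma cvg_bigprod (I : Type) (s : seq I) (g : I -> T -> R) (l : I -> R) :
  (forall i, g i x @[x --> F] --> l i) ->
  (\prod_(i <- s) g i x) @[x --> F] --> \prod_(i <- s) l i.
Proof.
move=> cg; elim: s => [|i s IH].
  rewrite big_nil (_ : (fun _ => _) = cst 1); first exact: cvg_cst.
  by apply/funext => x; rewrite big_nil.
rewrite big_cons (_ : (fun _ => _) = (fun x => g i x * \prod_(j <- s) g j x)).
  by apply: cvgM; [exact: cg|exact: IH].
by apply/funext => x; rewrite big_cons.
Qed.

Lemma cvg_det n (A : T -> 'M[R]_n) (L : 'M[R]_n) :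
  (forall i j, A x i j @[x --> F] --> L i j) ->
  \det (A x) @[x --> F] --> \det L.
Proof.
move=> cA; rewrite /determinant; apply: cvg_bigsum => s.
by apply: cvgM; [exact: cvg_cst|apply: cvg_bigprod => i; exact: cA].
Qed.

End matrix_limits.

Section jacobians.
Context {R : realType}.

Lemma row_jacobian m n (F : 'rV[R]_m -> 'rV[R]_n) y i : differentiable F y ->
  row i (jacobian F y) = 'D_(delta_mx 0 i) F y.
Proof. by move=> dF; rewrite rowE deriveEjacobian. Qed.

Lemma jacobian_entry m n (F : 'rV[R]_m -> 'rV[R]_n) y i j : differentiable F y ->
  jacobian F y i j = 'D_(delta_mx 0 i) F y 0 j.
Proof. by move=> dF; rewrite -(row_jacobian i dF) [RHS]mxE. Qed.

Lemma jacobian_comp m n p (F : 'rV[R]_m -> 'rV[R]_n) (G : 'rV[R]_n -> 'rV[R]_p) y :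
  differentiable F y -> differentiable G (F y) ->
  jacobian (G \o F) y = jacobian F y *m jacobian G (F y).
Proof.
move=> dF dG; apply/row_matrixP => i; rewrite !rowE.
rewrite mulmxA !mul_rV_lin1 /= diff_comp//.
Qed.

Lemma jacobian_near m n (F G : 'rV[R]_m -> 'rV[R]_n) y :
  differentiable F y -> differentiable G y -> (\forall z \near y, F z = G z) ->
  jacobian F y = jacobian G y.
Proof.
move=> dF dG FG; apply/row_matrixP => i.
apply: (etrans (row_jacobian i dF)); apply: esym.
apply: (etrans (row_jacobian i dG)); apply: esym.
have [->|v0] := eqVneq (delta_mx 0 i : 'rV[R]_m) 0; first by rewrite !derive0.
exact: near_eq_derive.
Qed.

(** An eigenvalue [t >= 0] of [- G] would give a vector on which the form is nonpositive. So the
    monic characteristic polynomial of [- G] has no root in [0, +oo), is positive at infinity, and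
    by the intermediate value theorem is positive at 0, where its value is [\det G]. *)
Lemma posdef_det_gt0 n (G : 'M[R]_n) :
  (forall v : 'rV[R]_n, v != 0 -> 0 < (v *m G *m v^T) ord0 ord0) -> 0 < \det G.
Proof.
move=> Gpos; pose p := char_poly (- G).
have nroot t : 0 <= t -> p.[t] != 0.
  move=> t0; apply/negP => pt; have : eigenvalue (- G) t by rewrite eigenvalue_root_char.
  move=> /eigenvalueP[v vG v0]; have := Gpos v v0.
  have -> : v *m G = - (t *: v) by rewrite -vG mulmxN opprK.
  rewrite mulNmx -scalemxAl mxE [X in - X]mxE ltNge oppr_le0 => /negP; apply.
  rewrite mulr_ge0// mxE sumr_ge0// => i _.
  by rewrite [v^T _ _]mxE -expr2 sqr_ge0.
have p0 : p.[0] = \det G.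
  by rewrite horner_coef0 char_poly_det -[- G]scaleN1r detZ mulrA -exprMn mulrNN mulr1 expr1n mul1r.
rewrite -p0 lt_neqAle eq_sym nroot//= leNgt; apply/negP => pneg.
have lc : 0 < lead_coef p by rewrite (monicP (char_poly_monic _)) ltr01.
have [M HM] := polyrcf.poly_pinfty_gt_lc lc.
pose t := Num.max M 0.
have pt : 0 < p.[t] by apply: lt_le_trans lc (HM t _); rewrite le_max lexx.
have [x /andP[x0 xt] /rootP px] : exists2 x, 0 <= x <= t & root p x.
  apply: poly_ivt; first by rewrite le_max lexx orbT.
  by rewrite (ltW pneg) (ltW pt).
by have := nroot x x0; rewrite px eqxx.
Qed.

End jacobians.

(** * Chart independence and continuity of the Jacobian *)

Section charts.
Context {R : realType} {d : nat} {M : topologicalType} (g : riemannian_manifold R d M).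
Variables (r : R) (r_gt1 : 1 < r) (f : M -> M) (f_Cr : Cr_map g r f).

Local Notation dom a := (chart_dom (g a)).
Local Notation phi a := (chart_map (g a)).
Local Notation inv a := (chart_inv (g a)).

Lemma f_continuous : continuous f. Proof. by case: f_Cr. Qed.

Lemma dom_near a x : dom a x -> \forall y \near x, dom a y.
Proof. by move=> ax; apply: open_nbhs_nbhs; split=> //; exact: chart_dom_open. Qed.

Lemma phi_inv_near a x (P : M -> Prop) : dom a x -> (\forall y \near x, P y) ->
  \forall z \near phi a x, exists2 y, dom a y /\ P y & z = phi a y /\ inv a z = y.
Proof.
move=> ax Px.
have img : (phi a @` dom a) (phi a x) by exists x.
have cinv := chart_inv_cont img.
have nimg : \forall z \near phi a x, (phi a @` dom a) z.
  by apply: open_nbhs_nbhs; split=> //; exact: chart_img_open.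
have /cinv Pinv : nbhs (inv a (phi a x)) P by rewrite chart_mapK.
apply: filterS2 nimg Pinv => z [y ay <-]; rewrite /= chart_mapK// => Py.
by exists y => //; rewrite chart_mapK.
Qed.

Lemma smooth_on_differentiable (W : normedModType R) O (F : 'rV[R]_d -> W) y :
  smooth_on O F -> O y -> differentiable F y.
Proof. by move=> /(_ 1%N)[+ _] => /[apply]. Qed.

Lemma smooth_on_continuous (W : normedModType R) O (F : 'rV[R]_d -> W) y :
  smooth_on O F -> O y -> {for y, continuous F}.
Proof. by move=> /(_ 0%N) + Oy => /(_ y Oy). Qed.

Lemma truncr_gt0 : exists k, Num.truncn r = k.+1.
Proof.
have : (0 < Num.truncn r)%N by rewrite truncn_gt0 ltW.
by case: (Num.truncn r) => // k _; exists k.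
Qed.

Lemma Cr_on_differentiable O (F : 'rV[R]_d -> 'rV[R]_d) y :
  Cr_on r O F -> O y -> differentiable F y.
Proof. by have [k kE] := truncr_gt0; rewrite /Cr_on kE => -[+ _] => /[apply]. Qed.

Lemma Cr_on_partial_continuous O (F : 'rV[R]_d -> 'rV[R]_d) y i :
  Cr_on r O F -> O y -> {for y, continuous (fun z => 'D_(delta_mx 0 i) F z)}.
Proof.
have [k kE] := truncr_gt0; rewrite /Cr_on kE => -[_ /(_ i)] + Oy.
case: k {kE} => [|k] /=; first by move=> [+ _]; exact.
by move=> [/(_ y Oy) + _]; exact: differentiable_continuous.
Qed.

Lemma local_domI a b h x : dom a x -> dom b (h x) -> local_dom (g a) (g b) h (phi a x).
Proof. by move=> ax bx; exists x. Qed.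

Lemma rep_differentiable a b x : dom a x -> dom b (f x) ->
  differentiable (local_rep (g a) (g b) f) (phi a x).
Proof.
by move=> ax bx; apply: Cr_on_differentiable (local_domI ax bx); case: f_Cr.
Qed.

Lemma transition_differentiable a b x : dom a x -> dom b x ->
  differentiable (local_rep (g a) (g b) id) (phi a x).
Proof.
move=> ax bx; apply: smooth_on_differentiable (local_domI (h := id) ax bx).
exact: transition_smooth.
Qed.

Definition gram_det a x := \det (gram g a (phi a x)).

Lemma gram_det_gt0 a x : dom a x -> 0 < gram_det a x.
Proof. by move=> ax; apply: posdef_det_gt0 => v v0; exact: gram_posdef. Qed.

Lemma gram_det_change a b x : dom a x -> dom b x ->
  Num.sqrt (gram_det a x) =
  `|\det (jacobian (local_rep (g a) (g b) id) (phi a x))| * Num.sqrt (gram_det b x).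
Proof.
move=> ax bx; rewrite /gram_det (gram_change ax bx) !det_mulmx det_tr.
by rewrite mulrAC -expr2 sqrtrM ?sqr_ge0// sqrtr_sqr.
Qed.

(** Chain rule for the composite of two transitions with a local representative, which agrees with
    the other representative near the point only. Tangent vectors are rows, so the source transition
    stands on the left. *)
Lemma jacobian_change a b a' b' x :
  dom a x -> dom b (f x) -> dom a' x -> dom b' (f x) ->
  jacobian (local_rep (g a') (g b') f) (phi a' x) =
  jacobian (local_rep (g a') (g a) id) (phi a' x) *m
  jacobian (local_rep (g a) (g b) f) (phi a x) *m
  jacobian (local_rep (g b) (g b') id) (phi b (f x)).
Proof.
move=> ax bx a'x b'x.
pose t1 := local_rep (g a') (g a) id; pose t2 := local_rep (g b) (g b') id.
pose F := local_rep (g a) (g b) f.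
have e1 : t1 (phi a' x) = phi a x by rewrite /t1 /local_rep chart_mapK.
have e2 : F (phi a x) = phi b (f x) by rewrite /F /local_rep chart_mapK.
have d1 : differentiable t1 (phi a' x) by exact: transition_differentiable.
have dF : differentiable F (t1 (phi a' x)) by rewrite e1; exact: rep_differentiable.
have d2 : differentiable t2 (F (t1 (phi a' x))).
  by rewrite e1 e2; exact: transition_differentiable.
rewrite -e2 -e1 -mulmxA -/F -/t1 -/t2.
have d2F : differentiable (t2 \o F) (t1 (phi a' x)) by exact: differentiable_comp.
have E1 := jacobian_comp dF d2; have E2 := jacobian_comp d1 d2F.
apply: (etrans _ (etrans E2 (congr1 (mulmx (jacobian t1 (phi a' x))) E1))).
apply: jacobian_near; [exact: rep_differentiable|exact: (differentiable_comp d1 d2F)|].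
have Px : \forall y \near x, dom a y /\ dom b (f y).
  near=> y; split; near: y; first exact: dom_near.
  exact: (f_continuous (dom_near bx)).
apply: filterS (phi_inv_near a'x Px) => z [y [a'y [ay by']] [-> iz]].
by rewrite /= /t2 /F /t1 /local_rep /= !chart_mapK.
Unshelve. all: by end_near. Qed.

Let frac_cancel (p q s t u : R) : p != 0 -> u != 0 ->
  p * q * s * t / (p * u) = q * (s * t) / u.
Proof. by move=> p0 u0; field; rewrite p0 u0. Qed.

(** The definition uses the charts of index [x] and [f x], which change abruptly with [x]; in fixed
    charts [a] and [b] the formula is visibly continuous. The transition determinants cancel against
    those in the Gram determinants. *)
Lemma abs_jacE a b x : dom a x -> dom b (f x) ->
  abs_jac g f x = `|\det (jacobian (local_rep (g a) (g b) f) (phi a x))|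
    * Num.sqrt (gram_det b (f x)) / Num.sqrt (gram_det a x).
Proof.
move=> ax bx; have xx := chart_at_dom g x; have fx := chart_at_dom g (f x).
rewrite /abs_jac -/(gram_det (f x) (f x)) -/(gram_det x x).
rewrite (jacobian_change ax bx xx fx) !det_mulmx !normrM.
rewrite (gram_det_change xx ax) (gram_det_change bx fx).
have : Num.sqrt (gram_det x x) != 0 by rewrite gt_eqF// sqrtr_gt0 gram_det_gt0.
rewrite (gram_det_change xx ax) mulf_eq0 negb_or => /andP[n1 n2].
exact: frac_cancel.
Qed.

Lemma abs_jac_ge0 x : 0 <= abs_jac g f x.
Proof. by rewrite /abs_jac divr_ge0 ?sqrtr_ge0// mulr_ge0 ?sqrtr_ge0. Qed.

Lemma gram_det_cont a x : dom a x -> {for x, continuous (gram_det a)}.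
Proof.
move=> ax; apply: cvg_det => i j.
have cg : {for phi a x, continuous (gram g a)}.
  by apply: smooth_on_continuous (gram_smooth g a) _; exists x.
have cphi : {for x, continuous (phi a)} by exact: chart_map_cont.
apply: (cvg_comp (fun y => gram g a (phi a y)) (fun A : 'M[R]_d => A i j)).
  by apply: (cvg_comp (phi a)); [exact: cphi|exact: cg].
exact: coord_continuous.
Qed.

Lemma jacobian_entry_cont a b x i j : dom a x -> dom b (f x) ->
  {for x, continuous (fun y => jacobian (local_rep (g a) (g b) f) (phi a y) i j)}.
Proof.
move=> ax bx; pose F := local_rep (g a) (g b) f.
have Oy := local_domI ax bx.
have CrF : Cr_on r (local_dom (g a) (g b) f) F by case: f_Cr.
have Px : \forall y \near x, dom a y /\ dom b (f y).
  near=> y; split; near: y; first exact: dom_near.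
  exact: (f_continuous (dom_near bx)).
have c1 : (('D_(delta_mx 0 i) F (phi a y)) 0 j) @[y --> x] --> ('D_(delta_mx 0 i) F (phi a x)) 0 j.
  have cD := Cr_on_partial_continuous (i := i) CrF Oy.
  have cc : {for x, continuous (fun y => 'D_(delta_mx 0 i) F (phi a y))}.
    exact: (continuous_comp (chart_map_cont ax) cD).
  apply: (cvg_comp _ (fun A : 'rV[R]_d => A 0 j) cc).
  exact: coord_continuous.
have E y : dom a y -> dom b (f y) ->
    jacobian F (phi a y) i j = 'D_(delta_mx 0 i) F (phi a y) 0 j.
  by move=> ay fy; exact: (jacobian_entry i j (rep_differentiable ay fy)).
suff : jacobian F (phi a y) i j @[y --> x] --> jacobian F (phi a x) i j by [].
apply: (eq_ind_r (fun u => jacobian F (phi a y) i j @[y --> x] --> u) _ (E x ax bx)).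
apply: cvg_trans c1; apply: near_eq_cvg.
by apply: filterS Px => y [ay fy]; exact: esym (E y ay fy).
Unshelve. all: by end_near. Qed.

Lemma abs_jac_cont : continuous (abs_jac g f).
Proof.
move=> x; have xx := chart_at_dom g x; have fx := chart_at_dom g (f x).
rewrite /continuous_at (abs_jacE xx fx).
have Px : \forall y \near x, dom x y /\ dom (f x) (f y).
  near=> y; split; near: y; first exact: dom_near.
  exact: (f_continuous (dom_near fx)).
have : (`|\det (jacobian (local_rep (g x) (g (f x)) f) (phi x y))|
    * Num.sqrt (gram_det (f x) (f y)) / Num.sqrt (gram_det x y)) @[y --> x] -->
    `|\det (jacobian (local_rep (g x) (g (f x)) f) (phi x x))|
    * Num.sqrt (gram_det (f x) (f x)) / Num.sqrt (gram_det x x).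
  apply: cvgM; first apply: cvgM.
  - apply: cvg_norm; apply: cvg_det => i j; exact: jacobian_entry_cont.
  - apply: (cvg_comp (fun y => gram_det (f x) (f y)) (@Num.sqrt R)); last exact: sqrt_continuous.
    by apply: (cvg_comp f); [exact: f_continuous|exact: gram_det_cont].
  - apply: cvgV; first by rewrite gt_eqF// sqrtr_gt0 gram_det_gt0.
    apply: (cvg_comp (gram_det x) (@Num.sqrt R)); last exact: sqrt_continuous.
    exact: gram_det_cont.
apply: cvg_trans; apply: near_eq_cvg.
by apply: filterS Px => y [ay fy]; rewrite (abs_jacE ay fy).
Unshelve. all: by end_near. Qed.

End charts.

(** * Hoelder estimates *)

Section mean_value.
Context {R : realType}.

Lemma coord_le_norm m n (A : 'M[R]_(m, n)) i j : `|A i j| <= `|A|.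
Proof. by rewrite [leRHS]/Num.Def.normr /= mx_normrE; apply/bigmax_geP; right => /=; exists (i, j). Qed.

Lemma norm_le_coord m n (A : 'M[R]_(m, n)) B : 0 <= B ->
  (forall i j, `|A i j| <= B) -> `|A| <= B.
Proof.
by move=> B0 AB; rewrite [leLHS]/Num.Def.normr /= mx_normrE bigmax_le// => -[i j] _; exact: AB.
Qed.

Lemma derive_segment m n (F : 'rV[R]_m -> 'rV[R]_n) z w (t : R) :
  differentiable F (z + t *: w) ->
  is_derive t 1 (fun s => F (z + s *: w)) (w *m jacobian F (z + t *: w)).
Proof.
move=> dF; pose l := fun s : R => z + s *: w.
have dl : is_derive t 1 l w.
  have -> : l = cst z + (fun s : R => s *: w) by [].
  rewrite -[X in is_derive _ _ _ X]add0r; apply: is_deriveD.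
  have dd : differentiable (fun s : R => s *: w) t by exact: differentiableZl.
  apply: DeriveDef; first exact/derivable1_diffP.
  by rewrite deriveE// diffZl// /= diff_val scale1r.
have [/derivable1_diffP dfl l'] := dl.
have dFl : differentiable (F \o l) t by exact: differentiable_comp.
apply: DeriveDef; first exact/derivable1_diffP.
rewrite -(deriveEjacobian w dF) (deriveE w dF) (deriveE (1 : R^o) dFl) (diff_comp dfl dF) /=.
by rewrite -(deriveE _ dfl) l'.
Qed.

(** For vector-valued maps the mean value theorem holds only one coordinate at a time; the point [t]
    depends on [j]. *)
Lemma mean_value_coord m n (F : 'rV[R]_m -> 'rV[R]_n) z w j :
  (forall t : R, 0 <= t <= 1 -> differentiable F (z + t *: w)) ->
  exists2 t : R, 0 <= t <= 1 &
    (F (z + w) - F z) 0 j = (w *m jacobian F (z + t *: w)) 0 j.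
Proof.
move=> dF; pose h (s : R) := F (z + s *: w) 0 j.
have dh (t : R) : 0 <= t <= 1 -> is_derive t 1 h ((w *m jacobian F (z + t *: w)) 0 j).
  move=> /dF/derive_segment[dt et].
  apply: DeriveDef; first exact: ((derivable_mxP _ _ _).1 dt).
  by rewrite -et derive_mx// mxE.
have [||t] := @MVT_segment R h (fun t => (w *m jacobian F (z + t *: w)) 0 j) 0 1 ler01.
- by move=> t; rewrite in_itv/= => /andP[t0 t1]; apply: dh; rewrite !ltW.
- apply: derivable_within_continuous => t; rewrite in_itv/= => t01.
  by have [] := dh t t01.
rewrite in_itv/= => t01; rewrite /h scale1r scale0r addr0 subr0 mulr1 => E.
by exists t => //; rewrite mxE [X in _ + X]mxE.
Qed.

Lemma ball_segment n (y z w : 'rV[R]_n) e t : 0 <= t <= 1 ->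
  ball y e z -> ball y e (z + w) -> ball y e (z + t *: w).
Proof.
rewrite -!ball_normE /ball_ /= => /andP[t0 t1] zy zwy.
have -> : y - (z + t *: w) = (1 - t) *: (y - z) + t *: (y - (z + w)).
  by apply/matrixP => i j; rewrite !mxE; ring.
apply: le_lt_trans (ler_normD _ _) _; rewrite !normrZ.
rewrite (ger0_norm t0) ger0_norm ?subr_ge0//.
have [->|tn] := eqVneq t 0; first by rewrite subr0 mul1r mul0r addr0.
have tp : 0 < t by rewrite lt_neqAle eq_sym tn.
have : (1 - t) * `|y - z| <= (1 - t) * e by rewrite ler_wpM2l ?subr_ge0// ltW.
have : t * `|y - (z + w)| < t * e by rewrite ltr_pM2l.
by move=> h1 h2; lra.
Qed.

Lemma row_mulmx_sub m n (w : 'rV[R]_m) (A B : 'M[R]_(m, n)) j :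
  (w *m B) 0 j = 0 -> (w *m A) 0 j = (w *m (A - B)) 0 j.
Proof. by move=> wB; rewrite mulmxBr [RHS]mxE [X in _ + X]mxE wB subr0. Qed.

Lemma sub_entry_eq m n p (A B : 'M[R]_(m, n)) (u v : 'rV[R]_p) i j k :
  A i j = u 0 k -> B i j = v 0 k -> (A - B) i j = (u - v) 0 k.
Proof. by move=> Au Bv; rewrite !mxE Au Bv. Qed.

Lemma row_mulmx_le m n (w : 'rV[R]_m) (A : 'M[R]_(m, n)) B j :
  (forall i, `|A i j| <= B) -> `|(w *m A) 0 j| <= m%:R * (`|w| * B).
Proof.
move=> AB; rewrite mxE; apply: le_trans (ler_norm_sum _ _ _) _.
rewrite mulr_natl -[X in _ *+ X]card_ord -sumr_const.
by apply: ler_sum => i _; rewrite normrM ler_pM// coord_le_norm.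
Qed.

End mean_value.

(** * The determinant at two nearby points with the same image *)

Section holder.
Context {R : realType} {d : nat}.
Implicit Types F : 'rV[R]_d -> 'rV[R]_d.

Lemma near_ord n (y : 'rV[R]_n) (P : 'I_d -> 'rV[R]_n -> Prop) :
  (forall i, \forall z \near y, P i z) -> \forall z \near y, forall i, P i z.
Proof. exact: (@filter_forall _ _ P (nbhs y) (nbhs_filter y)). Qed.

Lemma nbhs_row_ball n (y : 'rV[R]_n) (A : set 'rV[R]_n) : nbhs y A ->
  exists2 e : R, 0 < e & ball y e `<=` A.
Proof. by move=> /nbhs_ballP[e e0 eA]; exists e. Qed.

Lemma near_norm_le n (y : 'rV[R]_n) (u : 'rV[R]_n -> R) (l : R) :
  u z @[z --> y] --> l -> \forall z \near y, `|u z| <= `|l| + 1.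
Proof.
move=> ul; have lt1 : `|l| < `|l| + 1 by rewrite ltrDl.
exact: (@cvgr_norm_le _ _ _ (nbhs y) (nbhs_filter y) _ _ ul _ lt1).
Qed.

Lemma near_eq_row n (y : 'rV[R]_n) (u v : 'rV[R]_n -> R) :
  (\forall z \near y, u z = v z) -> v z @[z --> y] `=>` u z @[z --> y].
Proof. exact: (@near_eq_cvg _ _ (nbhs y) (nbhs_filter y)). Qed.

Lemma continuous_partials_lipschitz F O y : nbhs y O ->
  (forall z, O z -> differentiable F z) ->
  (forall i, {for y, continuous (fun z => 'D_(delta_mx 0 i) F z)}) ->
  exists C : R, \forall z1 \near y & z2 \near y, `|F z1 - F z2| <= C * `|z1 - z2|.
Proof.
move=> Oy dF cD.
have bDi (i : 'I_d) :
    \forall z \near y, `|'D_(delta_mx 0 i) F z| <= `|'D_(delta_mx 0 i) F y| + 1.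
  have lt1 : `|'D_(delta_mx 0 i) F y| < `|'D_(delta_mx 0 i) F y| + 1 by rewrite ltrDl.
  exact: (cvgr_norm_le _ (cD i) _ lt1).
have bD := near_ord bDi.
pose K := \sum_i (`|'D_(delta_mx 0 i) F y| + 1).
have [e e0 eP] := nbhs_row_ball (filterI Oy bD).
exists (d%:R * K); exists (ball y e, ball y e) => /=.
  by split; exact: nbhsx_ballx.
move=> [z1 z2] /= [z1e z2e].
have zw : z1 = z2 + (z1 - z2) by rewrite addrC subrK.
have seg (t : R) : 0 <= t <= 1 -> ball y e (z2 + t *: (z1 - z2)).
  by move=> t01; apply: ball_segment; rewrite -?zw.
have K0 : 0 <= K by apply: sumr_ge0 => i _; rewrite addr_ge0.
apply: norm_le_coord => [|i0 j]; first by rewrite !mulr_ge0.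
rewrite [i0]ord1 {1}zw.
have [t t01 ->] : exists2 t : R, 0 <= t <= 1 & (F (z2 + (z1 - z2)) - F z2) 0 j =
    ((z1 - z2) *m jacobian F (z2 + t *: (z1 - z2))) 0 j.
  by apply: mean_value_coord => t /seg /eP[/dF].
rewrite -mulrA [K * _]mulrC; apply: row_mulmx_le => i.
have [/dF dFt bt] := eP _ (seg t t01).
rewrite (jacobian_entry i j dFt); apply: le_trans (coord_le_norm _ _ _) _.
apply: le_trans (bt i) _; rewrite /K (bigD1 i)//= lerDl sumr_ge0// => k _.
Qed.

(** The local Hoelder exponent of the first derivatives: [r - 1] if [1 < r < 2]; if [r >= 2] these
    derivatives are C^1, hence locally Lipschitz. *)
Definition holder_exponent (r : R) := if Num.truncn r == 1%N then r - 1 else 1.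

Lemma Cr_on_partial_holder r F O (y : 'rV[R]_d) i : 1 < r -> nbhs y O -> Cr_on r O F ->
  exists C : R, \forall z1 \near y & z2 \near y,
   `|'D_(delta_mx 0 i) F z1 - 'D_(delta_mx 0 i) F z2| <=
     C * `|z1 - z2| `^ holder_exponent r.
Proof.
move=> r1 Oy; have rn1 : r != 1 by rewrite gt_eqF.
rewrite /Cr_on /holder_exponent.
have : (0 < Num.truncn r)%N by rewrite truncn_gt0 ltW.
case: (Num.truncn r) => [//|[|k]] _ /=.
  by move=> [_ /(_ i)[_ /(_ rn1)]]; apply; exact: nbhs_singleton.
move=> [_ /(_ i)[dD cD]].
have [|C CP] := continuous_partials_lipschitz Oy dD.
  move=> j; move: (cD j); case: k {cD} => [|k] /=.
    by move=> [+ _]; apply; exact: nbhs_singleton.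
  by move=> [+ _] => /(_ _ (nbhs_singleton Oy)); exact: differentiable_continuous.
exists C; move: CP; apply: filterS => -[z1 z2] /=.
by rewrite powRr1.
Qed.

Lemma cvg_adjugate {T : Type} {FT : set_system T} {FF : Filter FT} (A : T -> 'M[R]_d) (L : 'M[R]_d) i j :
  (forall i j, A x i j @[x --> FT] --> L i j) ->
  (\adj (A x)) i j @[x --> FT] --> (\adj L) i j.
Proof.
move=> cA; rewrite (_ : (fun x => _) = fun x => (-1) ^+ (j + i) * \det (row' j (col' i (A x)))).
  rewrite mxE; apply: cvgM; first exact: cvg_cst.
  apply: cvg_det => k l; rewrite !mxE.
  rewrite (_ : (fun x => _) = fun x => A x (lift j k) (lift i l)); first exact: cA.
  by apply/funext => x; rewrite !mxE.
by apply/funext => x; rewrite mxE.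
Qed.

(** [w *m A *m \adj A] equals [\det A] times [w], so a nonzero vector that [A] contracts strongly
    forces a small determinant. *)
Lemma det_le_adjugate (A : 'M[R]_d) (w : 'rV[R]_d) (B K : R) : 0 <= B -> 0 <= K ->
  (forall i j, `|(\adj A) i j| <= K) ->
  (forall j, `|(w *m A) 0 j| <= `|w| * B) ->
  w != 0 -> `|\det A| <= d%:R * (B * K).
Proof.
move=> B0 K0 AK wA w0; have wp : 0 < `|w| by rewrite normr_gt0.
have h i : `|\det A| * `|w 0 i| <= `|w| * (d%:R * (B * K)).
  have -> : `|\det A| * `|w 0 i| = `|(w *m A *m \adj A) 0 i|.
    by rewrite -mulmxA mul_mx_adj mul_mx_scalar mxE normrM.
  apply: le_trans (row_mulmx_le _ (AK ^~ i)) _.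
  have -> : `|w| * (d%:R * (B * K)) = d%:R * (`|w| * B * K) by ring.
  rewrite ler_wpM2l// ler_wpM2r//.
  by apply: norm_le_coord => [|i0 j]; rewrite ?mulr_ge0// [i0]ord1.
have [dA|dA] := eqVneq (\det A) 0; first by rewrite dA normr0 !mulr_ge0.
have dp : 0 < `|\det A| by rewrite normr_gt0.
rewrite -(ler_pM2r wp) [leRHS]mulrC -ler_pdivlMl//.
apply: norm_le_coord => [|i0 i]; first by rewrite mulr_ge0 ?invr_ge0// !mulr_ge0.
by rewrite [i0]ord1 ler_pdivlMl.
Qed.

(* Along a pair with equal images the mean value theorem gives, for each
   coordinate, a point of the segment where [w *m J] vanishes; by Hoelder
   continuity [w *m J] is then small at the endpoint as well, and so is [det J]. *)
Lemma det_jacobian_holder r F O (y : 'rV[R]_d) : 1 < r -> nbhs y O -> Cr_on r O F ->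
  (forall z, O z -> differentiable F z) ->
  (forall i, {for y, continuous (fun z => 'D_(delta_mx 0 i) F z)}) ->
  exists2 C : R, 0 <= C & \forall z \near y & z' \near y, F z = F z' -> z != z' ->
    `|\det (jacobian F z)| <= C * `|z' - z| `^ holder_exponent r.
Proof.
move=> r1 Oy CrF dF cD.
have [C CP] : exists C : 'I_d -> R, forall i, \forall z1 \near y & z2 \near y,
   `|'D_(delta_mx 0 i) F z1 - 'D_(delta_mx 0 i) F z2| <=
     C i * `|z1 - z2| `^ holder_exponent r.
  have P i := Cr_on_partial_holder i r1 Oy CrF.
  by exists (fun i => sval (cid (P i))) => i; exact: svalP (cid (P i)).
have alpha0 : 0 <= holder_exponent r by rewrite /holder_exponent; case: ifP => // _; lra.
pose K := \sum_i \sum_j (`|(\adj (jacobian F y)) i j| + 1).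
have K0 : 0 <= K by apply: sumr_ge0 => i _; apply: sumr_ge0 => j _; rewrite addr_ge0.
have adjK : \forall z \near y, forall i j, `|(\adj (jacobian F z)) i j| <= K.
  have jE i j z : O z -> jacobian F z i j = 'D_(delta_mx 0 i) F z 0 j.
    by move=> /dF; exact: jacobian_entry.
  have cJ i j : jacobian F z i j @[z --> y] --> jacobian F y i j.
    apply: (eq_ind_r (fun u => _ --> u) _ (jE i j y (nbhs_singleton Oy))).
    have c1 : ('D_(delta_mx 0 i) F z) 0 j @[z --> y] --> ('D_(delta_mx 0 i) F y) 0 j.
      exact: (cvg_comp (fun z => 'D_(delta_mx 0 i) F z) (fun A : 'rV[R]_d => A 0 j) (cD i)
        (@coord_continuous _ _ _ 0 j ('D_(delta_mx 0 i) F y))).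
    apply: cvg_trans c1; apply: near_eq_row.
    by apply: filterS Oy => z Oz; apply: esym; exact: jE.
  have near_ij i j : \forall z \near y,
      `|(\adj (jacobian F z)) i j| <= `|(\adj (jacobian F y)) i j| + 1.
    by apply: near_norm_le; exact: (@cvg_adjugate _ _ (nbhs_filter y) _ _ i j cJ).
  have nij := near_ord (fun i => near_ord (near_ij i)).
  apply: filterS nij => z zP i j; apply: le_trans (zP i j) _.
  rewrite /K (bigD1 i)//= (bigD1 j)//= -addrA lerDl addr_ge0// sumr_ge0// => k _.
  by apply: sumr_ge0 => l _; rewrite addr_ge0.
pose C' := \sum_i `|C i|.
have C'0 : 0 <= C' by apply: sumr_ge0.
exists (d%:R * (d%:R * C' * K)); first by rewrite !mulr_ge0.
have holderF : \forall z1 \near y & z2 \near y, forall i,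
   `|'D_(delta_mx 0 i) F z1 - 'D_(delta_mx 0 i) F z2| <=
     C' * `|z1 - z2| `^ holder_exponent r.
  have FF2 := @filter_prod_filter _ _ _ _ (nbhs_filter y) (nbhs_filter y).
  apply: (@filterS _ _ FF2 _ _ _ (filter_forall FF2 CP)) => -[z1 z2] /= h i.
  apply: le_trans (h i) _; rewrite ler_wpM2r ?powR_ge0//.
  by apply: le_trans (ler_norm _) _; rewrite /C' (bigD1 i)//= lerDl sumr_ge0.
have [[A B] /= [Ay By] ABP] := holderF.
have [e e0 eP] := nbhs_row_ball (filterI (filterI Ay By) (filterI Oy adjK)).
exists (ball y e, ball y e); first by split; exact: nbhsx_ballx.
move=> [z z'] /= [ze z'e] Fzz' zz'.
pose w := z' - z.
have z'E : z' = z + w by rewrite /w addrC subrK.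
have w0 : w != 0 by rewrite subr_eq0 eq_sym.
have seg (t : R) : 0 <= t <= 1 -> ball y e (z + t *: w).
  by move=> t01; apply: ball_segment; rewrite -?z'E.
have [[_ Bz] [Oz adjz]] := eP _ ze.
have := @det_le_adjugate (jacobian F z) w (d%:R * (C' * `|w| `^ holder_exponent r)) K.
have B0 : 0 <= d%:R * (C' * `|w| `^ holder_exponent r) by rewrite !mulr_ge0 ?powR_ge0.
move=> /(_ B0 K0 adjz _ w0) h; apply: (le_trans (h _)); last first.
  by rewrite le_eqVlt; apply/orP; left; apply/eqP; rewrite -/w; ring.
move=> j; have dseg (t : R) : 0 <= t <= 1 -> differentiable F (z + t *: w).
  by move=> /seg /eP[_ [/dF]].
have [t t01] := mean_value_coord j dseg.
rewrite -z'E Fzz' subrr mxE => /esym wJ0.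
have -> : (w *m jacobian F z) 0 j = (w *m (jacobian F z - jacobian F (z + t *: w))) 0 j.
  exact: row_mulmx_sub.
rewrite mulrCA; apply: row_mulmx_le => i.
have [[Az' _] _] := eP _ ze.
have [[_ Bt] _] := eP _ (seg t t01).
have := ABP (z, z + t *: w) (conj Az' Bt) i => /= hD.
have E : (jacobian F z - jacobian F (z + t *: w)) i j =
    ('D_(delta_mx 0 i) F z - 'D_(delta_mx 0 i) F (z + t *: w)) 0 j.
  apply: sub_entry_eq; first exact: (jacobian_entry i j (dF _ Oz)).
  exact: (jacobian_entry i j (dseg t t01)).
rewrite E; apply: le_trans (coord_le_norm _ _ _) _.
apply: le_trans hD _; rewrite ler_wpM2l//.
apply: ge0_ler_powR => //; rewrite ?nnegrE// opprD addNKr normrN normrZ.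
by case/andP: t01 => t0 t1; rewrite ger0_norm// ler_piMl.
Unshelve. all: by end_near. Qed.

End holder.

(** * Fibres *)

Section packing.
Context {R : realType}.

(** The integers counted run from [truncn a + 1] to [truncn b - 1]; rounding the two ends loses at
    most 2. *)
Lemma card_ord_between (N : nat) (a b : R) : 0 <= a -> b <= N%:R ->
  b - a - 2 <= #|[pred k : 'I_N | a < k%:R < b]|%:R.
Proof.
move=> a0 bN; have [b2|b2] := leP (b - a - 2) 0; first exact: le_trans b2 (ler0n _ _).
have b0 : 0 <= b by lra.
have /andP[a1 a2] := truncn_itv a0; have /andP[b1 b3] := truncn_itv b0.
set m := (Num.truncn a).+1; set n := Num.truncn b.
have nN : (n <= N)%N by rewrite -(ler_nat R); exact: le_trans bN.
have cardE : #|[pred k : 'I_N | (k < n) && (m <= k)]%N| = (n - m)%N.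
  rewrite -sum1_card -(big_geq_mkord m N (fun k => k < n)%N (fun=> 1%N)) -(big_nat_widen _ _ _ xpredT)//.
  by rewrite sum_nat_const_nat muln1.
apply: (@le_trans _ _ (n - m)%N%:R).
  rewrite lerBlDr lerBlDr (@le_trans _ _ (n%:R + 1))//.
    by rewrite -natr1 in b3; exact: ltW.
  have : (n%:R : R) <= (n - m)%N%:R + m%:R by rewrite -natrD ler_nat addnC -leq_subLR.
  by rewrite /m -natr1; lra.
rewrite ler_nat -cardE; apply: subset_leq_card; apply/fintype.subsetP => k.
rewrite !inE => /andP[kn mk]; apply/andP; split.
  by apply: lt_le_trans a2 _; rewrite ler_nat.
by apply: lt_le_trans b1; rewrite ltr_nat.
Qed.

(* The balls of radius [rho z / 2] around the points are disjoint: count the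
   points of a fine grid that fall in each of them. *)
Lemma packing_bound d (s : seq 'rV[R]_d) (rho : 'rV[R]_d -> R) : uniq s ->
  (forall z, z \in s -> 0 <= rho z <= 1) -> (forall z, z \in s -> `|z| <= 1) ->
  (forall z z', z \in s -> z' \in s -> z != z' -> rho z <= `|z - z'|) ->
  \sum_(z <- s) rho z ^+ d <= 8 ^+ d.
Proof.
move=> us rho01 z1 sep.
have rho0 z : z \in s -> 0 <= rho z by move=> /rho01/andP[].
(* One grid must be fine enough for all points at once: [N > S] gives [rho z * N >= 16] for every
   nonzero radius, while a zero radius adds [16 / 0 = 0]. *)
pose S := \sum_(z <- s) 16 / rho z.
have S_ge z : z \in s -> 16 / rho z <= S.
  move=> zs; rewrite /S (big_rem z)//= lerDl big_seq sumr_ge0// => y /mem_rem ys.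
  by rewrite divr_ge0// rho0.
have S0 : 0 <= S by rewrite /S big_seq sumr_ge0// => y ys; rewrite divr_ge0// rho0.
pose N := (Num.truncn S).+1.
have SN : S <= N%:R by apply: ltW; exact: truncnS_gt.
have N0 : 0 < N%:R :> R by rewrite ltr0n.
have rhoN z : z \in s -> rho z != 0 -> 16 <= rho z * N%:R.
  move=> zs r0; have rp : 0 < rho z by rewrite lt_neqAle eq_sym r0 rho0.
  by rewrite mulrC -ler_pdivrMr//; apply: le_trans (S_ge z zs) SN.
(* A grid of step [4 / N] on [-2, 2], which contains all the balls since the radii are at most 1/2.
   An interval of length [rho] contains at least [rho N / 4 - 2] grid points, and this is at least
   [rho N / 8] as soon as [rho N >= 16]: hence the constant 8. *)
pose pt (k : 'I_N) : R := -2 + 4 * k%:R / N%:R.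
pose F (z : 'rV[R]_d) (i : 'I_d) := [pred k : 'I_N | `|pt k - z 0 i| < rho z / 2].
pose Q z := [pred g : {ffun 'I_d -> 'I_N} | [forall i, F z i (g i)]].
have cardF z i : z \in s -> rho z * N%:R / 8 <= #|F z i|%:R.
  move=> zs; have [->|r0] := eqVneq (rho z) 0; first by rewrite mul0r mul0r.
  have zi : `|z 0 i| <= 1 by apply: le_trans (coord_le_norm _ _ _) (z1 z zs).
  have /andP[h0 h1] := rho01 z zs; have hN := rhoN z zs r0.
  move: zi; rewrite ler_norml => /andP[zi1 zi2].
  pose a := (z 0 i + 2 - rho z / 2) * (N%:R / 4).
  pose b := (z 0 i + 2 + rho z / 2) * (N%:R / 4).
  have a0 : 0 <= a by rewrite mulr_ge0 ?divr_ge0//; lra.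
  have bN : b <= N%:R.
    rewrite /b mulrCA -[leRHS]mulr1 ler_pM2l//; lra.
  apply: le_trans (le_trans (card_ord_between a0 bN) _).
    rewrite (_ : b - a = rho z * N%:R / 4); last by rewrite /a /b; field.
    by lra.
  rewrite ler_nat; apply: subset_leq_card; apply/fintype.subsetP => k.
  rewrite !inE => /andP[ak kb].
  have E (x : R) : pt k - x = (k%:R - (x + 2) * (N%:R / 4)) * (4 / N%:R).
    by rewrite /pt; field; rewrite gt_eqF.
  rewrite E normrM (ger0_norm (_ : 0 <= 4 / N%:R)); last by rewrite divr_ge0// ltW.
  rewrite -ltr_pdivlMr ?divr_gt0// invf_div ltr_norml.
  have e1 : rho z / 2 * (N%:R / 4) + (z 0 i + 2) * (N%:R / 4) = b by rewrite /b; ring.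
  have e2 : (z 0 i + 2) * (N%:R / 4) - rho z / 2 * (N%:R / 4) = a by rewrite /a; ring.
  by apply/andP; split; lra.
have cardQ z : z \in s -> (rho z * N%:R / 8) ^+ d <= #|Q z|%:R.
  move=> zs; have -> : #|Q z| = #|(family (F z) : pred _)| by apply: eq_card => g; rewrite !inE.
  rewrite card_family foldrE big_map big_enum/= natr_prod.
  rewrite -[X in _ ^+ X]card_ord -prodr_const; apply: ler_prod => i _.
  by rewrite cardF// andbT !mulr_ge0 ?rho0// ltW.
(* A grid point common to two balls would make [z] and [z'] differ by less than the mean of their
   radii in the coordinate that realises the sup norm of [z - z'], against separation. *)
have disj (g : {ffun 'I_d -> 'I_N}) : (count (fun z => Q z g) s <= 1)%N.
  rewrite -size_filter; case E : (seq.filter _ s) => [//|z [//|z' l]].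
  have /filter_uniq uf := us; have := uf (fun z => Q z g); rewrite E /= inE negb_or.
  move=> /andP[/andP[zz' _] _].
  have : z \in seq.filter (fun z => Q z g) s by rewrite E mem_head.
  have : z' \in seq.filter (fun z => Q z g) s by rewrite E !inE eqxx orbT.
  rewrite !mem_filter => /andP[/forallP Qz' z's] /andP[/forallP Qz zs].
  have n0 : mx_norm (z - z') != 0 by apply/negP => /eqP/mx_norm_eq0/eqP; rewrite subr_eq0 (negPf zz').
  have [[i0 i] /= E'] := mx_norm_neq0 n0; move: E'; rewrite [i0]ord1 !mxE => E'.
  have s1 := sep z z' zs z's zz'; have := sep z' z z's zs; rewrite eq_sym => /(_ zz').
  rewrite distrC => s2; move: s1 s2; rewrite [`|z - z'|]E'.
  have := Qz i; have := Qz' i; rewrite /= => q1 q2 s1 s2.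
  have : `|z 0 i - z' 0 i| <= `|pt (g i) - z 0 i| + `|pt (g i) - z' 0 i|.
    rewrite [in X in _ <= X + _]distrC; apply: le_trans (ler_normD _ _).
    by rewrite addrA subrK.
  by move=> q; exfalso; lra.
have total : (\sum_(z <- s) #|Q z| <= N ^ d)%N.
  have -> : (N ^ d)%N = #|{ffun 'I_d -> 'I_N}| by rewrite card_ffun !card_ord.
  rewrite -sum1_card.
  have -> : (\sum_(z <- s) #|Q z|)%N = (\sum_(g : {ffun 'I_d -> 'I_N}) count (fun z => Q z g) s)%N.
    under eq_bigr do rewrite -sum1_card big_mkcond/=.
    rewrite exchange_big/=; apply: eq_bigr => g _.
    rewrite -sum1_count [RHS]big_mkcond/=; apply: eq_bigr => z _.
    by rewrite inE.
  exact: leq_sum.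
have : \sum_(z <- s) (rho z * N%:R / 8) ^+ d <= N%:R ^+ d.
  apply: (@le_trans _ _ (\sum_(z <- s) #|Q z|%:R)).
    by rewrite big_seq [leRHS]big_seq; apply: ler_sum => z; exact: cardQ.
  by rewrite -natr_sum -natrX ler_nat.
under eq_bigr do rewrite -mulrA exprMn.
rewrite -mulr_suml -ler_pdivlMr ?exprn_gt0 ?divr_gt0//.
suff -> : N%:R ^+ d / (N%:R / 8) ^+ d = 8 ^+ d :> R by [].
rewrite -expr_div_n; congr (_ ^+ _); field.
by rewrite gt_eqF.
Qed.

End packing.

Lemma compact_finite_cover {M : ptopologicalType} (U : M -> set M) :
  compact [set: M] -> (forall p, open (U p)) -> (forall p, U p p) ->
  exists s : seq M, forall x, exists2 p, p \in s & U p x.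
Proof.
rewrite (@compact_cover M) => cM oU Up.
have [|D _ cD] := cM M setT U (fun p _ => oU p); first by move=> x _; exists x.
exists (finmap.enum_fset D) => x; have [p pD Upx] := cD x I; exists p => //; exact: pD.
Qed.

Lemma open_nbhs_and3 {M : topologicalType} (p : M) (A B C : set M) :
  nbhs p A -> nbhs p B -> nbhs p C ->
  exists U, [/\ open U, U p & forall x, U x -> (A x /\ B x) /\ C x].
Proof.
move=> Ap Bp Cp; have : nbhs p (A `&` B `&` C) by apply: filterI => //; exact: filterI.
by rewrite nbhsE => -[U [oU Up] UABC]; exists U; split=> // x /UABC.
Qed.

(** * Local injectivity and fibre sums of powers of the Jacobian *)

Section local_estimates.
Context {R : realType} {d : nat} {M : ptopologicalType} (g : riemannian_manifold R d M).
Variables (r : R) (r_gt1 : 1 < r) (f : M -> M) (f_Cr : Cr_map g r f).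

Local Notation dom a := (chart_dom (g a)).
Local Notation phi a := (chart_map (g a)).
Local Notation jac := (abs_jac g f).

(** An integer [n] whose product with the exponent is at least 1: on distances at most 1, the n-th
    power of a Hoelder bound is a linear bound. *)
Definition holder_power := (Num.truncn (holder_exponent r)^-1).+1.

Lemma holder_exponent_gt0 : 0 < holder_exponent r.
Proof. by rewrite /holder_exponent; case: ifP => // _; rewrite subr_gt0. Qed.

Lemma holder_power_ge1 : 1 <= holder_exponent r * holder_power%:R.
Proof.
by rewrite mulrC -ler_pdivrMr ?holder_exponent_gt0// mul1r ltW// truncnS_gt.
Qed.

Let power_bound (D k K C w a : R) n : 0 <= D -> 0 <= k -> k <= K -> 0 <= C ->
  0 < w <= 1 -> D <= C * w `^ a -> 1 <= a * n%:R -> (D * k) ^+ n <= (K * C) ^+ n * w.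
Proof.
move=> D0 k0 kK C0 w01 DC an; have K0 : 0 <= K by exact: le_trans kK.
apply: (@le_trans _ _ ((K * C * w `^ a) ^+ n)).
  apply: lerXn2r; rewrite ?nnegrE ?mulr_ge0 ?powR_ge0//.
  by rewrite -mulrA [K * _]mulrC ler_pM.
by rewrite exprMn ler_wpM2l ?exprn_ge0 ?mulr_ge0// -powR_mulrn ?powR_ge0// -powRrM ge1r_powR.
Qed.

(** [det_jacobian_holder] read in the charts at [p] and [f p]: the factor [kappa] relating the
    determinant to the Jacobian is bounded near [p], and the power [holder_power] makes the estimate
    linear in the distance. *)
Lemma abs_jac_holder (p : M) : exists (U : set M) (C : R),
  [/\ open U, U p, U `<=` dom p, 0 <= C &
      forall x x', U x -> U x' -> `|phi p x - phi p x'| <= 1 /\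
        (f x = f x' -> x != x' -> jac x ^+ holder_power <= C * `|phi p x - phi p x'|)].
Proof.
have pp := chart_at_dom g p; have fp := chart_at_dom g (f p).
pose F := local_rep (g p) (g (f p)) f; pose y := phi p p.
pose O := [set z | exists2 x, dom p x /\ dom (f p) (f x) & z = phi p x].
have domp : \forall x \near p, dom p x /\ dom (f p) (f x).
  near=> x; split; near: x; first exact: dom_near.
  exact: (f_continuous f_Cr (dom_near fp)).
have Oy : nbhs y O.
  by apply: filterS (phi_inv_near pp domp) => z [x [_ hx] [-> _]]; exists x.
have CrF : Cr_on r O F.
  case: f_Cr => _ /(_ p (f p)); rewrite (_ : local_dom _ _ _ = O)//.
  apply/seteqP; split => [_ [x hx <-]|_ [x hx ->]]; by exists x.
have dF z : O z -> differentiable F z.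
  by move=> Oz; exact: Cr_on_differentiable CrF Oz.
have cD i : {for y, continuous (fun z => 'D_(delta_mx 0 i) F z)}.
  by apply: (Cr_on_partial_continuous r_gt1 CrF); exact: nbhs_singleton.
have [C C0 [[A B] /= [Ay By] ABP]] := det_jacobian_holder r_gt1 Oy CrF dF cD.
have [e e0 eP] := nbhs_row_ball (filterI Ay By).
pose kappa x := Num.sqrt (gram_det g (f p) (f x)) / Num.sqrt (gram_det g p x).
have ckappa : {for p, continuous kappa}.
  apply: cvgM.
    apply: (cvg_comp (fun y => gram_det g (f p) (f y)) (@Num.sqrt R)); last exact: sqrt_continuous.
    have cf : {for p, continuous f} by exact: (f_continuous f_Cr).
    exact: (continuous_comp cf (gram_det_cont fp)).
  apply: cvgV; first by rewrite gt_eqF// sqrtr_gt0 gram_det_gt0.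
  apply: (cvg_comp (gram_det g p) (@Num.sqrt R)); last exact: sqrt_continuous.
  exact: gram_det_cont.
pose K := `|kappa p| + 1.
have lt1 : `|kappa p| < K by rewrite ltrDl.
have nkappa : \forall x \near p, `|kappa x| <= K by exact: (cvgr_norm_le _ ckappa _ lt1).
(* Radius at most 1/2, so that coordinate distances within [U] are at most 1 and raising the
   exponent does not spoil the bound. *)
have ball_near : \forall x \near p, ball y (Num.min e (2^-1)) (phi p x).
  by apply: (chart_map_cont pp); apply: nbhsx_ballx; rewrite lt_min e0/=.
have [U [oU Up UP]] := open_nbhs_and3 domp nkappa ball_near.
exists U, ((K * C) ^+ holder_power); split => //.
- by move=> x /UP[[[]]].
- by rewrite exprn_ge0// mulr_ge0// addr_ge0.
move=> x x' /UP[[[px fx] kx] bx] /UP[[[px' fx'] kx'] bx'].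
have ballE z : ball y (Num.min e (2^-1)) z -> ball y e z /\ `|y - z| < 2^-1.
  by rewrite -ball_normE /ball_ /= lt_min => /andP[].
have [bex hx] := ballE _ bx; have [bex' hx'] := ballE _ bx'.
have w1 : `|phi p x - phi p x'| <= 1.
  have -> : phi p x - phi p x' = (y - phi p x') - (y - phi p x).
    by rewrite opprB [RHS]addrC addrA subrK.
  by apply: le_trans (ler_normB _ _) _; lra.
split => // ffx xx'.
have phxx' : phi p x != phi p x'.
  by apply: contra_neq xx' => E; rewrite -(chart_mapK px) E chart_mapK.
have [[Ax _] [_ Bx']] := (eP _ bex, eP _ bex').
have FE : F (phi p x) = F (phi p x') by rewrite /F /local_rep !chart_mapK// ffx.
have := ABP (phi p x, phi p x') (conj Ax Bx') FE phxx' => /= detC.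
set w := `|phi p x - phi p x'|; have w0 : 0 < w by rewrite normr_gt0 subr_eq0.
have -> : jac x = `|\det (jacobian F (phi p x))| * kappa x.
  by rewrite (abs_jacE r_gt1 f_Cr px fx) mulrA.
rewrite distrC -/w in detC.
apply: (power_bound _ _ _ _ _ detC holder_power_ge1); rewrite ?w0//.
  by rewrite divr_ge0// sqrtr_ge0.
exact: le_trans (ler_norm _) kx.
Unshelve. all: by end_near. Qed.

(** Two distinct points near [p] with the same image are close, so [abs_jac_holder] makes the
    Jacobian there small, whereas by continuity it is at least half its nonzero value at [p]. *)
Lemma abs_jac_locally_injective (p : M) : jac p != 0 ->
  exists U, [/\ open U, U p & set_inj U f].
Proof.
move=> jp; have jp0 : 0 < jac p by rewrite lt_neqAle eq_sym jp abs_jac_ge0.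
have [U [C [oU Up Udom C0 hU]]] := abs_jac_holder p.
pose c := (jac p / 2) ^+ holder_power / (C + 1).
have C1 : 0 < C + 1 by rewrite ltr_wpDl.
have c0 : 0 < c by apply: divr_gt0 => //; apply: exprn_gt0; apply: divr_gt0.
have pp := chart_at_dom g p.
have near_jac : \forall x \near p, jac p / 2 <= jac x.
  by apply: (cvgr_ge _ (abs_jac_cont r_gt1 f_Cr (x := p))); rewrite ltr_pdivrMr// ltr_pMr// ltr1n.
have near_ball : \forall x \near p, ball (phi p p) (c / 2) (phi p x).
  by apply: (chart_map_cont pp); apply: nbhsx_ballx; rewrite divr_gt0.
have [V [oV Vp VP]] := open_nbhs_and3 near_jac near_ball (open_nbhs_nbhs (conj oU Up)).
 exists V; split => //.
move=> x x' /set_mem Vx /set_mem Vx' fxx'; apply/eqP; apply: contraPT isT => xx' _.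
have [[jx bx] Ux] := VP _ Vx; have [[_ bx'] Ux'] := VP _ Vx'.
have [_ /(_ fxx' xx') H] := hU x x' Ux Ux'.
have : `|phi p x - phi p x'| < c.
  have -> : phi p x - phi p x' = (phi p p - phi p x') - (phi p p - phi p x).
    by rewrite opprB [RHS]addrC addrA subrK.
  move: bx bx'; rewrite -!ball_normE /ball_ /= => b1 b2.
  by apply: le_lt_trans (ler_normB _ _) _; lra.
rewrite /c ltr_pdivlMr// => H2.
have H3 : (jac p / 2) ^+ holder_power <= jac x ^+ holder_power.
  by apply: lerXn2r => //; rewrite nnegrE ?abs_jac_ge0// divr_ge0// ltW.
have : `|phi p x - phi p x'| * C <= `|phi p x - phi p x'| * (C + 1).
  by rewrite ler_wpM2l// lerDl.
by rewrite mulrC => H4; have := lt_le_trans H2 (le_trans H3 (le_trans H H4)); rewrite ltxx.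
Qed.

Lemma abs_jac_fiber_bound (J0 : R) : compact [set: M] -> (forall x, jac x <= J0) ->
  exists C : R, forall x (s : seq M), uniq s -> (forall y, y \in s -> f y = x) ->
    \sum_(y <- s) jac y ^+ (holder_power * d) <= C.
Proof.
move=> cM jJ0.
have [U /(_ _)/cid UC] := choice abs_jac_holder.
pose C p := sval (UC p).
have CP p := svalP (UC p); rewrite -/(C _) in CP.
have [|p|ps psP] := compact_finite_cover (U := U) cM; first by move=> p; case: (CP p).
  by case: (CP p).
(* Dividing by [B p] brings the radii below both 1 and the distances between fibre points:
   [|J0| ^+ n] serves the first, [C p] the second, and 1 makes [B p] positive. *)
pose n := holder_power; pose B p := C p + `|J0| ^+ n + 1.
have B0 p : 0 < B p by case: (CP p) => _ _ _ C0 _; rewrite ltr_wpDl// addr_ge0// exprn_ge0.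
exists (\sum_(p <- ps) (8 * B p) ^+ d) => x s us fs.
apply: (@le_trans _ _ (\sum_(p <- ps) \sum_(y <- s | y \in U p) jac y ^+ (n * d))).
  under [leRHS]eq_bigr do rewrite big_mkcond.
  rewrite exchange_big/=; apply: ler_sum => y _.
  have [p pps Up] := psP y.
  rewrite (big_rem p)//= mem_set// lerDl sumr_ge0// => q _.
  by case: ifP => // _; rewrite exprn_ge0// abs_jac_ge0.
apply: ler_sum => p _; rewrite -big_filter.
have [oU Up Udom C0 hU] := CP p.
pose t := [seq y <- s | y \in U p].
have tU y : y \in t -> U p y by rewrite mem_filter => /andP[/set_mem].
have ts y : y \in t -> f y = x by rewrite mem_filter => /andP[_ /fs].
have inj_t : {in t &, injective (fun y => phi p y - phi p p)}.
  move=> y y' /tU/Udom py /tU/Udom py' /addIr E.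
  by rewrite -(chart_mapK py) E chart_mapK.
(* Coordinates are translated by [phi p p] to lie in the unit ball, and the radius is expressed as a
   function of the coordinates. *)
pose rho z := jac (chart_inv (g p) (z + phi p p)) ^+ n / B p.
have rhoE y : y \in t -> rho (phi p y - phi p p) = jac y ^+ n / B p.
  by move=> /tU/Udom py; rewrite /rho subrK chart_mapK.
have -> : \sum_(y <- t) jac y ^+ (n * d) =
    \sum_(z <- [seq phi p y - phi p p | y <- t]) rho z ^+ d * B p ^+ d.
  rewrite big_map big_seq [RHS]big_seq; apply: eq_bigr => y yt.
  by rewrite rhoE// -exprMn divfK ?gt_eqF// exprM.
rewrite -mulr_suml exprMn ler_pM2r ?exprn_gt0//.
apply: packing_bound.
- by rewrite map_inj_in_uniq// filter_uniq.
- move=> _ /mapP[y yt ->]; rewrite rhoE// divr_ge0 ?exprn_ge0 ?abs_jac_ge0//=; last exact: ltW.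
  rewrite ler_pdivrMr// mul1r /B; apply: (@le_trans _ _ (`|J0| ^+ n)).
    apply: lerXn2r; rewrite ?nnegrE ?abs_jac_ge0//.
    exact: le_trans (jJ0 y) (ler_norm _).
  by rewrite addrAC lerDr addr_ge0.
- by move=> _ /mapP[y yt ->]; have [] := hU y p (tU y yt) Up.
move=> _ _ /mapP[y yt ->] /mapP[y' y't ->] yy'.
rewrite rhoE// ler_pdivrMr// opprB addrA subrK.
have ne : y != y' by apply: contra_neq yy' => ->.
have [_ ] := hU y y' (tU y yt) (tU y' y't).
rewrite (ts y yt) (ts y' y't) => /(_ erefl ne) H; apply: le_trans H _.
rewrite mulrC ler_wpM2l// /B -addrA lerDl addr_ge0// exprn_ge0//.
Qed.

End local_estimates.

(** * Riemannian distance *)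

Section quadratic_forms.
Context {R : realType} {d : nat}.
Implicit Types (G : 'M[R]_d) (v : 'rV[R]_d).

Definition quad_form G v : R := (v *m G *m v^T) 0 0.

Lemma quad_formE G v : quad_form G v = \sum_j (\sum_i v 0 i * G i j) * v 0 j.
Proof. by rewrite /quad_form mxE; apply: eq_bigr => j _; rewrite !mxE. Qed.

Lemma quad_formZ G (k : R) v : quad_form G (k *: v) = k ^+ 2 * quad_form G v.
Proof.
rewrite !quad_formE mulr_sumr; apply: eq_bigr => j _.
rewrite mxE; under eq_bigr do rewrite mxE -mulrA.
by rewrite -mulr_sumr; ring.
Qed.

Lemma quad_form_continuous G : continuous (quad_form G).
Proof.
move=> v; rewrite /continuous_at quad_formE.
rewrite (_ : quad_form G = fun w => \sum_j (\sum_i w 0 i * G i j) * w 0 j); last first.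
  by apply/funext => w; exact: quad_formE.
have FF := nbhs_filter v.
apply: cvg_bigsum => j; apply: cvgM; last exact: coord_continuous.
apply: cvg_bigsum => i; apply: cvgM; first exact: coord_continuous.
exact: cvg_cst.
Qed.

(** The form has a positive minimum on the compact unit sphere; homogeneity extends the bound to all
    vectors. *)
Lemma quad_form_lower_bound G : (forall v, v != 0 -> 0 < quad_form G v) ->
  exists2 l : R, 0 < l & forall v, l * `|v| ^+ 2 <= quad_form G v.
Proof.
move=> Gpos; pose D := [set v : 'rV[R]_d | `|v| = 1].
have cD : compact D.
  apply: bounded_closed_compact.
    by exists 1; split=> [|x x1 v /= ->]; [exact: num_real|exact: ltW].
  rewrite (_ : D = (fun v : 'rV[R]_d => `|v|) @^-1` [set 1])//.
  apply: preimage_closed => // v _; exact: norm_continuous.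
have Dpos v : D v -> 0 < quad_form G v.
  by move=> Dv; apply: Gpos; rewrite -normr_gt0 Dv.
have [c [c0 _ cG]] := compact_lower_bound cD (@quad_form_continuous G) Dpos.
exists c => // v; have [->|v0] := eqVneq v 0.
  by rewrite normr0 expr0n mulr0 -[X in quad_form _ X](scale0r 0) quad_formZ expr0n mul0r.
have nv : 0 < `|v| by rewrite normr_gt0.
have Du : D (`|v|^-1 *: v).
  by rewrite /D/= normrZ gtr0_norm ?invr_gt0// mulVf// gt_eqF.
have := cG _ Du; rewrite quad_formZ exprVn => H.
by rewrite mulrC -ler_pdivlMl ?exprn_gt0.
Qed.

Lemma quad_form_perturb G G' (e : R) v : 0 <= e -> (forall i j, `|(G - G') i j| <= e) ->
  `|quad_form G v - quad_form G' v| <= d%:R ^+ 2 * e * `|v| ^+ 2.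
Proof.
move=> e0 Ge.
have -> : quad_form G v - quad_form G' v = (v *m (G - G') *m v^T) 0 0.
  by rewrite /quad_form mulmxBr mulmxBl [RHS]mxE [X in _ = _ + X]mxE.
apply: (le_trans (row_mulmx_le (B := `|v|) _ _)).
  by move=> i; rewrite mxE; exact: coord_le_norm.
have H : `|v *m (G - G')| <= d%:R * (`|v| * e).
  apply: norm_le_coord => [|i0 j]; first by rewrite !mulr_ge0.
  by rewrite [i0]ord1; exact: row_mulmx_le.
apply: (@le_trans _ _ (d%:R * (d%:R * (`|v| * e) * `|v|))).
  by rewrite ler_wpM2l// ler_wpM2r.
by rewrite le_eqVlt; apply/orP; left; apply/eqP; ring.
Qed.

End quadratic_forms.

Section curves.
Context {R : realType}.

(** Squaring makes the positive part continuously differentiable across 0, which the bump functions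
    along curves require. *)
Lemma is_derive_max0_sqr (s : R) :
  is_derive s 1 (fun x : R => Num.max 0 x ^+ 2) (2 * Num.max 0 s).
Proof.
have [s0|s0|s0] := ltgtP s 0.
- have d0 : is_derive s 1 (fun _ : R => 0 : R) 0 by exact: is_derive_cst.
  rewrite mulr0; apply: (near_eq_is_derive _ d0).
  near=> x; rewrite /= max_l ?expr0n//; apply/ltW; near: x.
  exact: lt_nbhsl.
- have dX : is_derive s 1 (fun x : R => x ^+ 2) (2 * s).
    have := @is_deriveX R R^o id 2 s 1 1 (is_derive_id _ _).
    by rewrite /= expr1 /GRing.scale /= mulr1.
  apply: (near_eq_is_derive _ dX).
  near=> x; rewrite max_r//; apply/ltW; near: x.
  exact: lt_nbhsr.
subst s.
pose F (x : R) : R^o := Num.max 0 x ^+ 2.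
have c0 : (fun h : R => h^-1 *: (F (h *: (1 : R^o) + 0) - F 0)) @ 0^' --> (2 * 0 : R^o).
  rewrite /F maxxx mulr0 expr0n/=; apply/cvgrPdist_le => e e0.
  near=> h; rewrite sub0r normrN addr0 subr0 /GRing.scale /= mulr1.
  have h0 : h != 0 by near: h; exact: nbhs_dnbhs_neq.
  have he : `|h| <= e by near: h; apply: dnbhs0_le.
  rewrite normrM normfV normrX.
  have m : `|Num.max 0 h| <= `|h|.
    by rewrite ger0_norm ?le_max ?lexx// ge_max normr_ge0 ler_norm.
  rewrite ler_pdivrMl ?normr_gt0// expr2 ler_pM//.
  exact: le_trans he.
apply: DeriveDef; first by apply/cvg_ex; exists (2 * 0).
exact: (cvg_lim _ c0).
Unshelve. all: by end_near. Qed.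

Lemma derive1_comp_row m n (w : R -> 'rV[R]_m) (F : 'rV[R]_m -> 'rV[R]_n) (t : R) :
  derivable w t 1 -> differentiable F (w t) ->
  derive1 (F \o w) t = derive1 w t *m jacobian F (w t).
Proof.
move=> /derivable1_diffP dw dF.
rewrite !derive1E' //; last exact: differentiable_comp.
by rewrite -(deriveEjacobian _ dF) (deriveE _ dF) (diff_comp dw dF).
Qed.

Lemma derive1_near_eq n (u v : R -> 'rV[R]_n) (t : R) :
  (\forall s \near t, u s = v s) -> derive1 u t = derive1 v t.
Proof. by move=> uv; rewrite !derive1E; exact: near_eq_derive. Qed.

Lemma is_derive_coord n (w : R -> 'rV[R]_n) (t : R) i : derivable w t 1 ->
  is_derive t 1 (fun s => w s 0 i) (derive1 w t 0 i).
Proof.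
move=> dw; apply: DeriveDef; first exact: ((derivable_mxP _ _ _).1 dw).
by rewrite derive1E derive_mx// mxE.
Qed.

Lemma is_derive_bigsum n (h : 'I_n -> R -> R) (dh : 'I_n -> R) (t : R) :
  (forall i, is_derive t 1 (h i) (dh i)) ->
  is_derive t 1 (fun s => \sum_i h i s) (\sum_i dh i).
Proof.
move=> hi; have -> : (fun s => \sum_i h i s) = \sum_i h i.
  by apply/funext => s; rewrite fct_sumE.
exact: is_derive_sum.
Qed.

Lemma ftc_lower_bound (u u' v : R -> R) : (forall t : R, is_derive t 1 u (u' t)) ->
  continuous u' -> (forall t, `|u' t| <= v t) ->
  (`|u 1 - u 0|%:E <= \int[lebesgue_measure]_(t in `[0%R, 1%R]) (v t)%:E)%E.
Proof.
move=> du cu' uv.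
have dv (t : R) : derivable u t 1 by have [] := du t.
have cu (t : R) : {for t, continuous u}.
  by apply: differentiable_continuous; exact/derivable1_diffP.
have := @continuous_FTC2 R u' u 0 1 ltr01 (continuous_subspaceT cu').
move=> /(_ _ _)/esym E.
have {}E : (u 1 - u 0)%:E = (\int[lebesgue_measure]_(t in `[0%R, 1%R]) (u' t)%:E)%E.
  rewrite EFinB; apply: E.
    split; first by move=> t _; exact: dv.
      exact: cvg_at_right_filter (cu 0).
    exact: cvg_at_left_filter (cu 1).
  by move=> t _; rewrite derive1E; have [] := du t.
rewrite -abse_EFin E; apply: le_trans (le_abse_integral _ _ _) _ => //.
  apply/measurable_EFinP; apply: measurable_funTS.
  exact: continuous_measurable_fun.
rewrite integral_mkcond [leRHS]integral_mkcond; apply: ge0_le_integral_any => t.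
  by rewrite patchE; case: ifP => // _; exact: abse_ge0.
by rewrite !patchE; case: ifP => // _; rewrite abse_EFin lee_fin.
Qed.

End curves.

Section lengths.
Context {R : realType} {d : nat} {M : topologicalType} (g : riemannian_manifold R d M).

Local Notation dom a := (chart_dom (g a)).
Local Notation phi a := (chart_map (g a)).

(** The bound [l] for the metric frozen at [p] survives with [l / 2] nearby: [e] is chosen so that
    moving every Gram entry by at most [e] changes the form by at most half of it. *)
Lemma metric_lower_bound p : exists2 l : R, 0 < l &
  \forall z \near phi p p, forall v, l * `|v| ^+ 2 <= quad_form (gram g p z) v.
Proof.
have pp := chart_at_dom g p.
have [l l0 lG] := quad_form_lower_bound (gram_posdef pp).
pose e := l / 2 / (d%:R ^+ 2 + 1).
have D1 : 0 < d%:R ^+ 2 + 1 :> R by rewrite ltr_wpDl// exprn_ge0.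
have e0 : 0 < e by rewrite !divr_gt0.
exists (l / 2); first by rewrite divr_gt0.
have cg : {for phi p p, continuous (gram g p)}.
  by apply: smooth_on_continuous (gram_smooth g p) _; exists p.
have : \forall z \near phi p p, `|gram g p (phi p p) - gram g p z| <= e.
  exact: ((@cvgrPdist_le _ _ _ _ (nbhs_filter (phi p p)) _ _).1 cg e e0).
apply: filterS => z zE v.
have H : `|quad_form (gram g p (phi p p)) v - quad_form (gram g p z) v| <=
    d%:R ^+ 2 * e * `|v| ^+ 2.
  apply: quad_form_perturb (ltW e0) _ => i j.
  exact: le_trans (coord_le_norm _ _ _) zE.
have H1 : d%:R ^+ 2 * e * `|v| ^+ 2 <= l / 2 * `|v| ^+ 2.
  rewrite ler_wpM2r ?exprn_ge0// /e mulrA ler_pdivrMr// mulrC ler_wpM2l//.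
    by rewrite divr_ge0// ltW.
  by rewrite lerDl.
have := lG v; move: H; rewrite ler_norml => /andP[_].
by rewrite /quad_form /=; move: H1; lra.
Qed.

(* The speed is computed in the chart of index [c t]; the change of chart
   formula for the Gram matrix makes any other chart as good. *)
Lemma speedE (c : R -> M) t p : C1_curve g c -> dom p (c t) ->
  speed g c t = Num.sqrt (quad_form (gram g p (phi p (c t))) (derive1 (phi p \o c) t)).
Proof.
move=> [cc dc] pt; rewrite /speed; set a := c t.
have aa : dom a a by exact: chart_at_dom.
have [da _] := dc a t aa.
pose T := local_rep (g a) (g p) id.
have dT : differentiable T (phi a a) by exact: transition_differentiable.
have near_a : \forall s \near t, dom a (c s) by exact: (cc t _ (dom_near aa)).
have E1 : derive1 (phi p \o c) t = derive1 (T \o (phi a \o c)) t.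
  apply: derive1_near_eq; apply: filterS near_a => s as_.
  by rewrite /= /T /local_rep chart_mapK.
rewrite E1 derive1_comp_row// -/a (gram_change aa pt) /quad_form.
by rewrite trmx_mul !mulmxA.
Qed.

Let speed_bound (e D m W l s S : R) : 0 < e -> 0 <= D -> 0 < l -> 0 <= m -> m <= e ^+ 2 ->
  0 <= W -> l * W ^+ 2 <= s -> `|S| <= D * (2 * e * W) ->
  `|Num.sqrt l / (4 * D * e ^+ 3 + 1) * (2 * m * S)| <= Num.sqrt s.
Proof.
move=> e0 D0 l0 m0 me W0 ls SD.
have K0 : 0 < 4 * D * e ^+ 3 + 1 by rewrite ltr_wpDl// !mulr_ge0 ?exprn_ge0// ltW.
have sl0 : 0 < Num.sqrt l by rewrite sqrtr_gt0.
have H : Num.sqrt l * W <= Num.sqrt s.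
  have -> : Num.sqrt l * W = Num.sqrt (l * W ^+ 2) by rewrite sqrtrM ?ltW// sqrtr_sqr ger0_norm.
  by rewrite ler_sqrt// (le_trans _ ls)// mulr_ge0 ?exprn_ge0// ltW.
apply: le_trans H.
rewrite !normrM normfV (ger0_norm (ltW K0)) (ger0_norm (ltW sl0)) (ger0_norm m0) ger0_norm//.
rewrite -mulrA ler_wpM2l ?(ltW sl0)// ler_pdivrMl//.
apply: (@le_trans _ _ (2 * e ^+ 2 * (D * (2 * e * W)))).
  by apply: ler_pM => //; [rewrite mulr_ge0|rewrite ler_wpM2l].
rewrite (_ : _ * _ = 4 * D * e ^+ 3 * W); last by ring.
by rewrite ler_wpM2r// lerDl.
Qed.

(** In the chart at [p] the function is a multiple of the square of the positive part of [e1 ^+ 2]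
    minus the squared Euclidean distance, extended by 0. Its derivative along any C^1 curve is
    bounded by the speed, so it is 1-Lipschitz for the Riemannian distance. *)
Lemma local_bump p (U : set M) : hausdorff_space M -> open U -> U p ->
  exists psi : M -> R, [/\ 0 < psi p, {for p, continuous psi},
    forall y, ~ U y -> psi y = 0 &
    forall c, C1_curve g c -> exists2 u' : R -> R, continuous u' &
      forall t : R, is_derive t 1 (psi \o c) (u' t) /\ `|u' t| <= speed g c t].
Proof.
move=> hM oU Up; have pp := chart_at_dom g p.
have [l l0 nearl] := metric_lower_bound p.
have nearU : \forall x \near p, U x by exact: open_nbhs_nbhs.
have [e e0 eP] := nbhs_row_ball (filterI (phi_inv_near pp nearU) nearl).
pose y0 := phi p p; pose e1 := e / 2.
have e10 : 0 < e1 by rewrite divr_gt0.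
have e1e : e1 < e by rewrite ltr_pdivrMr// ltr_pMr// ltr1n.
(* A sum of squares, because the sup norm carried by row vectors is not differentiable. *)
pose rr (z : 'rV[R]_d) := e1 ^+ 2 - \sum_i (z 0 i - y0 0 i) ^+ 2.
pose m (z : 'rV[R]_d) := Num.max 0 (rr z).
have m0 z : 0 <= m z by rewrite le_max lexx.
have me z : m z <= e1 ^+ 2.
  rewrite /m /rr ge_max exprn_ge0 ?(ltW e10)//= gerDl oppr_le0.
  by apply: sumr_ge0 => i _; exact: sqr_ge0.
have rr_coord z i : 0 < rr z -> `|z 0 i - y0 0 i| <= e1.
  rewrite subr_gt0 => H; rewrite -(@ler_pXn2r _ 2)// ?nnegrE ?(ltW e10)//.
  rewrite real_normK ?num_real//; apply: ltW; apply: le_lt_trans H.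
  by rewrite (bigD1 i)//= lerDl sumr_ge0// => j _; exact: sqr_ge0.
have rr_norm z : 0 < rr z -> `|y0 - z| <= e1.
  move=> H; apply: norm_le_coord => [|i0 i]; first exact: ltW.
  by rewrite [i0]ord1 !mxE distrC rr_coord.
have ball_e1 z : `|y0 - z| <= e1 -> ball y0 e z.
  by move=> H; rewrite -ball_normE /ball_/=; exact: le_lt_trans e1e.
(* The derivative is at most [kap * 4 * d * e1 ^+ 3] times the norm of the velocity, and the speed
   is at least [Num.sqrt l] times that norm; the added 1 keeps the denominator positive even if
   [d = 0]. *)
pose kap := Num.sqrt l / (4 * d%:R * e1 ^+ 3 + 1).
have kap0 : 0 < kap.
  by rewrite divr_gt0 ?sqrtr_gt0// ltr_wpDl// !mulr_ge0 ?exprn_ge0// ltW.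
pose h z := kap * m z ^+ 2.
pose psi x := if pselect (dom p x) then h (phi p x) else 0.
(* The image of a closed ball is compact, hence closed in [M]. A curve outside the chart domain is
   thus locally outside [K], where the function is 0: the two branches of its definition fit
   together. *)
pose K := chart_inv (g p) @` [set z | `|y0 - z| <= e1].
have cK : closed K.
  apply: compact_closed => //; apply: continuous_compact.
    apply: continuous_in_subspaceT => z /set_mem /= /ball_e1 /eP[[x [px _] [zE _]] _].
    by apply: chart_inv_cont; exists x.
  apply: bounded_closed_compact.
    exists (`|y0| + e1); split=> [|x x1 z /= zy]; first exact: num_real.
    rewrite -[z](subKr y0); apply: le_trans (ler_normB _ _) _.
    by apply: le_trans (ltW x1); rewrite lerD2l.
  rewrite (_ : [set z | _] = (fun z : 'rV[R]_d => `|y0 - z|) @^-1` [set t | t <= e1])//.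
  apply: preimage_closed => [z _|]; last exact: closed_le.
  have FF := nbhs_filter z.
  by apply: cvg_norm; apply: cvgB; [exact: cvg_cst|exact: cvg_id].
have Kdom x : K x -> dom p x.
  by move=> [z /= /ball_e1 /eP[[x' [px' _] [_ iz]] _] <-]; rewrite iz.
have notK x : ~ K x -> dom p x -> m (phi p x) = 0.
  move=> nK px; apply: max_l; rewrite leNgt; apply/negP => /rr_norm H.
  by apply: nK; exists (phi p x) => //; rewrite chart_mapK.
have crr z : {for z, continuous rr}.
  have FF := nbhs_filter z.
  apply: cvgB; first exact: cvg_cst.
  apply: cvg_bigsum => i; apply: cvgM; apply: cvgB; try exact: cvg_cst.
    exact: coord_continuous.
  exact: coord_continuous.
have cm z : {for z, continuous m}.
  have -> : m = fun z => (rr z + `|rr z|) / 2.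
    by apply/funext => z'; rewrite /m maxr_absE add0r sub0r normrN.
  have FF := nbhs_filter z.
  by apply: cvgM; [apply: cvgD; [exact: crr|apply: cvg_norm; exact: crr]|exact: cvg_cst].
have ch z : {for z, continuous h}.
  have FF := nbhs_filter z.
  by apply: cvgM; [exact: cvg_cst|apply: cvgM; exact: cm].
have psiE x : dom p x -> psi x = h (phi p x).
  by rewrite /psi; case: pselect.
have psi0 x : ~ K x -> psi x = 0.
  move=> nK; rewrite /psi; case: pselect => // px.
  by rewrite /h (notK _ nK px) expr0n mulr0.
exists psi; split.
- rewrite psiE// mulr_gt0// exprn_gt0// lt_max.
  by rewrite /rr big1 ?subr0 ?exprn_gt0 ?orbT// => i _; rewrite subrr expr0n.
- have c1 : {for p, continuous (h \o phi p)} by exact: (continuous_comp (chart_map_cont pp) (ch _)).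
  suff : psi x @[x --> p] --> psi p by [].
  rewrite (psiE p pp); apply: cvg_trans c1; apply: near_eq_cvg.
  by apply: filterS (dom_near pp) => x px; rewrite psiE.
- move=> y nUy; apply: psi0 => Ky; apply: nUy.
  move: Ky => [z /= /ball_e1 /eP[[x [px Ux] [_ iz]] _] <-].
  by rewrite iz.
move=> c C1c; have [cc dc] := C1c.
pose w := phi p \o c.
pose S t := - \sum_i 2 * (w t 0 i - y0 0 i) * derive1 w t 0 i.
pose D t := kap * (2 * m (w t) * S t).
have near_dom t : dom p (c t) -> \forall s \near t, dom p (c s).
  by move=> pt; exact: (cc t _ (dom_near pt)).
have near_notK t : ~ dom p (c t) -> \forall s \near t, ~ K (c s).
  move=> npt; have oK : open (~` K) by exact: closed_openC.
  have nK : nbhs (c t) (~` K) by apply: open_nbhs_nbhs; split=> // /Kdom.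
  exact: (cc t _ nK).
have dw t : dom p (c t) -> derivable w t 1 by move=> pt; exact: (dc p t pt).1.
pose U' t := if pselect (dom p (c t)) then D t else 0.
exists U'.
  move=> t; suff : U' s @[s --> t] --> U' t by [].
  rewrite {2}/U'; case: pselect => pt.
    have cw i : w s 0 i @[s --> t] --> w t 0 i.
      have [dwi _] := is_derive_coord i (dw t pt).
      by apply: differentiable_continuous; exact/derivable1_diffP.
    have cw' i : derive1 w s 0 i @[s --> t] --> derive1 w t 0 i.
      have [_ cd] := dc p t pt.
      exact: (cvg_comp _ (fun A : 'rV[R]_d => A 0 i) cd (@coord_continuous _ _ _ 0 i _)).
    have cmw : m (w s) @[s --> t] --> m (w t).
      have cwt : {for t, continuous w}.
        by apply: differentiable_continuous; exact/derivable1_diffP/dw.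
      exact: (continuous_comp cwt (cm _)).
    have cD : D s @[s --> t] --> D t.
      apply: cvgM; first exact: cvg_cst.
      apply: cvgM; first by apply: cvgM; [exact: cvg_cst|exact: cmw].
      apply: cvgN; apply: cvg_bigsum => i; apply: cvgM; last exact: cw'.
      by apply: cvgM; [exact: cvg_cst|apply: cvgB; [exact: cw|exact: cvg_cst]].
    apply: cvg_trans cD; apply: near_eq_cvg.
    by apply: filterS (near_dom t pt) => s ps; rewrite /U'; case: pselect.
  have c0 : (fun _ : R => 0 : R) s @[s --> t] --> (0 : R) by exact: cvg_cst.
  apply: cvg_trans c0; apply: near_eq_cvg.
  apply: filterS (near_notK t pt) => s nK; rewrite /U'; case: pselect => // ps.
  by rewrite /D (notK _ nK ps) mulr0 mul0r mulr0.
move=> t; rewrite /U'; case: pselect => pt; last first.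
  split; last by rewrite normr0 sqrtr_ge0.
  have d0 : is_derive t 1 (fun _ : R => 0 : R) 0 by exact: is_derive_cst.
  apply: (near_eq_is_derive _ d0).
  by apply: filterS (near_notK t pt) => s nK /=; rewrite psi0.
split.
  have drr : is_derive t 1 (fun s => rr (w s)) (S t).
    have dsum : is_derive t 1 (fun s => \sum_i (w s 0 i - y0 0 i) ^+ 2)
        (\sum_i 2 * (w t 0 i - y0 0 i) * derive1 w t 0 i).
      apply: is_derive_bigsum => i.
      have d1 := is_derive_coord i (dw t pt).
      have d2 : is_derive t 1 (fun s => w s 0 i - y0 0 i) (derive1 w t 0 i - 0).
        by apply: is_deriveB; exact: is_derive_cst.
      have := @is_deriveX R R^o _ 2 t 1 _ d2.
      by rewrite /= expr1 subr0 /GRing.scale.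
    have := @is_deriveB R R^o R^o _ _ t 1 _ _ (is_derive_cst (e1 ^+ 2 : R^o) t 1) dsum.
    by rewrite sub0r.
  have dcomp := @is_derive1_comp R _ _ t _ _ (is_derive_max0_sqr (rr (w t))) drr.
  have dh := @is_deriveZ R R^o R^o _ kap t 1 _ dcomp.
  apply: (near_eq_is_derive _ dh).
  by apply: filterS (near_dom t pt) => s ps; rewrite /= psiE.
rewrite (speedE C1c pt).
have [m1|/negP] := eqVneq (m (w t)) 0.
  by rewrite /D m1 mulr0 mul0r mulr0 normr0 sqrtr_ge0.
move=> /negP mn0; have mpos : 0 < m (w t) by rewrite lt_neqAle eq_sym mn0 m0.
have rpos : 0 < rr (w t) by move: mpos; rewrite lt_max ltxx.
have [_ lq] := eP _ (ball_e1 _ (rr_norm _ rpos)).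
have SD : `|S t| <= d%:R * (2 * e1 * `|derive1 w t|); last first.
  exact: (speed_bound e10 (ler0n _ d) l0 (m0 (w t)) (me (w t)) (normr_ge0 _) (lq _) SD).
rewrite normrN; apply: le_trans (ler_norm_sum _ _ _) _.
have -> : d%:R * (2 * e1 * `|derive1 w t|) = \sum_(i < d) (2 * e1 * `|derive1 w t|).
  by rewrite sumr_const card_ord mulr_natl.
apply: ler_sum => i _.
rewrite !normrM; apply: ler_pM => //; last exact: coord_le_norm.
by rewrite gtr0_norm// ler_wpM2l// rr_coord.
Qed.

(* No measurability of the speed is needed: the integral of nonnegative
   functions is monotone without it. *)
Lemma riemannian_dist_lower_bound (psi : M -> R) x y :
  (forall c, C1_curve g c -> exists2 u' : R -> R, continuous u' &
    forall t : R, is_derive t 1 (psi \o c) (u' t) /\ `|u' t| <= speed g c t) ->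
  (`|psi y - psi x|%:E <= riemannian_dist g x y)%E.
Proof.
move=> lip; apply: le_ereal_inf_tmp => _ [cs + <-].
elim: cs x => [|c cs IH] x /=.
  by move=> ->; rewrite subrr normr0 big_nil.
move=> [C1c <- /IH H]; rewrite big_cons.
have [u' cu' du] := lip c C1c.
have H1 : (`|psi (c 1) - psi (c 0)|%:E <= arc_length g c)%E.
  apply: (@ftc_lower_bound _ (psi \o c) u' (speed g c)) => // t.
    by case: (du t).
  by case: (du t).
apply: le_trans (leeD H1 H); rewrite -EFinD lee_fin.
rewrite (_ : psi y - psi (c 0) = (psi (c 1) - psi (c 0)) + (psi y - psi (c 1))).
  exact: ler_normD.
by ring.
Qed.

(** The bump function vanishes off [U] and exceeds half of [psi p] on [W]; being 1-Lipschitz, it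
    keeps the two sets that far apart. *)
Lemma riemannian_dist_compl p (U : set M) : hausdorff_space M -> open U -> U p ->
  exists (W : set M) (e : R), [/\ open W, W p, 0 < e &
    forall x y, W x -> ~ U y -> (e%:E <= riemannian_dist g y x)%E].
Proof.
move=> hM oU Up; have [psi [psip cpsi psiU lip]] := local_bump hM oU Up.
have : nbhs p [set x | psi p / 2 < psi x].
  by apply: (cvgr_gt _ cpsi); rewrite ltr_pdivrMr// ltr_pMr// ltr1n.
rewrite nbhsE => -[W [oW Wp] WP].
exists W, (psi p / 2); split=> //; first by rewrite divr_gt0.
move=> x y Wx nUy; apply: le_trans (riemannian_dist_lower_bound y x lip).
rewrite (psiU y nUy) subr0 lee_fin; apply: le_trans (ler_norm _).
exact/ltW/WP.
Qed.

End lengths.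

(** By compactness the local gaps of [riemannian_dist_compl] combine into a uniform positive
    distance [e] between [S] and the complement of [U]. *)
Lemma shrinking_nbhs_eventually {R : realType} {d : nat} {M : ptopologicalType}
    (g : riemannian_manifold R d M) (V : nat -> set M) (S U : set M) :
  compact [set: M] -> closed S -> open U -> S `<=` U ->
  (fun m => hausdorff_dist g (V m) S) @ \oo --> (0 : \bar R) ->
  exists m0, forall m, (m0 <= m)%N -> V m `<=` U.
Proof.
move=> cM cS oU SU cV; have hM := manifold_hausdorff g.
have H p : exists We : set M * R, [/\ open We.1, We.1 p, 0 < We.2 &
    forall x y, We.1 x -> S x -> ~ U y -> (We.2%:E <= riemannian_dist g y x)%E].
  have [Sp|nSp] := pselect (S p).
    have [W [e [oW Wp e0 HW]]] := riemannian_dist_compl g hM oU (SU p Sp).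
    by exists (W, e); split=> // x y Wx _; exact: HW.
  (* Away from [S] the required estimate is vacuous, so any positive constant will do. *)
  exists (~` S, 1); split=> //; first exact: closed_openC.
have [We WeP] := choice H.
have [s sP] := compact_finite_cover (U := fun p => (We p).1) cM
  (fun p => let: And4 o _ _ _ := WeP p in o) (fun p => let: And4 _ o _ _ := WeP p in o).
have [e e0 es] : exists2 e : R, 0 < e & forall p, p \in s -> e <= (We p).2.
  elim: (s) => [|p t [e e0 et]]; first by exists 1.
  exists (Num.min (We p).2 e); first by rewrite lt_min e0 andbT; case: (WeP p).
  move=> q; rewrite inE => /predU1P[->|/et qe]; first by rewrite ge_min lexx.
  by rewrite ge_min qe orbT.
have eW x y : S x -> ~ U y -> (e%:E <= riemannian_dist g y x)%E.
  move=> Sx nUy; have [p ps Wx] := sP x; have [_ _ _ /(_ x y Wx Sx nUy)] := WeP p.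
  by apply: le_trans; rewrite lee_fin es.
have e0' : (0 < e%:E)%E by rewrite lte_fin.
have [m0 _ Hm0] := cV _ (open_ereal_lt' e0').
exists m0 => m m0m x Vx; apply: contrapT => nUx.
(* A point [x] of [V m] outside [U] is at distance at least [e] from [S], which bounds from below
   the half of the Hausdorff distance that measures [V m] against [S]. *)
have := Hm0 m m0m; apply/negP; rewrite /= -leNgt /hausdorff_dist !le_max.
apply/orP; right; apply/orP; left.
apply: (@le_trans _ _ (ereal_inf [set riemannian_dist g x y | y in S])).
  by apply: le_ereal_inf_tmp => _ [y Sy <-]; exact: eW.
by apply: ereal_sup_ubound; exists x.
Qed.

Theorem corollary1p2 (R : realType) (d : nat) (M : ptopologicalType)
    (g : riemannian_manifold R d M) (M_compact : compact [set: M])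
    (r : R) (r_gt1 : 1 < r) (f : M -> M) (f_Cr : Cr_map g r f)
    (V : nat -> set M) (V_nbhs : shrinking_nbhs g f V)
    (eta : nat -> R) (eta_gt0 : forall m, 0 < eta m)
    (eta_cvg0 : eta @ \oo --> (0 : R))
    (mus : nat -> probability (borel M) R) (mu : probability (borel M) R)
    (mus_rate : forall n, degenerate_rate g f V eta (mus n))
    (mus_cvg : weak_star_cvg mus mu) :
  (limn_esup (fun n => entropy_production g f (mus n))
     <= entropy_production g f mu)%E.
Proof.
have J_cont := abs_jac_cont r_gt1 f_Cr.
have [V_open V_sup _ V_cvg] := V_nbhs.
have [c _ cmax] := compact_EVT_max (ex_intro _ point I) M_compact (continuous_subspaceT J_cont).
(* The maximum with 1 makes [ln J0] nonnegative, as the truncated losses require. *)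
pose J0 := Num.max 1 (abs_jac g f c).
have J0_ge1 : 1 <= J0 by rewrite le_max lexx.
have J_le x : abs_jac g f x <= J0 by rewrite le_max cmax ?orbT// inE.
have [C fiber_bound] := abs_jac_fiber_bound r_gt1 f_Cr M_compact J_le.
have V_shrink U : open U -> critical_set g f `<=` U ->
    exists m0, forall m, (m0 <= m)%N -> V m `<=` U.
  move=> oU SU; apply: (shrinking_nbhs_eventually M_compact _ oU SU V_cvg).
  rewrite (_ : critical_set g f = abs_jac g f @^-1` [set 0])//.
  by apply: preimage_closed => // x _; exact: J_cont.
exact: (@entropy_production_limsup _ _ (manifold_hausdorff g) M_compact
  (abs_jac g f) J_cont (abs_jac_ge0 g f) J0 J0_ge1 J_le (manifold_second_countable g)
  f (f_continuous f_Cr) (@abs_jac_locally_injective _ _ _ g r r_gt1 f f_Cr)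
  (holder_power r * d)%N C fiber_bound V V_open V_shrink V_sup eta eta_cvg0 mus mu mus_rate mus_cvg).
Qed.
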